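(* Let $X$ be the toric variety of a fan $\Sigma$ in a tropical torus $\mathfrak T$, with big torus $T$, let $c=(J,\pi,\omega)$ be a tangency condition, let $\Delta=\Delta(c)$ be the associated tropical degree, let $I$ be a finite nonempty set disjoint from $J$, let $L_0=I\cup J$, and fix $i_0\in I$. Then, with respect to the embedding of the moduli space $M^{\mathrm{lab}}_{0,I}(X,c)$ into the algebraic torus $\mathbb G_m^{D(L_0)}/\mathbb G_m^{L_0}\times T$ given by Plücker coordinates and evaluation at $i_0$, its tropicalization is the tropical moduli space $\mathfrak M^{\mathrm{lab}}_{0,I}(\mathfrak T,\Delta)$ (embedded in $\mathbb R^{D(L_0)}/\operatorname{Im}\Phi\times\mathfrak T$ by $\mathfrak{pl}\times\mathfrak{ev}_{i_0}$, all weights being $1$): $$\operatorname{Trop}\bigl(M^{\mathrm{lab}}_{0,I}(X,c)\bigr)=\mathfrak M^{\mathrm{lab}}_{0,I}(\mathfrak T,\Delta).$$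
   Context: Ground field: $(K,\nu)$ is an algebraically closed valued field of characteristic $0$ (valuation possibly trivial), with valuation ring $R$ and residue field $\kappa$. For a set $S$, $D(S)$ is the set of ordered pairs of distinct elements of $S$. A tropical torus is a finite-dimensional real vector space $\mathfrak T$ with a lattice $N_{\mathfrak T}$ with $N_{\mathfrak T}\otimes\mathbb R=\mathfrak T$; the tropicalization of an algebraic torus is (one-parameter subgroup lattice)$\,\otimes\,\mathbb R$. Tropicalization: for a pure-dimensional closed subscheme $Y$ of an algebraic torus $T'=\operatorname{Spec}K[M']$ and $\mathfrak t\in\operatorname{Hom}(M',\mathbb R)$, $\operatorname{in}_{\mathfrak t}Y$ is the special fiber of the closure of $t^{-1}Y$ in $\operatorname{Spec}R[M']$, with $t\in T'$ such that $\nu(m(t))=\langle m,\mathfrak t\rangle$ for all $m\in M'$ (after a valued field extension if necessary). $\operatorname{Trop}(Y)$ is the tropical cycle with support $\{\mathfrak t:\operatorname{in}_{\mathfrak t}Y\neq\emptyset\}$ and weight at a generic point $\mathfrak t$ equal to the sum of multiplicities of the components of $\operatorname{in}_{\mathfrak t}Y$. Toric setting: $\Sigma$ is a rational polyhedral strongly convex fan in $\mathfrak T$ whose rays span $\mathfrak T$; $\Sigma$ consists only of its rays $\Sigma(1)$ and $\{0\}$. $X=X_\Sigma$ is the (smooth) toric variety over $K$ with big torus $T$ (one-parameter subgroup lattice $N_{\mathfrak T}$), $D_\rho$ the boundary divisor of $\rho\in\Sigma(1)$, $u_\rho$ the primitive lattice vector of $\rho$. A tangency condition is $c=(J,\pi,\omega)$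 with $J$ a finite set, $\pi:J\to\Sigma(1)$, $\omega:J\to\mathbb N_{>0}$ such that $\sum_\rho d_\rho(c)u_\rho=0$, where $d_\rho(c)=\sum_{j\in\pi^{-1}\{\rho\}}\omega(j)$. Its tropical degree is $\Delta(c):J\to N_{\mathfrak T}$, $j\mapsto\omega(j)u_{\pi(j)}$. It is assumed that $|L_0|\ge3$. Algebraic curves: a labeled parametrized $I$-marked rational curve in $X$ satisfying $c$ is $(C,(p_\lambda)_{\lambda\in L_0},f)$ with $C\cong\mathbb P^1$, distinct points $p_\lambda\in C$, and a morphism $f:C\to X$ whose image is not contained in the boundary, such that $f^*(D_\rho)=\sum_{\lambda\in\pi^{-1}\{\rho\}}\omega(\lambda)p_\lambda$ for all $\rho\in\Sigma(1)$. $M^{\mathrm{lab}}_{0,I}(X,c)$ is the set of isomorphism classes. Such a curve is determined by the points $(p_\lambda)$ and $f(p_{i_0})\in T$, and every tuple of distinct points together with a point of $T$ occurs. The torus embedding: write $C=\mathbb P^1$, $p_\lambda=(b_\lambda:a_\lambda)$; the class of the curve is sent to $\bigl([(b_\lambda a_\mu-a_\lambda b_\mu)_{(\lambda,\mu)}],f(p_{i_0})\bigr)\in\mathbb G_m^{D(L_0)}/\mathbb G_m^{L_0}\times T$, where $(x_\lambda)\in\mathbb G_m^{L_0}$ acts through $(x_\lambda x_\mu)_{(\lambda,\mu)}$. This is injective, and $M^{\mathrm{lab}}_{0,I}(X,c)$ is identified with its image, a closed subvariety. Tropical curves: an abstract rational tropical curve is a finite metric tree $\mathfrak C=(V,E,\ell)$,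 $\ell:E\to\mathbb R_{>0}\cup\{\infty\}$, without $2$-valent vertices and not consisting of exactly two vertices, such that the edges of infinite length are exactly those incident to a $1$-valent vertex (''legs''; the $1$-valent vertices are ''feet'', other vertices ''inner''); $\mathfrak C^\circ$ is $\mathfrak C$ without the feet. $\mathfrak M^{\mathrm{lab}}_{0,I}(\mathfrak T,\Delta)$ is the set of isomorphism classes of triples $(\mathfrak C,(e_\lambda)_{\lambda\in L_0},\mathfrak f)$, where $\lambda\mapsto e_\lambda$ is a bijection from $L_0$ to the legs of $\mathfrak C$ and $\mathfrak f:\mathfrak C^\circ\to\mathfrak T$ is continuous and affine linear on edges, with all direction vectors $\mathrm v(v,e)$ (derivative of $\mathfrak f|_e$ in the direction away from the inner vertex $v\in e$, with respect to length) in $N_{\mathfrak T}$, balanced ($\sum_{e\ni v}\mathrm v(v,e)=0$ at each inner vertex $v$), with direction $\Delta(j)$ on $e_j$ for $j\in J$ and direction $0$ on $e_i$ for $i\in I$. $\mathfrak{ev}_i$ ($i\in I$) sends such a curve to the point $\mathfrak f(e_i)$. Let $\operatorname{dist}_{\mathfrak C}(\lambda,\mu)$ be the distance between the inner vertices incident to $e_\lambda,e_\mu$, $\Phi:\mathbb R^{L_0}\to\mathbb R^{D(L_0)}$, $(x_\lambda)\mapsto(x_\lambda+x_\mu)_{(\lambda,\mu)}$, and $\mathfrak{pl}(\mathfrak C)=[(-\operatorname{dist}_{\mathfrak C}(\lambda,\mu)/2)_{(\lambda,\mu)}]\in\mathbb R^{D(L_0)}/\operatorname{Im}\Phi$ (with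 lattice the image of $\mathbb Z^{D(L_0)}$). The map $\mathfrak{pl}\times\mathfrak{ev}_{i_0}$ is injective and identifies $\mathfrak M^{\mathrm{lab}}_{0,I}(\mathfrak T,\Delta)$ with a tropical variety (all weights $1$) in $\mathbb R^{D(L_0)}/\operatorname{Im}\Phi\times\mathfrak T$, which is the tropicalization of $\mathbb G_m^{D(L_0)}/\mathbb G_m^{L_0}\times T$. *)

(* Defs.v *)
From HB Require Import structures.
From mathcomp Require Import all_boot all_order all_algebra finmap.
From mathcomp Require Import ring_quotient generic_quotient.
From mathcomp Require Import boolp classical_sets cardinality fsbigop.
From mathcomp Require Import reals constructive_ereal.

Set Implicit Arguments.
Unset Strict Implicit.
Unset Printing Implicit Defensive.

Import Order.TTheory GRing.Theory Num.Theory.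

Local Open Scope classical_set_scope.
Local Open Scope ring_scope.

(* F[M] for an additively written abelian group M, as finitely supported      *)
(* functions with the convolution product; for a lattice M it is the          *)
(* coordinate ring of a torus.                                                *)

Definition group_algebra (F : comNzRingType) (M : zmodType) : Type :=
  {fsfun M -> F with 0}.

Section GroupAlgebra.
Variables (F : comNzRingType) (M : zmodType).
Local Notation A := (group_algebra F M).
Implicit Types (f g h : A) (m n : M).

HB.instance Definition _ := Choice.on A.

Definition gcoef f m : F := (f : {fsfun M -> F with 0}) m.
Definition gsupp f : {fset M} := finsupp (f : {fsfun M -> F with 0}).
Definition gmk (s : {fset M}) (c : M -> F) : A := [fsfun m in s => c m | 0].

Lemma gcoefP f g : (forall m, gcoef f m = gcoef g m) -> f = g.
Proof. by move=> h; apply/fsfunP => m; exact: h. Qed.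

Lemma gcoef_mk s c m : gcoef (gmk s c) m = if m \in s then c m else 0.
Proof. by rewrite /gcoef /gmk fsfun_fun. Qed.

Lemma gcoef_out f m : m \notin gsupp f -> gcoef f m = 0.
Proof. exact: fsfun_dflt. Qed.

Lemma gcoef_mk_supp f (c : M -> F) m :
  (gcoef f m = 0 -> c m = 0) -> gcoef (gmk (gsupp f) c) m = c m.
Proof.
by move=> h; rewrite gcoef_mk; case: ifPn => // /gcoef_out /h ->.
Qed.

Definition gzero : A := gmk fset0 (fun=> 0).
Definition gopp f : A := gmk (gsupp f) (fun m => - gcoef f m).
Definition gadd f g : A :=
  gmk (gsupp f `|` gsupp g)%fset (fun m => gcoef f m + gcoef g m).
(* c X^m *)
Definition gmon (c : F) (m : M) : A := gmk [fset m]%fset (fun=> c).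

Lemma gcoef_zero m : gcoef gzero m = 0.
Proof. by rewrite gcoef_mk. Qed.

Lemma gcoef_opp f m : gcoef (gopp f) m = - gcoef f m.
Proof. by rewrite gcoef_mk_supp // => ->; rewrite oppr0. Qed.

Lemma gcoef_add f g m : gcoef (gadd f g) m = gcoef f m + gcoef g m.
Proof.
rewrite gcoef_mk in_fsetE; case: ifPn => //; rewrite negb_or => /andP[hf hg].
by rewrite !gcoef_out // addr0.
Qed.

Lemma gcoef_mon c m n : gcoef (gmon c m) n = c *+ (n == m).
Proof. by rewrite gcoef_mk in_fsetE; case: eqP. Qed.

Fact gaddA : associative gadd.
Proof. by move=> f g h; apply: gcoefP => m; rewrite !gcoef_add addrA. Qed.
Fact gaddC : commutative gadd.
Proof. by move=> f g; apply: gcoefP => m; rewrite !gcoef_add addrC. Qed.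
Fact gadd0 : left_id gzero gadd.
Proof. by move=> f; apply: gcoefP => m; rewrite gcoef_add gcoef_zero add0r. Qed.
Fact gaddN : left_inverse gzero gopp gadd.
Proof.
by move=> f; apply: gcoefP => m; rewrite gcoef_add gcoef_opp gcoef_zero addNr.
Qed.

HB.instance Definition _ := GRing.isZmodule.Build A gaddA gaddC gadd0 gaddN.

Lemma gcoef0 m : gcoef 0 m = 0. Proof. exact: gcoef_zero. Qed.
Lemma gcoefD f g m : gcoef (f + g) m = gcoef f m + gcoef g m.
Proof. exact: gcoef_add. Qed.
Lemma gcoefN f m : gcoef (- f) m = - gcoef f m.
Proof. exact: gcoef_opp. Qed.
Lemma gcoef_sum (T : Type) (s : seq T) (P : pred T) (G : T -> A) m :
  gcoef (\sum_(i <- s | P i) G i) m = \sum_(i <- s | P i) gcoef (G i) m.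
Proof.
by elim/big_rec2: _ => [|i y1 y2 _ <-]; rewrite ?gcoef0 ?gcoefD.
Qed.

Lemma gmon0 m : gmon 0 m = 0.
Proof. by apply: gcoefP => n; rewrite gcoef_mon mul0rn gcoef0. Qed.
Lemma gmonD c d m : gmon (c + d) m = gmon c m + gmon d m.
Proof. by apply: gcoefP => n; rewrite gcoefD !gcoef_mon mulrnDl. Qed.

Definition gmul f g : A :=
  \sum_(x <- gsupp f) \sum_(y <- gsupp g) gmon (gcoef f x * gcoef g y) (x + y).

Lemma gsum_widen (G : M -> A) f (s : {fset M}) :
  (forall m, gcoef f m = 0 -> G m = 0) -> {subset gsupp f <= s} ->
  \sum_(x <- gsupp f) G x = \sum_(x <- s) G x.
Proof.
move=> h /fsubsetP sub; apply: big_fset_incl => // x _ /gcoef_out; exact: h.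
Qed.

Lemma gmulE f g (s t : {fset M}) :
  {subset gsupp f <= s} -> {subset gsupp g <= t} ->
  gmul f g = \sum_(x <- s) \sum_(y <- t) gmon (gcoef f x * gcoef g y) (x + y).
Proof.
move=> hs ht; rewrite /gmul (gsum_widen _ hs) => [|m ->].
  by apply: eq_bigr => x _; apply: gsum_widen => // m ->; rewrite mulr0 gmon0.
by rewrite big1 // => y _; rewrite mul0r gmon0.
Qed.

Fact gmulDl : left_distributive gmul +%R.
Proof.
move=> f g h; pose s := (gsupp f `|` gsupp g `|` gsupp (f + g)%R)%fset.
have sf : {subset gsupp f <= s} by move=> x hx; rewrite !in_fsetE hx.
have sg : {subset gsupp g <= s} by move=> x hx; rewrite !in_fsetE hx orbT.
have sfg : {subset gsupp (f + g) <= s}.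
  by move=> x hx; rewrite !in_fsetE hx !orbT.
have sh : {subset gsupp h <= gsupp h} by [].
rewrite (gmulE sf sh) (gmulE sg sh) (gmulE sfg sh) -big_split /=.
apply: eq_bigr => x _; rewrite -big_split /=.
by apply: eq_bigr => y _; rewrite gcoefD mulrDl gmonD.
Qed.

Fact gmulC : commutative gmul.
Proof.
move=> f g; rewrite /gmul exchange_big /=.
by apply: eq_bigr => x _; apply: eq_bigr => y _; rewrite mulrC addrC.
Qed.

Lemma gmulDr f g h : gmul f (g + h) = gmul f g + gmul f h.
Proof. by rewrite gmulC gmulDl !(gmulC f). Qed.

Lemma gmul0l f : gmul 0 f = 0.
Proof. by apply: (addIr (gmul 0 f)); rewrite -gmulDl !add0r. Qed.
Lemma gmul0r f : gmul f 0 = 0.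
Proof. by rewrite gmulC gmul0l. Qed.

Lemma gmul_suml (T : Type) (s : seq T) (G : T -> A) g :
  gmul (\sum_(i <- s) G i) g = \sum_(i <- s) gmul (G i) g.
Proof.
elim: s => [|i s IH]; first by rewrite !big_nil gmul0l.
by rewrite !big_cons gmulDl IH.
Qed.
Lemma gmul_sumr (T : Type) (s : seq T) (G : T -> A) g :
  gmul g (\sum_(i <- s) G i) = \sum_(i <- s) gmul g (G i).
Proof. by rewrite gmulC gmul_suml; apply: eq_bigr => i _; rewrite gmulC. Qed.

Lemma gmulUU c d m n : gmul (gmon c m) (gmon d n) = gmon (c * d) (m + n).
Proof.
have sub a k : {subset gsupp (gmon a k) <= [fset k]%fset}.
  move=> x; apply: contraLR; rewrite in_fsetE => /negPf xk.
  by rewrite /gsupp mem_finsupp negbK -/(gcoef _ _) gcoef_mon xk.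
rewrite (gmulE (sub c m) (sub d n)) !big_seq_fset1.
by rewrite !gcoef_mon !eqxx.
Qed.

Lemma gsumE f : f = \sum_(x <- gsupp f) gmon (gcoef f x) x.
Proof.
apply: gcoefP => m; rewrite gcoef_sum.
have [hm|hm] := boolP (m \in gsupp f).
  rewrite (big_fsetD1 m) //= gcoef_mon eqxx big1_fset ?addr0 // => x.
  by rewrite in_fsetD1 => /andP[xm _] _; rewrite gcoef_mon eq_sym (negPf xm).
rewrite gcoef_out // big1_fset // => x hx _; rewrite gcoef_mon.
by case: eqP => // e; move: hm; rewrite e hx.
Qed.

Fact gmulA : associative gmul.
Proof.
move=> f g h; rewrite [f]gsumE [g]gsumE.
move: (gsupp f) (gsupp g) => s t; rewrite !gmul_suml.
apply: eq_bigr => x _; rewrite !(gmul_sumr t) gmul_suml.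
apply: eq_bigr => y _; rewrite [h]gsumE; move: (gsupp h) => u.
rewrite !gmul_sumr; apply: eq_bigr => z _.
by rewrite !gmulUU mulrA addrA.
Qed.

Definition gone : A := gmon 1 0.

Fact gmul1 : left_id gone gmul.
Proof.
move=> f; rewrite {1}[f]gsumE gmul_sumr [RHS]gsumE.
by apply: eq_bigr => x _; rewrite gmulUU mul1r add0r.
Qed.

Fact gone_neq0 : gone != 0.
Proof.
apply/eqP => /(congr1 (fun f => gcoef f 0)); rewrite gcoef0 gcoef_mon eqxx.
by move/eqP; rewrite oner_eq0.
Qed.

HB.instance Definition _ := GRing.Zmodule_isComNzRing.Build A
  gmulA gmulC gmul1 gmulDl gone_neq0.

End GroupAlgebra.

Definition gmap (F G : comNzRingType) (M : zmodType) (phi : F -> G)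
    (f : group_algebra F M) : group_algebra G M :=
  gmk (gsupp f) (fun m => phi (gcoef f m)).

Section Multiplicities.
Variable A : comNzRingType.
Implicit Types (I J P Q : set A).

Definition is_ideal I :=
  [/\ I 0, (forall a b, I a -> I b -> I (a + b)) & forall a b, I b -> I (a * b)].

Definition ideal_gen (S : set A) : set A :=
  [set a | forall I, is_ideal I -> S `<=` I -> I a].

Definition is_prime P :=
  [/\ is_ideal P, ~ P 1 & forall a b, P (a * b) -> P a \/ P b].

(* the generic points of the components of V(J) *)
Definition minimal_primes J : set (set A) :=
  [set P | [/\ is_prime P, J `<=` P &
    forall Q, is_prime Q -> J `<=` Q -> Q `<=` P -> Q = P]].

(* Elements of the local ring (A/J)_P are fractions a/s with s outside P;     *)
(* frac_eq is equality of fractions.                                          *)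
Definition frac_eq J P (a s a' s' : A) :=
  exists2 u, ~ P u & J (u * (s' * a - s * a')).

(* W a s stands for "a/s lies in the ideal W of (A/J)_P"; only the values of  *)
(* W at s outside P are meaningful.                                           *)
Definition is_local_ideal J P (W : A -> A -> Prop) :=
  [/\ forall a s a' s', ~ P s -> ~ P s' ->
        frac_eq J P a s a' s' -> W a s -> W a' s',
      W 0 1,
      forall a s a' s', ~ P s -> ~ P s' ->
        W a s -> W a' s' -> W (s' * a + s * a') (s * s') &
      forall b r a s, ~ P r -> ~ P s -> W a s -> W (b * a) (r * s)].

Definition strict_sub P (W W' : A -> A -> Prop) :=
  (forall a s, ~ P s -> W a s -> W' a s) /\
  exists a s, [/\ ~ P s, W' a s & ~ W a s].

Definition has_chain J P (n : nat) :=
  exists W : nat -> A -> A -> Prop,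
    (forall i, (i <= n)%N -> is_local_ideal J P (W i)) /\
    (forall i, (i < n)%N -> strict_sub P (W i) (W i.+1)).

(* n is the length of the local ring (A/J)_P *)
Definition has_length J P (n : nat) :=
  has_chain J P n /\ forall k, has_chain J P k -> (k <= n)%N.

Definition multiplicity J P : nat := xget 0%N [set n | has_length J P n].

Definition sum_multiplicities J : nat :=
  \big[addn/0%N]_(P \in minimal_primes J) multiplicity J P.

End Multiplicities.

Record valuation (R : realType) (F : fieldType) := Valuation {
  vfun :> F -> \bar R;
  v_pinfty : forall x, vfun x = +oo%E <-> x = 0;
  v_ninfty : forall x, vfun x <> -oo%E;
  vM : forall x y, vfun (x * y) = (vfun x + vfun y)%E;
  vD : forall x y, (Order.min (vfun x) (vfun y) <= vfun (x + y))%E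
}.

Section ResidueField.
Variables (R : realType) (F : fieldType) (v : valuation R F).

Lemma v0 : v 0 = +oo%E. Proof. exact/v_pinfty. Qed.

Lemma v_fin x : x != 0 -> exists r : R, v x = r%:E.
Proof.
move=> x0; case E : (v x) => [r| |]; first by exists r.
- by move/v_pinfty: E x0 => ->; rewrite eqxx.
- by case: (@v_ninfty _ _ v x).
Qed.

Lemma v1 : v 1 = 0%E.
Proof.
have [r E] := v_fin (oner_neq0 F).
have := vM v 1 1; rewrite mulr1 E -EFinD => -[] /eqP.
by rewrite -subr_eq0 opprD addNKr oppr_eq0 => /eqP ->.
Qed.

Lemma vN x : v (- x) = v x.
Proof.
have N1 : -1 != 0 :> F by rewrite oppr_eq0 oner_eq0.
have [r E] := v_fin N1; have := vM v (-1) (-1).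
rewrite mulrNN mulr1 v1 E -EFinD => -[] /esym/eqP.
by rewrite -mulr2n mulrn_eq0 /= => /eqP r0; rewrite -mulN1r vM E r0 add0e.
Qed.

Lemma vV x : x != 0 -> (v x + v (x^-1)%R)%E = 0%E.
Proof. by move=> x0; rewrite -vM divff // v1. Qed.

Definition vring_pred : {pred F} := [pred x | (0 <= v x)%E].

Fact vring_closed : subring_closed vring_pred.
Proof.
split=> [|x y|x y]; rewrite !inE ?v1 // => hx hy; last by rewrite vM adde_ge0.
by apply: le_trans (vD v x (- y)); rewrite le_min vN hx.
Qed.
HB.instance Definition _ := GRing.isSubringClosed.Build F vring_pred vring_closed.

Definition vring : Type := {x : F | x \in vring_pred}.
HB.instance Definition _ := SubChoice.on vring.
HB.instance Definition _ := [SubChoice_isSubComNzRing of vring by <:].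

Definition vmax : {pred vring} := [pred x | (0 < v (val x))%E].

Fact vmax_closed : idealr_closed vmax.
Proof.
split=> [||a x y]; rewrite !inE /= ?v0 ?v1 ?ltry ?ltxx // => hx hy.
apply: lt_le_trans (vD v _ _); rewrite lt_min hy andbT vM.
by apply: lt_le_trans hx _; rewrite leeDr //; exact: (valP a).
Qed.
HB.instance Definition _ := isIdealr.Build vring vmax vmax_closed.

Definition residue_field : Type := {ideal_quot vmax}.
HB.instance Definition _ := GRing.ComNzRing.on residue_field.

(* the reduction map; its value is 0 outside of the valuation ring *)
Definition residue (x : F) : residue_field :=
  \pi_({ideal_quot vmax})%qT (insubd (0 : vring) x).

Definition residue_inv (a : residue_field) : residue_field :=
  if a == 0 then 0 else residue (val (repr (a : {ideal_quot vmax})))^-1.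

Fact residue_mulV (a : residue_field) : a != 0 -> residue_inv a * a = 1.
Proof.
move=> a0; rewrite /residue_inv (negPf a0).
pose pi := \pi_({ideal_quot vmax})%qT.
set x : vring := repr _; have xE : pi x = a by rewrite /pi reprK.
have xmax : x \notin vmax.
  apply: contra a0; rewrite -[x]subr0 Quotient.idealrBE => /eqP.
  by rewrite -/pi xE => ->; apply/eqP; exact: rmorph0.
have x0 : val x != 0.
  by apply: contra xmax => /eqP x0; rewrite inE x0 v0 ltry.
have vx : v (val x) = 0%E.
  by apply/le_anti; rewrite leNgt xmax; exact: (valP x).
have xV : (val x)^-1 \in vring_pred.
  by rewrite inE; have := vV x0; rewrite vx add0e => ->.
rewrite -{1}xE /residue -/pi (_ : insubd _ _ = Sub (val x)^-1 xV); last first.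
  by apply: val_inj; rewrite val_insubd ifT.
rewrite /pi -[LHS](rmorphM (\pi_({ideal_quot vmax})%qT)).
rewrite (_ : _ * _ = 1); first exact: rmorph1.
by apply: val_inj; rewrite rmorphM /= mulVf.
Qed.
Fact residue_inv0 : residue_inv 0 = 0. Proof. by rewrite /residue_inv eqxx. Qed.
HB.instance Definition _ :=
  GRing.ComNzRing_isField.Build residue_field residue_mulV residue_inv0.
End ResidueField.

(* F-valued points of the torus with character lattice M: homomorphisms from  *)
(* M to the multiplicative group of F (t m is nonzero since t m * t (- m) = 1)*)
Record torus_point (M : zmodType) (F : fieldType) := TorusPoint {
  tfun :> M -> F;
  tfun0 : tfun 0 = 1;
  tfunD : forall m n, tfun (m + n) = tfun m * tfun n
}.

Section Tropicalization.
Variable M : zmodType.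

Definition geval (F : fieldType) (f : group_algebra F M) (y : torus_point M F) :=
  \sum_(m <- gsupp f) gcoef f m * y m.

Definition vanishing_ideal (F : fieldType) (Y : set (torus_point M F)) :
    set (group_algebra F M) :=
  [set f | forall y, Y y -> geval f y = 0].

(* f(x) |-> f(t x) *)
Definition translate (F : fieldType) (t : torus_point M F)
    (f : group_algebra F M) : group_algebra F M :=
  gmk (gsupp f) (fun m => gcoef f m * t m).

Definition base_change (K L : fieldType) (iota : K -> L)
    (I : set (group_algebra K M)) : set (group_algebra L M) :=
  ideal_gen (gmap iota @` I).

(* The ideal in kappa[M] of the special fiber of the closure of t^-1 Y in the *)
(* torus over the valuation ring, for Y = V(I) over the valued field F: the   *)
(* closure is cut out by the elements with coefficients in the valuation ring *)
(* of the ideal of t^-1 Y.                                                    *)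
Definition initial_ideal (R : realType) (F : fieldType) (v : valuation R F)
    (I : set (group_algebra F M)) (t : torus_point M F) :
    set (group_algebra (residue_field v) M) :=
  [set gmap (residue v) g | g in
     [set g | (translate t @` I) g /\ forall m, (0 <= v (gcoef g m))%E]].
Arguments initial_ideal {R F} v I t.

Section Trop.
Variables (R : realType) (K : fieldType) (v : valuation R K).
Variable I : set (group_algebra K M).
Implicit Types s : {additive M -> R}.

(* a valued field extension of (K, v), together with a point of the torus     *)
(* over it whose valuation is s                                               *)
Record lifting s := Lifting {
  lift_field : fieldType;
  lift_val : valuation R lift_field;
  lift_emb : {rmorphism K -> lift_field};
  lift_ext : forall x, lift_val (lift_emb x) = v x;
  lift_point : torus_point M lift_field;
  lift_pointE : forall m, lift_val (lift_point m) = (s m)%:E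
}.

Definition initial_degeneration s (l : lifting s) :
    set (group_algebra (residue_field (lift_val l)) M) :=
  initial_ideal (lift_val l) (base_change (lift_emb l) I) (lift_point l).
Arguments initial_degeneration {s} l.

(* V(J) is empty if and only if J contains 1 *)
Definition trop_support : set {additive M -> R} :=
  [set s | exists l : lifting s, ~ initial_degeneration l 1].

Definition has_trop_weight s (w : nat) :=
  exists l : lifting s, sum_multiplicities (initial_degeneration l) = w.

End Trop.

(* s is a generic point of S: near s, S is an affine subspace, i.e. s lies in *)
(* the relative interior of a maximal cell                                    *)
Definition is_generic (R : realType) (S : set {additive M -> R})
    (s : {additive M -> R}) :=
  S s /\
  exists V : set (M -> R),
    [/\ V (fun=> 0),
        forall f g, V f -> V g -> V (fun m => f m + g m),
        forall (a : R) f, V f -> V (fun m => a * f m) &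
        exists (e : R) (ms : seq M), 0 < e /\
          forall s' : {additive M -> R},
            (forall m, m \in ms -> `|s' m - s m| < e) ->
            (S s' <-> V (fun m => s' m - s m))].

(* Trop(V(I)) is the tropical cycle with support S and weight w *)
Definition trop_is (R : realType) (K : fieldType) (v : valuation R K)
    (I : set (group_algebra K M)) (S : set {additive M -> R})
    (w : {additive M -> R} -> nat) :=
  trop_support v I = S /\
  forall s, is_generic S s -> forall n, has_trop_weight v I s n <-> n = w s.

End Tropicalization.

Section Pluecker.
Variable L0 : finType.

Definition dpairs : Type := {p : L0 * L0 | p.1 != p.2}.
HB.instance Definition _ := Finite.on dpairs.

(* Characters of G_m^D(L0) that are trivial on the image of G_m^L0, i.e.      *)
(* characters of the quotient.                                                *)
Definition pl_char_pred : {pred {ffun dpairs -> int}} :=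
  [pred m : {ffun dpairs -> int} | [forall l : L0,
     \sum_(p : dpairs) m p *+ (((val p).1 == l) + ((val p).2 == l)) == 0]].

Fact pl_char_closed : zmod_closed pl_char_pred.
Proof.
split=> [|m n]; rewrite !inE.
  by apply/forallP => l; rewrite big1 // => p _; rewrite ffunE mul0rn.
move=> /forallP hm /forallP hn; apply/forallP => l.
under eq_bigr do rewrite !ffunE mulrnBl.
by rewrite sumrB (eqP (hm l)) (eqP (hn l)) subr0.
Qed.
HB.instance Definition _ :=
  GRing.isZmodClosed.Build {ffun dpairs -> int} pl_char_pred pl_char_closed.

Definition pl_char : Type := {m : {ffun dpairs -> int} | m \in pl_char_pred}.
HB.instance Definition _ := SubChoice.on pl_char.
HB.instance Definition _ := [SubChoice_isSubZmodule of pl_char by <:].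

(* Character lattice of G_m^D(L0) / G_m^L0 x T, where T has rank r.  Its real *)
(* dual is R^D(L0) / Im(Phi) x R^r.                                           *)
Definition ambient_char (r : nat) : zmodType := (pl_char * 'rV[int]_r)%type.

End Pluecker.

Definition pairing (r : nat) (m n : 'rV[int]_r) : int :=
  \sum_(i < r) m 0 i * n 0 i.

Definition to_real (R : realType) (r : nat) (n : 'rV[int]_r) : 'rV[R]_r :=
  map_mx intr n.

(* The fan in R^r (with lattice Z^r) consisting of 0 and the rays spanned by  *)
(* the primitive vectors prim rho.                                            *)
Record fan1 (R : realType) (r : nat) := Fan1 {
  ray : finType;
  prim : ray -> 'rV[int]_r;
  prim_primitive : forall rho (d : int) n, prim rho = d *: n -> `|d| = 1;
  prim_inj : injective prim;
  prim_span : forall x : 'rV[R]_r, exists a : ray -> R,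
    x = \sum_rho a rho *: to_real R (prim rho)
}.

Section Toric.
Variables (R : realType) (r : nat) (Sigma : fan1 R r) (K : fieldType).
Local Notation cone := (option (ray Sigma)). (* None is the cone 0 *)

Definition in_dual (sigma : cone) (m : 'rV[int]_r) : bool :=
  if sigma is Some rho then 0 <= pairing m (prim rho) else true.
Definition in_perp (sigma : cone) (m : 'rV[int]_r) : bool :=
  if sigma is Some rho then pairing m (prim rho) == 0 else true.

(* A K-point of X_Sigma: the cone sigma whose torus orbit contains it, and    *)
(* the semigroup homomorphism from the lattice points of the dual cone of     *)
(* sigma to K that gives it in U_sigma.  It is nonzero exactly on the lattice *)
(* points of the orthogonal of sigma; we extend it by 0 to all characters.    *)
Record toric_point := ToricPoint {
  orbit_cone : cone;
  chi :> 'rV[int]_r -> K;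
  chi0 : chi 0 = 1;
  chiD : forall m n, in_dual orbit_cone m -> in_dual orbit_cone n ->
    chi (m + n) = chi m * chi n;
  chi_neq0 : forall m, (chi m != 0) = in_perp orbit_cone m
}.

(* x lies in the affine chart U_sigma, whose coordinate ring is spanned by    *)
(* the characters in the dual cone of sigma *)
Definition in_chart (sigma : cone) (x : toric_point) : bool :=
  (orbit_cone x == None) || (orbit_cone x == sigma).

(* Points of P^1 are given by homogeneous coordinates q = (b, a) != 0.        *)
Definition wedge (p q : K * K) : K := p.1 * q.2 - p.2 * q.1.

Definition form (d : nat) (h : {poly K}) (q : K * K) : K :=
  \sum_(i < d.+1) h`_i * q.1 ^+ i * q.2 ^+ (d - i).

Definition is_morphism (f : K * K -> toric_point) :=
  [/\ forall (a : K) q, a != 0 -> q != 0 -> f (a * q.1, a * q.2) = f q,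
      forall sigma p, p != 0 -> in_chart sigma (f p) ->
        exists d h, form d h p != 0 /\
          forall q, q != 0 -> form d h q != 0 -> in_chart sigma (f q) &
      forall sigma p m, p != 0 -> in_chart sigma (f p) -> in_dual sigma m ->
        exists d h k, form d k p != 0 /\
          forall q, q != 0 -> in_chart sigma (f q) -> form d k q != 0 ->
            f q m = form d h q / form d k q].

(* The multiplicity of p in f^* D_rho is n.  On U_rho, the divisor D_rho is   *)
(* cut out by any character m with <m, u_rho> = 1; q |-> wedge q p is the     *)
(* linear form vanishing at p.                                                *)
Definition has_pullback_mult (f : K * K -> toric_point) (rho : ray Sigma)
    (p : K * K) (n : nat) :=
  if in_chart (Some rho) (f p) then
    forall m, pairing m (prim rho) = 1 ->
      exists d h k, [/\ form d h p != 0, form (n + d) k p != 0 &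
        forall q, q != 0 -> in_chart (Some rho) (f q) -> form (n + d) k q != 0 ->
          f q m = wedge q p ^+ n * form d h q / form (n + d) k q]
  else n = 0%N.

End Toric.

Record tangency (R : realType) (r : nat) (Sigma : fan1 R r) (J : finType) :=
  Tangency {
    tray : J -> ray Sigma;
    tord : J -> nat;
    tord_gt0 : forall j, (0 < tord j)%N;
    tbalanced : \sum_rho (\sum_(j | tray j == rho) tord j)%N%:Z *: prim rho = 0
  }.

Section Moduli.
Variables (R : realType) (r : nat) (Sigma : fan1 R r) (J I : finType).
Variables (c : tangency Sigma J) (i0 : I).
Local Notation L0 := (I + J)%type.

(* (P^1, (p_l), f); every curve is isomorphic to one with C = P^1 *)
Record alg_curve (K : fieldType) := AlgCurve {
  mark : L0 -> K * K;
  mark_neq0 : forall l, mark l != 0;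
  mark_distinct : forall l l', l != l' -> wedge (mark l) (mark l') != 0;
  cmap : K * K -> toric_point Sigma K;
  cmap_morphism : is_morphism cmap;
  cmap_boundary : exists2 q, q != 0 & orbit_cone (cmap q) = None;
  cmap_tangency : forall rho q, q != 0 -> has_pullback_mult cmap rho q
    (\sum_(j | (tray c j == rho) && (wedge (mark (inr j)) q == 0%R)) tord c j)
}.

(* The image of the moduli space under Plücker coordinates and evaluation at  *)
(* i0, each character m of the quotient torus being evaluated on it.          *)
Definition Mlab (K : fieldType) : set (torus_point (ambient_char L0 r) K) :=
  [set y | exists C : alg_curve K, forall m : ambient_char L0 r,
    y m = (\prod_(p : dpairs L0)
             wedge (mark C (val p).1) (mark C (val p).2) ^ (val m.1 p))
          * cmap C (mark C (inl i0)) m.2].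

Definition leg_direction (l : L0) : 'rV[int]_r :=
  match l with
  | inl _ => 0
  | inr j => (tord c j)%:Z *: prim (tray c j)
  end.

End Moduli.

Section Graphs.
Variables (V : finType) (adj : rel V).

Definition is_tree :=
  [/\ exists x : V, true, symmetric adj, irreflexive adj,
      forall x y, connect adj x y &
      forall s : seq V, (2 < size s)%N -> ~~ (cycle adj s && uniq s)].

Definition valence (x : V) : nat := #|[set y | adj x y]|.
Definition foot x := valence x == 1%N.
Definition inner x := ~~ foot x.

Definition legs : {set {set V}} :=
  [set [set p.1; p.2]%SET | p in [pred p : V * V | adj p.1 p.2 && foot p.2]]%SET.

End Graphs.

Section TropicalCurves.
Variables (R : realType) (r : nat) (L0 : finType) (Delta : L0 -> 'rV[int]_r).

Record trop_curve := TropCurve {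
  vert : finType;
  adj : rel vert;
  tc_tree : is_tree adj;
  tc_valence : forall x, valence adj x != 2%N;
  tc_card : #|vert| != 2%N;
  len : vert -> vert -> \bar R;
  len_sym : forall x y, len x y = len y x;
  len_gt0 : forall x y, adj x y -> (0 < len x y)%E;
  len_leg : forall x y, adj x y ->
    (len x y == +oo%E) = foot adj x || foot adj y
}.

(* The continuous map from the curve without *)
(* its feet to R^r, affine linear on edges, is given by the images of the     *)
(* inner vertices and by the direction vectors: tdir x y is the direction     *)
(* vector at the inner vertex x of the edge {x, y}.                           *)
Record param_trop_curve := ParamTropCurve {
  tcurve :> trop_curve;
  leg : L0 -> {set vert tcurve};
  leg_inj : injective leg;
  leg_legs : [set leg l | l in L0]%SET = legs (@adj tcurve);
  tpos : vert tcurve -> 'rV[R]_r;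
  tdir : vert tcurve -> vert tcurve -> 'rV[int]_r;
  tdir_edge : forall x y, adj x y -> inner (@adj tcurve) x ->
    inner (@adj tcurve) y ->
    tpos y = tpos x + fine (len x y) *: to_real R (tdir x y);
  tdir_balanced : forall x, inner (@adj tcurve) x ->
    \sum_(y | adj x y) tdir x y = 0;
  tdir_leg : forall l x y, leg l = [set x; y]%SET -> adj x y ->
    inner (@adj tcurve) x -> foot (@adj tcurve) y -> tdir x y = Delta l
}.

(* x is the inner vertex incident to the leg marked by l *)
Definition leg_end (C : param_trop_curve) (l : L0) (x : vert C) :=
  x \in leg C l /\ inner (@adj C) x.

Definition has_dist (C : trop_curve) (x y : vert C) (d : R) :=
  exists p : seq (vert C),
    [/\ path (@adj C) x p, uniq (x :: p), last x p = y &
        (\sum_(e <- zip (x :: p) p) len e.1 e.2)%E = d%:E].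

(* The image of the moduli space under pl x ev_{i0}, as a subset of the real  *)
(* dual of the ambient character lattice.  The leg i0 is contracted, so the   *)
(* evaluation at i0 is the position of its inner vertex.                      *)
Definition Mtrop (i0 : L0) : set {additive ambient_char L0 r -> R} :=
  [set s | exists (C : param_trop_curve) (e : L0 -> vert C)
      (dist : dpairs L0 -> R),
    [/\ forall l, leg_end l (e l),
        forall p : dpairs L0, has_dist (e (val p).1) (e (val p).2) (dist p) &
        forall m : ambient_char L0 r,
          s m = (\sum_(p : dpairs L0) (val m.1 p)%:~R * (- dist p / 2))
                + \sum_(i < r) (m.2 0 i)%:~R * tpos (e i0) 0 i]].

End TropicalCurves.

(* Main.v *)
(* Put the marking i0 at infinity.  The class of a marked line is then given by
   the differences x_a - x_b of the coordinates of the other markings, up to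
   scaling, and the tropicalization consists of the s for which
   u(a, b) = s(x_a - x_b) is an ultrametric: one inclusion comes from the
   relations (x_a - x_b) + (x_b - x_c) + (x_c - x_a) = 0, and for the other one
   an ultrametric is realized by x_a = x_p(a) + z_a, where p(a) is the nearest
   among the markings that follow a and the z_a are independent elements of
   prescribed valuation in a Gauss extension.  Trees with leaves marked by L0
   correspond to the ultrametrics: u(a, b) is the length of the common part of
   the paths from i0 to a and b, and conversely the balls of u form a laminar
   family.  At a generic s no three distances are equal, so that each triple
   relation specializes to a binomial; these binomials and the independence of
   the z_a identify the initial ideal with the kernel of the specialization at
   the Gauss point, a prime ideal, and all weights are 1. *)

Require Import Defs.
From HB Require Import structures.
From mathcomp Require Import all_boot all_order all_algebra.
From mathcomp Require Import reals constructive_ereal lra ring zify.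
From mathcomp Require boolp classical_sets.

Set Implicit Arguments.
Unset Strict Implicit.
Unset Printing Implicit Defensive.
Import Order.TTheory GRing.Theory Num.Theory.
Local Open Scope ring_scope.

(** * Paths in trees *)

(** The weight has to be 1 for every lifting, that is, for every valued extension and every point of
    valuation [s] over it. So the Gauss extension is built on top of an arbitrary lifting field, and
    its independence is stated through valuations, with coefficients in that field. Primality comes
    from the multiplicativity of a valuation: the polynomials over the valuation ring whose value at
    the translated Gauss point has positive valuation reduce to a prime ideal. It always contains
    the initial ideal; only the converse needs genericity. The moduli space enters through its
    K-points, and that its ideal also vanishes at the Gauss point is a polynomial identity over an
    infinite field, which is where characteristic 0 enters. Genericity is used by symmetry: near a
    generic [s] the support is an affine subspace, so it contains [s - w] along with [s + w],
    whereas three equal distances admit a perturbation in one direction and not in the opposite one.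
    Two markings [a0], [b0] fix the unit of length. As (a, b) and (b, a) are separate coordinates,
    some characters are constantly -1 on the moduli space, and [s] must vanish on them. *)

Section LongestCommonPrefix.
Variable T : eqType.

Fixpoint lcp (s t : seq T) : seq T :=
  match s, t with
  | x :: s', y :: t' => if x == y then x :: lcp s' t' else [::]
  | _, _ => [::]
  end.

Lemma lcp_split (s t : seq T) : exists s' t',
  [/\ s = lcp s t ++ s', t = lcp s t ++ t' &
      forall x u w, s' = x :: u -> t' = x :: w -> False].
Proof.
elim: s t => [|x s IH] [|y t] /=; try by do 2 eexists; split.
case: eqP => [<-|ne]; last by exists (x :: s), (y :: t); split=> // z u w [ez _] [ey _];
    apply: ne; rewrite ez ey.
by have [s' [t' [e1 e2 h]]] := IH t; exists s', t'; split=> //; congr cons.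
Qed.

(** Where [a] and [b] part, [c] must differ from one of them. This is the reason why the Gromov
    products in a tree form an ultrametric. *)
Lemma lcp_ultrametric (a b c : seq T) :
  prefix (lcp b c) (lcp a b) || prefix (lcp c a) (lcp a b).
Proof.
elim: a b c => [|x a IH] [|y b] [|z c] //=; rewrite ?prefix0s ?orbT //.
have [->|yz] := eqVneq y z; last by rewrite prefix0s.
have [<-|_] := eqVneq z x; last by rewrite prefix0s orbT.
by rewrite /= eqxx; exact: IH.
Qed.

End LongestCommonPrefix.

Section TreePaths.
Variables (V : finType) (adj : rel V).
Hypothesis sym : symmetric adj.
Hypothesis acyclic : forall s : seq V, (2 < size s)%N -> ~~ (cycle adj s && uniq s).
Implicit Types (x y : V) (p q : seq V).

Lemma rev_pathP x p : path adj (last x p) (rev (belast x p)) = path adj x p.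
Proof. by rewrite rev_path; apply: eq_path => y z; exact: sym. Qed.

(** A first common vertex would close a cycle through [x]; since the first steps differ, this cycle
    has more than two vertices. *)
Lemma branches_disjoint x p q : path adj x p -> path adj x q ->
  uniq (x :: p) -> uniq (x :: q) ->
  (forall y u w, p = y :: u -> q = y :: w -> False) -> ~~ has (mem q) p.
Proof.
move=> px qx up uq heads; apply/negP => hpq.
case: (split_find hpq) px up heads => y p1 p2 yq nq.
move: yq => /= yq; case/splitPr: yq qx uq nq => q1 q2 qx uq nq px up heads.
have := acyclic (s := x :: p1 ++ y :: rev q1).
case/(_ _)/negP.
  rewrite /= size_cat /= size_rev addnS !ltnS; case: (p1) (q1) heads => [|? ?] [|? ?] //=.
  by move/(_ y p2 q2 erefl erefl).
apply/andP; split.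
  rewrite /= rcons_cat cat_path /=; move: px; rewrite cat_rcons cat_path /= => /and3P[-> -> _] /=.
  have := rev_pathP x (rcons q1 y); rewrite last_rcons belast_rcons rev_cons => ->.
  by move: qx; rewrite -cat_rcons cat_path => /andP[].
have {}up : uniq (x :: rcons p1 y).
  have : uniq ((x :: rcons p1 y) ++ p2) by [].
  by rewrite cat_uniq => /andP[].
have {}uq : uniq (x :: rcons q1 y).
  have : uniq ((x :: rcons q1 y) ++ q2) by rewrite /= cat_rcons.
  by rewrite cat_uniq => /andP[].
move: up uq; rewrite /= !mem_rcons !inE !rcons_uniq !negb_or.
case/andP=> /andP[xy xp1] /andP[yp1 up1] /andP[/andP[_ xq1] /andP[yq1 uq1]].
rewrite mem_cat inE mem_rev !negb_or xp1 xy xq1 /= cat_uniq up1 /= mem_rev yq1 rev_uniq uq1.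
rewrite !andbT (negPf yp1) /= has_rev; apply/hasPn => z zq.
by apply: contra nq => zp; apply/hasP; exists z; rewrite //= mem_cat zq.
Qed.

Lemma unique_path x p q : path adj x p -> path adj x q ->
  uniq (x :: p) -> uniq (x :: q) -> last x p = last x q -> p = q.
Proof.
elim: p x q => [|y p IH] x [|z q] //.
- by move=> _ _ _ /= /andP[xq _] e; move: xq; rewrite {1}e mem_last.
- by move=> _ _ /= /andP[xq _] _ e; move: xq; rewrite -{1}e mem_last.
have [<-|yz] := eqVneq y z.
  move=> /= /andP[_ py] /andP[_ qy] /andP[_ up] /andP[_ uq] e.
  by rewrite (IH y q).
move=> px qx up uq e; have := branches_disjoint px qx up uq.
case/(_ _)/hasP; first by move=> w u t [ew _] [ez _]; rewrite ew ez eqxx in yz.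
by exists (last y p); [exact: mem_last|move: e => /= ->; exact: mem_last].
Qed.

Lemma branches_path x p q : path adj x p -> path adj x q ->
  uniq (x :: p) -> uniq (x :: q) ->
  (forall y u w, p = y :: u -> q = y :: w -> False) ->
  [/\ path adj (last x p) (rev (belast x p) ++ q),
      uniq (last x p :: rev (belast x p) ++ q) &
      last (last x p) (rev (belast x p) ++ q) = last x q].
Proof.
move=> px qx up uq heads; have dis := branches_disjoint px qx up uq heads.
have lastE : last (last x p) (rev (belast x p)) = x.
  by case: (p) => //= y p'; rewrite rev_cons last_rcons.
split; last by rewrite last_cat lastE.
  by rewrite cat_path rev_pathP px lastE.
rewrite -cat_cons -rev_rcons -lastI cat_uniq rev_uniq up /=.
move: uq => /= /andP[xq ->]; rewrite andbT; apply/hasPn => y yq /=.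
rewrite mem_rev inE negb_or; apply/andP; split; first by apply: contraNneq xq => <-.
by apply: contra dis => yp; apply/hasP; exists y.
Qed.

End TreePaths.

(** * Distances in a tropical curve *)

Section TreeDistance.
Variables (R : realType) (C : trop_curve R).
Local Notation V := (vert C).
Local Notation adjC := (@adj R C).
Implicit Types (x y : V) (p q : seq V).

(** An infinite edge counts as 0 here; by [path_lengthE] this agrees with the extended sum as soon
    as that sum is finite. *)
Fixpoint path_length x p : R :=
  if p is y :: p' then fine (len x y) + path_length y p' else 0.

Lemma path_length_ge0 x p : path adjC x p -> 0 <= path_length x p.
Proof.
elim: p x => //= y p IH x /andP[xy /IH h]; rewrite addr_ge0 //.
by have := len_gt0 xy; case: (len x y) => [t| |] //=; rewrite lte_fin => /ltW.
Qed.

Lemma path_length_cat x p q :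
  path_length x (p ++ q) = path_length x p + path_length (last x p) q.
Proof. by elim: p x => [|y p IH] x /=; rewrite ?add0r // IH addrA. Qed.

Lemma path_length_rev x p :
  path_length (last x p) (rev (belast x p)) = path_length x p.
Proof.
elim: p x => // y p IH x; rewrite /= rev_cons -cats1 path_length_cat IH /= addr0.
by rewrite addrC len_sym; congr (fine (len _ _) + _); case: (p) => //= z s; rewrite rev_cons last_rcons.
Qed.

Lemma path_lengthE x p (d : R) : path adjC x p ->
  (\sum_(e <- zip (x :: p) p) len e.1 e.2)%E = d%:E -> d = path_length x p.
Proof.
elim: p x d => [|y p IH] x d /=; first by rewrite big_nil => _ [].
case/andP=> xy py; rewrite big_cons /=; set S := bigop _ _ _.
have S0 : (0 <= S)%E.
  rewrite /S; elim: (p) (y) py => [|z s IHs] w /=; first by rewrite big_nil.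
  by case/andP=> wz /IHs h; rewrite big_cons /= adde_ge0 // ltW // len_gt0.
have := len_gt0 xy; case: (len x y) => [t| |] //= _; last first.
  by case: (S) S0.
case ES : S S0 => [t'| |] // _ [<-].
by rewrite (IH y t').
Qed.

Definition tree_path x y p :=
  [/\ path adjC x p, uniq (x :: p) & last x p = y].

Lemma has_dist_path x y d : has_dist x y d ->
  exists2 p, tree_path x y p & d = path_length x p.
Proof.
by case=> p [px up lp e]; exists p => //; exact: path_lengthE e.
Qed.

Let symC : symmetric adjC. Proof. by case: (tc_tree C). Qed.
Let acyC : forall s : seq V, (2 < size s)%N -> ~~ (cycle adjC s && uniq s).
Proof. by case: (tc_tree C). Qed.

(** Beyond their common prefix the two paths are disjoint and join to the only path from [x] to [y].
    So [path_length o (lcp p q)] is the Gromov product of [x] and [y] at [o]. *)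
Lemma branch_dist o x y p q d : tree_path o x p -> tree_path o y q -> has_dist x y d ->
  d = path_length o p + path_length o q - path_length o (lcp p q) *+ 2.
Proof.
move=> [px up lp] [qx uq lq] /has_dist_path[w [wx uw lw] ->].
have [p' [q' [ep eq heads]]] := lcp_split p q; set s := lcp p q in ep eq *.
rewrite ep eq !path_length_cat; set z := last o s.
move: px qx up uq lp lq; rewrite ep eq !cat_path !last_cat -!cat_cons !cat_uniq -/z.
case/andP=> _ px /andP[_ qx] /and3P[us ps up] /and3P[_ qs uq] lp lq.
have notin (r : seq V) : ~~ has (mem (o :: s)) r -> uniq r -> uniq (z :: r).
  move=> hr ur; rewrite /= ur andbT; apply: contra hr => zr.
  by apply/hasP; exists z => //; rewrite inE /z; exact: mem_last.
have [bx ub lb] := branches_path symC acyC px qx (notin _ ps up) (notin _ qs uq) heads.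
have <- : path_length (last z p') (rev (belast z p') ++ q') = path_length x w.
  rewrite lp in bx ub lb *; congr path_length.
  by apply: (unique_path symC acyC bx wx ub uw); rewrite lb lw lq.
rewrite path_length_cat path_length_rev.
have -> : last (last z p') (rev (belast z p')) = z.
  by case: (p') => //= k r; rewrite rev_cons last_rcons.
by ring.
Qed.

Lemma dist_symmetric x y d d' : has_dist x y d -> has_dist y x d' -> d = d'.
Proof.
move=> /has_dist_path[p [px up lp] ->] /has_dist_path[q [qx uq lq] ->].
rewrite -lp in qx uq lq *; rewrite -(path_length_rev x p); congr path_length.
have lr : last (last x p) (rev (belast x p)) = x.
  by case: (p) => //= k r; rewrite rev_cons last_rcons.
apply: (unique_path symC acyC _ qx _ uq); rewrite ?lr ?lq //.
  by rewrite rev_pathP.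
by rewrite -rev_rcons -lastI rev_uniq.
Qed.

End TreeDistance.

(** * The tropical curve of a laminar family *)

(* The set in the definition of the valence is a classical one. *)
Lemma valenceE (V : finType) (adj : rel V) x : valence adj x = #|[set y | adj x y]|.
Proof.
rewrite cardsE; apply: eq_card => y; rewrite /in_mem /=.
exact: boolp.asboolb.
Qed.

(** The measure of the two inductions that climb the tree: [n1] and [n2] are the sizes of a set and
    of its parent, and [n3] bounds both. *)
Lemma subn_ltn_trans n1 n2 n3 n :
  (n1 < n2 -> n2 <= n3 -> n3 - n1 < n.+1 -> n3 - n2 < n)%N.
Proof. by lia. Qed.

(* A laminar family of subsets of the set of legs is a rooted tree, with the
   foot of the leg rho as its root. *)
Section LaminarTree.
Variables (T : finType) (rho : T) (F : {set {set T}}).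
Local Notation N := (~: [set rho]).
Hypothesis laminar : forall A B, A \in F -> B \in F ->
  [\/ A \subset B, B \subset A | [disjoint A & B]].
Hypothesis nonempty : forall A, A \in F -> exists x, x \in A.
Hypothesis leafF : forall a, a != rho -> [set a] \in F.
Hypothesis topF : [set: T] \in F.
Hypothesis stemF : N \in F.
Hypothesis rootF : forall A, A \in F -> rho \in A -> A = [set: T].
Hypothesis N_gt1 : (1 < #|N|)%N.
Implicit Types (A B C : {set T}).

Definition parent A := [arg min_(B < [set: T] | (B \in F) && (A \proper B)) #|B|].

Lemma properT A : A \in F -> A != [set: T] -> A \proper [set: T].
Proof. by move=> AF AT; rewrite properEneq AT subsetT. Qed.

(** Two members above the nonempty [A] meet, hence are nested, so the one of least cardinality is
    also least for inclusion. *)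
Lemma parentP A : A \in F -> A != [set: T] ->
  [/\ parent A \in F, A \proper parent A &
      forall B, B \in F -> A \proper B -> parent A \subset B].
Proof.
move=> AF AT; rewrite /parent; case: arg_minnP => [|P /andP[PF AP] Pmin].
  by rewrite topF properT.
split=> // B BF AB; have [x xA] := nonempty AF.
have [//|BP|/disjoint_setI0 PB] := laminar PF BF; last first.
  have : x \in P :&: B by rewrite inE (subsetP (proper_sub AP)) ?(subsetP (proper_sub AB)).
  by rewrite PB inE.
have := Pmin B; rewrite BF AB => /(_ isT) le.
by rewrite -(eqP (_ : B == P)) // eqEcard BP le.
Qed.

Lemma parent_in A : A \in F -> A != [set: T] -> parent A \in F.
Proof. by move=> AF AT; case: (parentP AF AT). Qed.
Lemma parent_proper A : A \in F -> A != [set: T] -> A \proper parent A.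
Proof. by move=> AF AT; case: (parentP AF AT). Qed.
Lemma parent_min A B : A \in F -> B \in F -> A \proper B -> parent A \subset B.
Proof.
move=> AF BF AB; have AT : A != [set: T].
  by apply: contraTneq AB => ->; rewrite properE subsetT andbF.
by case: (parentP AF AT) => _ _; exact.
Qed.

Definition covers A B := (A != [set: T]) && (B == parent A).
Definition cover_adj A B := covers A B || covers B A.

Lemma covers_proper A B : A \in F -> covers A B -> A \proper B.
Proof. by move=> AF /andP[AT /eqP ->]; exact: parent_proper. Qed.

Definition lvert : Type := {A : {set T} | A \in F}.
HB.instance Definition _ := SubFinite.on lvert.
Definition ladj : rel lvert := fun x y => cover_adj (val x) (val y).
Implicit Types (x y z : lvert).

Lemma ladj_sym : symmetric ladj.
Proof. by move=> x y; rewrite /ladj /cover_adj orbC. Qed.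

Lemma ladj_irr : irreflexive ladj.
Proof.
by move=> x; rewrite /ladj /cover_adj orbb; apply/negP => /(covers_proper (valP x)); rewrite properxx.
Qed.

Definition top : lvert := Sub [set: T] topF.

Definition vparent x (xT : val x != [set: T]) : lvert :=
  Sub (parent (val x)) (parent_in (valP x) xT).

Lemma ladj_parent x (xT : val x != [set: T]) : ladj x (vparent xT).
Proof. by rewrite /ladj /cover_adj /covers xT eqxx. Qed.

Lemma lconnect_top x : connect ladj x top.
Proof.
have [n] := ubnP (#|T| - #|val x|)%N; elim: n x => // n IH x sx.
have [e|xT] := eqVneq (val x) [set: T].
  by rewrite (_ : x = top) //; apply: val_inj.
apply: connect_trans (connect1 (ladj_parent xT)) (IH _ _).
rewrite -[val (vparent xT)]/(parent (val x)).
exact: subn_ltn_trans (proper_card (parent_proper (valP x) xT)) (max_card _) sx.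
Qed.

Lemma ladj_ge x y : ladj x y -> (#|val x| <= #|val y|)%N -> val y = parent (val x).
Proof.
case/orP => [/andP[_ /eqP] //|/(covers_proper (valP y))/proper_card].
by rewrite ltnNge => /negPf ->.
Qed.

(** Both neighbours of a smallest set on a cycle are at least as large, so each is its parent and
    they coincide. *)
Lemma lacyclic (s : seq lvert) : (2 < size s)%N -> ~~ (cycle ladj s && uniq s).
Proof.
move=> s2; apply/negP => /andP[cs us].
have s0 : s != [::] by case: (s) s2.
have [x xs xmin] : exists2 x, x \in s & forall y, y \in s -> (#|val x| <= #|val y|)%N.
  case: (s) s0 => // x0 s' _; exists [arg min_(x < x0 in x0 :: s') #|val x|].
    by case: arg_minnP => [|? ? _]; rewrite ?inE ?eqxx.
  by case: arg_minnP => [|? ? h]; rewrite ?inE ?eqxx.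
have [i s' e] := rot_to xs.
have memE y : y \in s -> (y \in x :: s') by rewrite -e mem_rot.
have mems y : y \in x :: s' -> y \in s by rewrite -e mem_rot.
move: cs us s2; rewrite -(rot_cycle i) -(rot_uniq i) -(size_rot i) e.
case: s' mems {memE e} => [|y [|w t]] mems //= /andP[xy].
rewrite rcons_path => /and3P[_ _ zx] /and3P[_ yt _] _.
set z := last w t in zx; have zin : z \in w :: t by exact: mem_last.
have ys : y \in s by apply: mems; rewrite !inE eqxx orbT.
have zs : z \in s by apply: mems; rewrite inE [z \in y :: _]inE zin !orbT.
have e1 := ladj_ge xy (xmin _ ys); rewrite ladj_sym in zx.
have e2 := ladj_ge zx (xmin _ zs).
by move: yt; rewrite (_ : y = z) ?zin //; apply: val_inj; rewrite e1 e2.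
Qed.

Lemma ltree : is_tree ladj.
Proof.
split; [by exists top|exact: ladj_sym|exact: ladj_irr| |exact: lacyclic].
move=> x y; apply: connect_trans (lconnect_top x) _.
by rewrite (sym_connect_sym ladj_sym) lconnect_top.
Qed.

Lemma N_neqT : N != [set: T].
Proof.
by apply/eqP => /setP/(_ rho); rewrite !inE eqxx.
Qed.

Lemma rho_notin A : A \in F -> A != [set: T] -> A \subset N.
Proof.
move=> AF AT; apply/subsetP => x xA; rewrite !inE; apply: contraNneq AT => e.
by apply/eqP/rootF; rewrite // -e.
Qed.

Lemma parent_stem : parent N = [set: T].
Proof.
have NT := N_neqT; apply: contraTeq (parent_proper stemF NT) => PT.
by rewrite properE negb_and negbK (rho_notin (parent_in stemF NT) PT) orbT.
Qed.

Lemma parent_eqT A : A \in F -> A != [set: T] -> parent A = [set: T] -> A = N.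
Proof.
move=> AF AT PT; apply: contraTeq isT => AN.
have AN' : A \proper N by rewrite properEneq AN rho_notin.
have := parent_min AF stemF AN'; rewrite PT => /subsetP/(_ rho).
by rewrite !inE eqxx => /(_ isT).
Qed.

Definition child A (a : T) := [arg max_(B > [set a] | [&& B \in F, a \in B & B \proper A]) #|B|].

Lemma childP A (x : T) : A \in F -> A != [set: T] -> (1 < #|A|)%N -> x \in A ->
  [/\ child A x \in F, x \in child A x, child A x \proper A &
      parent (child A x) = A].
Proof.
move=> AF AT A1 xA; have xr : x != rho.
  by have := subsetP (rho_notin AF AT) x xA; rewrite !inE.
rewrite /child; case: arg_maxnP => [|B /and3P[BF xB BA] Bmax].
  rewrite leafF //= inE eqxx /= properEcard sub1set xA cards1.
  by rewrite A1.
split=> //; have BT : B != [set: T].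
  by apply: contraTneq BA => ->; rewrite properE subsetT andbF.
apply/eqP; rewrite eqEsubset (parent_min BF AF BA) /=.
have := laminar AF (parent_in BF BT); case=> // [PA|/disjoint_setI0 dis]; last first.
  have : x \in A :&: parent B.
    by rewrite inE xA (subsetP (proper_sub (parent_proper BF BT))).
  by rewrite dis inE.
apply: contraT => nAP; have PA' : parent B \proper A by rewrite properE PA.
have xP : x \in parent B by rewrite (subsetP (proper_sub (parent_proper BF BT))).
have PBin : [&& parent B \in F, x \in parent B & parent B \proper A].
  by rewrite parent_in // xP.
have le : (#|parent B| <= #|B|)%N by exact: Bmax PBin.
by have := proper_card (parent_proper BF BT); rewrite ltnNge le.
Qed.

Lemma child_uniq A B (x : T) : A \in F -> A != [set: T] -> (1 < #|A|)%N ->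
  B \in F -> B != [set: T] -> parent B = A -> x \in B -> child A x = B.
Proof.
move=> AF AT A1 BF BT BA xB; have AB := parent_proper BF BT; rewrite BA in AB.
have xA : x \in A by exact: (subsetP (proper_sub AB)).
have [CF xC CA CP] := childP AF AT A1 xA.
have CT : child A x != [set: T].
  by apply: contraTneq CA => ->; rewrite properE subsetT andbF.
case: (laminar CF BF) => [CB|BC|/disjoint_setI0 dis].
- apply/eqP; apply: contraT => ne; have CB' : child A x \proper B by rewrite properEneq ne.
  have := parent_min CF BF CB'; rewrite CP => AB'.
  by move: AB; rewrite properE AB' andbF.
- apply/esym/eqP; apply: contraT => ne; have BC' : B \proper child A x by rewrite properEneq ne.
  have := parent_min BF CF BC'; rewrite BA => AC.
  by move: CA; rewrite properE AC andbF.
- have : x \in child A x :&: B by rewrite inE xC.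
  by rewrite dis inE.
Qed.

Definition is_foot A := (A == [set: T]) || (#|A| == 1%N).

Lemma card_gt1 A : A \in F -> ~~ is_foot A -> A != [set: T] /\ (1 < #|A|)%N.
Proof.
move=> AF; rewrite negb_or => /andP[AT A1]; split=> //.
have [x xA] := nonempty AF; rewrite ltn_neqAle eq_sym A1 /=.
by apply/card_gt0P; exists x.
Qed.

Lemma valence_foot x : is_foot (val x) -> valence ladj x = 1%N.
Proof.
have NT := N_neqT; case/orP => [/eqP e|c1].
  rewrite valenceE (_ : [set y | _] = [set (Sub N stemF : lvert)]) ?cards1 //.
  apply/setP => y; rewrite !inE /ladj /cover_adj /covers e eqxx /=.
  apply/andP/eqP => [[yT /eqP py]|->].
    by apply: val_inj; apply: parent_eqT => //; exact: (valP y).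
  by rewrite /= NT parent_stem.
have [a e] := cards1P c1; have xT : val x != [set: T].
  apply: contraTneq c1 => ->; rewrite neq_ltn (leq_trans N_gt1) ?orbT //.
  exact: subset_leq_card (subsetT _).
rewrite valenceE (_ : [set y | _] = [set vparent xT]) ?cards1 //.
apply/setP => y; rewrite !inE /ladj /cover_adj; apply/orP/eqP => [[|]|->].
- by move=> /andP[_ /eqP py]; apply: val_inj.
- move=> /(covers_proper (valP y))/proper_card; rewrite e cards1 ltnS leqn0 cards_eq0 => /eqP y0.
  by have [b] := nonempty (valP y); rewrite y0 inE.
- by left; rewrite /covers xT eqxx.
Qed.

(** Besides its parent, an inner set has two children: the one through an element [a], and the one
    through an element [b] that the first child misses. *)
Lemma valence_inner x : ~~ is_foot (val x) -> (2 < valence ladj x)%N.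
Proof.
move=> nf; have [xT x1] := card_gt1 (valP x) nf.
have [a ax] := nonempty (valP x).
have [C1F aC1 C1x P1] := childP (valP x) xT x1 ax.
have [_ [b bx bC1]] := properP C1x.
have [C2F bC2 C2x P2] := childP (valP x) xT x1 bx.
pose y1 : lvert := Sub (child (val x) a) C1F; pose y2 : lvert := Sub (child (val x) b) C2F.
have nT C : C \proper val x -> C != [set: T].
  by apply: contraTneq => ->; rewrite properE subsetT andbF.
have sub : [set vparent xT; y1; y2] \subset [set y | ladj x y].
  apply/subsetP => y; rewrite !inE => /orP[/orP[]|] /eqP ->.
  - exact: ladj_parent.
  - by apply/orP; right; apply/andP; split; [exact: nT|rewrite P1].
  - by apply/orP; right; apply/andP; split; [exact: nT|rewrite P2].
rewrite valenceE; apply: leq_trans (subset_leq_card sub).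
have y12 : y1 != y2 by apply: contraNneq bC1 => -[->].
have py (y : lvert) : val y \proper val x -> vparent xT != y.
  move=> yx; apply: contraTneq yx => <-; rewrite properE negb_and negbK.
  by rewrite (proper_sub (parent_proper (valP x) xT)) orbT.
by rewrite setUC cardsU1 !inE cards2 negb_or !(eq_sym y2) y12 !py.
Qed.

Lemma foot_ladj x : foot ladj x = is_foot (val x).
Proof.
rewrite /foot; have [h|h] := boolP (is_foot (val x)); first by rewrite valence_foot.
by have := valence_inner h; case: (valence ladj x) => [|[|[|?]]].
Qed.

Lemma lvalence x : valence ladj x != 2%N.
Proof.
have [h|h] := boolP (is_foot (val x)); first by rewrite valence_foot.
by have := valence_inner h; case: (valence ladj x) => [|[|[|?]]].
Qed.

Lemma stem_inner : ~~ is_foot N.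
Proof. by rewrite negb_or N_neqT /= gtn_eqF. Qed.

Lemma lcard : #|{: lvert}| != 2%N.
Proof.
have := valence_inner (x := Sub N stemF) stem_inner; apply: contraTneq => e.
by rewrite -leqNgt -e; exact: max_card.
Qed.

(** * Edge lengths from a height function *)

Variables (R : realType) (h : {set T} -> R).
Hypothesis h_mono : forall A B, A \in F -> B \in F -> ~~ is_foot A -> ~~ is_foot B ->
  A \proper B -> h B < h A.

Definition llen x y : \bar R :=
  if is_foot (val x) || is_foot (val y) then +oo%E
  else `|h (val x) - h (val y)|%:E.

Fact llen_sym x y : llen x y = llen y x.
Proof. by rewrite /llen orbC distrC. Qed.

Lemma h_adj x y : ~~ is_foot (val x) -> ~~ is_foot (val y) -> ladj x y -> h (val x) != h (val y).
Proof.
move=> fx fy /orP[/(covers_proper (valP x)) xy|/(covers_proper (valP y)) xy].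
  by rewrite gt_eqF // (h_mono (valP x) (valP y)).
by rewrite lt_eqF // (h_mono (valP y) (valP x)).
Qed.

Fact llen_gt0 x y : ladj x y -> (0 < llen x y)%E.
Proof.
rewrite /llen; case: ifP => [_ _|/negbT]; first exact: ltry.
by rewrite negb_or => /andP[fx fy] xy; rewrite lte_fin normr_gt0 subr_eq0 h_adj.
Qed.

Fact llen_leg x y : ladj x y -> (llen x y == +oo%E) = foot ladj x || foot ladj y.
Proof. by move=> _; rewrite !foot_ladj /llen; case: ifP. Qed.

Definition laminar_curve : trop_curve R :=
  TropCurve ltree lvalence lcard llen_sym llen_gt0 llen_leg.

Lemma up_path x y : ~~ is_foot (val x) -> ~~ is_foot (val y) -> val x \subset val y ->
  exists p : seq lvert, [/\ path ladj x p, uniq (x :: p), last x p = y,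
    all (fun z => [&& val x \proper val z, val z \subset val y & ~~ is_foot (val z)]) p &
    path_length (C := laminar_curve) x p = h (val x) - h (val y)].
Proof.
have [n] := ubnP (#|val y| - #|val x|)%N; elim: n x => // n IH x sn fx fy xy.
have [e|ne] := eqVneq (val x) (val y).
  by exists [::]; rewrite (val_inj e) subrr.
have xy' : val x \proper val y by rewrite properEneq ne.
have xT : val x != [set: T].
  by apply: contraTneq xy' => ->; rewrite properE subsetT andbF.
have xp := parent_proper (valP x) xT.
have py := parent_min (valP x) (valP y) xy'.
have fp : ~~ is_foot (val (vparent xT)).
  have [yT _] := card_gt1 (valP y) fy; have [_ x1] := card_gt1 (valP x) fx.
  rewrite negb_or; apply/andP; split.
    by apply: contraNneq yT => /= e; rewrite -subTset -e.
  by rewrite gtn_eqF // (ltn_trans x1) // proper_card.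
have [|p [pp up lp sp dp]] := IH (vparent xT) _ fp fy py.
  rewrite -[val (vparent xT)]/(parent (val x)).
  exact: subn_ltn_trans (proper_card xp) (subset_leq_card py) sn.
exists (vparent xT :: p); split.
- by rewrite /= ladj_parent.
- rewrite /= -/(uniq (vparent xT :: p)) up andbT inE negb_or; apply/andP; split.
    by apply: contraTneq xp => {1}->; rewrite properxx.
  apply/negP => /(allP sp)/and3P[px _ _].
  by have := proper_trans xp px; rewrite properxx.
- exact: lp.
- rewrite /= xp py fp /=; apply/allP => z /(allP sp)/and3P[pz -> ->].
  by rewrite (proper_trans xp pz).
- rewrite /= dp; have -> : llen x (vparent xT) = `|h (val x) - h (val (vparent xT))|%:E.
    by rewrite /llen (negPf fx) (negPf fp).
  rewrite gtr0_norm /= ?addrA ?subrK // subr_gt0.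
  exact: (h_mono (valP x) (valP (vparent xT)) fx fp xp).
Qed.

Lemma path_length_sum x p : ~~ is_foot (val x) -> all (fun z => ~~ is_foot (val z)) p ->
  (\sum_(e <- zip (x :: p) p) llen e.1 e.2)%E = (path_length (C := laminar_curve) x p)%:E.
Proof.
elim: p x => [|y p IH] x fx /=; first by rewrite big_nil.
case/andP=> fy fp; rewrite big_cons /= IH // /llen (negPf fx) (negPf fy) /=.
by rewrite EFinD.
Qed.

(** The path climbs from [x] to [z] and descends to [y]. A set on both branches contains [x] and
    [y], hence [z] by minimality, so the branches meet only in [z]. *)
Lemma meet_dist x y z : ~~ is_foot (val x) -> ~~ is_foot (val y) -> ~~ is_foot (val z) ->
  val x \subset val z -> val y \subset val z ->
  (forall A, A \in F -> val x \subset A -> val y \subset A -> val z \subset A) ->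
  has_dist (C := laminar_curve) x y (h (val x) + h (val y) - h (val z) *+ 2).
Proof.
move=> fx fy fz xz yz zmin.
have [p [px up lp sp dp]] := up_path fx fz xz.
have [q [qy uq lq sq dq]] := up_path fy fz yz.
pose w := rev (belast y q).
have pw : path ladj z w by rewrite -lq (rev_pathP ladj_sym).
have lw : last z w = y by rewrite /w -lq; case: (q) => //= k r; rewrite rev_cons last_rcons.
have inw k : k \in w -> (k == y) || (k \in q) && (k != z).
  rewrite mem_rev => kb; have : k \in rcons (belast y q) (last y q).
    by rewrite mem_rcons inE kb orbT.
  rewrite -lastI inE => /orP[-> //|kq]; rewrite kq /=; apply/orP; right.
  apply: contraTneq kb => ->; rewrite -lq.
  by move: uq; rewrite lastI rcons_uniq => /andP[].
have big k : k \in w -> val y \subset val k.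
  by move=> /inw/orP[/eqP -> //|/andP[/(allP sq)/and3P[/proper_sub]]].
have neqz k : k \in w -> k != z.
  move=> kw; move: (kw); rewrite mem_rev => kb; apply: contraTneq kb => ->; rewrite -lq.
  by move: uq; rewrite lastI rcons_uniq => /andP[].
have subz k : k \in w -> val k \subset val z.
  by move=> /inw/orP[/eqP -> //|/andP[/(allP sq)/and3P[_]]].
exists (p ++ w); split.
- by rewrite cat_path px lp.
- rewrite -cat_cons cat_uniq up /= rev_uniq; apply/andP; split; last first.
    by move: uq; rewrite lastI rcons_uniq => /andP[].
  apply/hasPn => k kw /=; apply: contra (neqz k kw) => kp.
  have xk : val x \subset val k.
    by move: kp; rewrite inE => /orP[/eqP -> //|/(allP sp)/and3P[/proper_sub]].
  apply/eqP/val_inj/eqP; rewrite eqEsubset subz //.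
  by rewrite zmin ?(valP k) // big.
- by rewrite last_cat lp.
- rewrite path_length_sum //; last first.
    rewrite all_cat; apply/andP; split; first by apply/allP => k /(allP sp)/and3P[].
    by apply/allP => k /inw/orP[/eqP -> //|/andP[/(allP sq)/and3P[]]].
  rewrite path_length_cat lp dp /w -[z in path_length z _]lq.
  rewrite (path_length_rev (C := laminar_curve)) dq; congr EFin; ring.
Qed.

Lemma foot_neighbour x y z : is_foot (val x) -> ladj x y -> ladj x z -> y = z.
Proof.
move=> /valence_foot; rewrite valenceE => /eqP/cards1P[w e] xy xz.
have : y \in [set y | ladj x y] by rewrite inE.
have : z \in [set y | ladj x y] by rewrite inE.
by rewrite e !inE => /eqP -> /eqP ->.
Qed.

(** The leg of [rho] points upwards, from the complement of [rho] to the root [[set: T]]; every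
    other leg points downwards, from a parent to a singleton. *)
Definition foot_set l := if l == rho then [set: T] else [set l].
Definition end_set l := if l == rho then N else parent [set l].

Lemma set1_neqT l : [set l] != [set: T].
Proof.
apply: contraTneq N_gt1 => e; rewrite -leqNgt -(cards1 l) e.
exact: subset_leq_card (subsetT _).
Qed.

Lemma foot_set_in l : foot_set l \in F.
Proof. by rewrite /foot_set; case: eqVneq => // /leafF. Qed.
Lemma end_set_in l : end_set l \in F.
Proof.
by rewrite /end_set; case: eqVneq => // /leafF lF; exact: parent_in lF (set1_neqT l).
Qed.

Definition vfoot l : lvert := Sub (foot_set l) (foot_set_in l).
Definition vend l : lvert := Sub (end_set l) (end_set_in l).
Lemma val_vfoot l : val (vfoot l) = foot_set l. Proof. by []. Qed.
Lemma val_vend l : val (vend l) = end_set l. Proof. by []. Qed.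

Lemma vfoot_foot l : is_foot (val (vfoot l)).
Proof.
rewrite val_vfoot /foot_set /is_foot; case: (l == rho); first by rewrite eqxx.
by rewrite cards1 eqxx orbT.
Qed.

Lemma vend_inner l : ~~ is_foot (val (vend l)).
Proof.
rewrite val_vend /end_set; case: eqVneq => [_|lr]; first exact: stem_inner.
have lF := leafF lr; have lp := parent_proper lF (set1_neqT l).
rewrite negb_or; apply/andP; split; last first.
  by have := proper_card lp; rewrite cards1 => /gtn_eqF ->.
apply: contraNneq (stem_inner) => /(parent_eqT lF (set1_neqT l)) <-.
by rewrite /is_foot cards1 eqxx orbT.
Qed.

Lemma vend_vfoot l : ladj (vend l) (vfoot l).
Proof.
rewrite /ladj /cover_adj val_vend val_vfoot /end_set /foot_set /covers.
have [_|lr] := eqVneq l rho; first by rewrite N_neqT parent_stem eqxx.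
by rewrite set1_neqT eqxx orbT.
Qed.

Lemma foot_vfoot x : is_foot (val x) -> exists l, x = vfoot l.
Proof.
have [e _|xT] := eqVneq (val x) [set: T].
  by exists rho; apply: val_inj; rewrite val_vfoot /foot_set eqxx.
rewrite /is_foot (negPf xT) => /cards1P[a e]; exists a; apply: val_inj.
rewrite val_vfoot /foot_set ifN //; apply: contraNneq xT => ar.
by apply/eqP/rootF; rewrite ?(valP x) // e ar inE.
Qed.

Lemma vfoot_inj : injective vfoot.
Proof.
move=> l l' e; have := congr1 val e; rewrite !val_vfoot /foot_set.
have [->|_] := eqVneq l rho; have [->//|_] := eqVneq l' rho.
- by move/eqP; rewrite eq_sym (negPf (set1_neqT _)).
- by move/eqP; rewrite (negPf (set1_neqT _)).
- exact: set1_inj.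
Qed.

Lemma foot_inner x y : is_foot (val x) -> ~~ is_foot (val y) -> x != y.
Proof. by move=> fx; apply: contraNneq => <-. Qed.

Definition laminar_leg l : {set lvert} := [set vend l; vfoot l].

Lemma laminar_leg_pair l x y : laminar_leg l = [set x; y] ->
  ~~ is_foot (val x) -> is_foot (val y) -> x = vend l /\ y = vfoot l.
Proof.
move=> e fx fy.
have : x \in laminar_leg l by rewrite e !inE eqxx.
have : y \in laminar_leg l by rewrite e !inE eqxx orbT.
rewrite !inE (negPf (foot_inner fy (vend_inner l))) /= => /eqP ->.
by rewrite eq_sym [x == _]eq_sym (negPf (foot_inner (vfoot_foot l) fx)) orbF => /eqP ->.
Qed.

Lemma laminar_leg_inj : injective laminar_leg.
Proof.
move=> l l' e; apply: vfoot_inj.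
by have [_] := laminar_leg_pair e (vend_inner l') (vfoot_foot l').
Qed.

Lemma laminar_leg_legs : [set laminar_leg l | l in T] = legs ladj.
Proof.
apply/setP => A; apply/imsetP/imsetP => [[l _ ->]|[[x y]]].
  exists (vend l, vfoot l) => //.
  by rewrite inE /= vend_vfoot foot_ladj vfoot_foot.
rewrite inE /= => /andP[xy]; rewrite foot_ladj => fy ->.
have [l e] := foot_vfoot fy; exists l => //; congr [set _; _]; last exact: e.
apply: (@foot_neighbour y); rewrite ?fy // ladj_sym // e; exact: vend_vfoot.
Qed.

(** * The balanced map on the tree of a laminar family *)

Variables (r : nat) (Delta : T -> 'rV[int]_r) (P0 : 'rV[R]_r).
Hypothesis Delta0 : \sum_l Delta l = 0.

(** Balancing forces the direction along an edge, away from the root, to be the sum of the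
    directions of all legs beyond it. *)
Definition weight A := \sum_(l in A) Delta l.
Definition laminar_dir x y :=
  if val x \proper val y then - weight (val x) else weight (val y).

Lemma inner_neqT x : ~~ is_foot (val x) -> val x != [set: T].
Proof. by case/(card_gt1 (valP x)). Qed.

(** The children of an inner set partition it, so their weights add up to its own weight, which the
    edge to the parent carries with a minus sign. *)
Lemma laminar_balanced x : ~~ is_foot (val x) ->
  \sum_(y | ladj x y) laminar_dir x y = 0.
Proof.
move=> fx; have [xT x1] := card_gt1 (valP x) fx.
have xp := parent_proper (valP x) xT.
rewrite (bigD1 (vparent xT)) ?ladj_parent //= {1}/laminar_dir xp.
pose Q y := ladj x y && (y != vparent xT).
have QE y : Q y -> [/\ val y != [set: T], parent (val y) = val x & val y \proper val x].
  case/andP=> /orP[/andP[_ /eqP yp]|yx] yP.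
    by case/eqP: yP; apply: val_inj.
  by split; [case/andP: yx|case/andP: yx => _ /eqP|exact: covers_proper (valP y) yx].
pose p l : lvert := insubd top (child (val x) l).
have pE l : l \in val x -> val (p l) = child (val x) l.
  by move=> lx; have [cF _ _ _] := childP (valP x) xT x1 lx; rewrite val_insubd cF.
rewrite (eq_bigr (fun y => weight (val y))) => [|y /QE[_ _ yx]]; last first.
  rewrite /laminar_dir ifF //; apply/negP => xy.
  by have := proper_trans xy yx; rewrite properxx.
rewrite {1}/weight (partition_big p Q) /= => [|l lx]; last first.
  have [cF lc cx cp] := childP (valP x) xT x1 lx.
  rewrite /Q /ladj /cover_adj pE // /covers cp eqxx andbT.
  have -> : child (val x) l != [set: T].
    by apply: contraTneq cx => ->; rewrite properE subsetT andbF.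
  rewrite orbT /=; apply: contraTneq (proper_trans cx xp) => e.
  by rewrite -pE // e properxx.
apply/eqP; rewrite addrC subr_eq0; apply/eqP/eq_bigr => y /QE[yT yp yx].
apply: eq_bigl => l; apply/idP/andP => [ly|[lx /eqP <-]]; last first.
  by rewrite pE //; case: (childP (valP x) xT x1 lx).
have lx : l \in val x by exact: (subsetP (proper_sub yx)).
split=> //; apply/eqP/val_inj; rewrite pE //.
exact: (child_uniq (valP x) xT x1 (valP y) yT yp ly).
Qed.

(** The vertex of the complement of [rho] is placed at [P0]. The term of [B] is the displacement
    along the edge from [parent B] down to [B], and the sum runs over the edges between that vertex
    and [x]. *)
Definition laminar_pos x : 'rV[R]_r :=
  P0 + \sum_(B in F | [&& ~~ is_foot B, val x \subset B & B != N])
         (h B - h (parent B)) *: to_real R (weight B).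

Lemma laminar_pos_stem : laminar_pos (Sub N stemF) = P0.
Proof.
rewrite /laminar_pos big1 ?addr0 // => B /andP[BF /and3P[Bf NB BN]].
by case/eqP: BN; apply/eqP; rewrite eqEsubset NB rho_notin //; case: (card_gt1 BF Bf).
Qed.

Lemma laminar_pos_parent x y : ~~ is_foot (val x) -> ~~ is_foot (val y) -> covers (val x) (val y) ->
  laminar_pos x = laminar_pos y + (h (val x) - h (val y)) *: to_real R (weight (val x)).
Proof.
move=> fx fy xy; have [xT /eqP yE] := andP xy; have xy' := covers_proper (valP x) xy.
have xN : val x != N.
  by apply: contraNneq (inner_neqT fy) => e; rewrite yE e parent_stem.
rewrite /laminar_pos (bigD1 (val x)); last by rewrite (valP x) fx xN subxx.
rewrite -yE addrA addrAC -!addrA; congr (_ + (_ + _)).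
apply: eq_bigl => B; apply/andP/andP => [[/andP[BF /and3P[-> xB ->]] Bx]|[BF /and3P[-> yB ->]]].
  split=> //; rewrite andbT yE parent_min ?(valP x) //.
  by rewrite properEneq eq_sym Bx.
rewrite BF (subset_trans (proper_sub xy') yB); split=> //.
by apply: contraTneq xy' => <-; rewrite properE yB andbF.
Qed.

Lemma laminar_edge x y : ladj x y -> ~~ is_foot (val x) -> ~~ is_foot (val y) ->
  laminar_pos y = laminar_pos x + fine (llen x y) *: to_real R (laminar_dir x y).
Proof.
move=> xy fx fy; have NW A : to_real R (- weight A) = - to_real R (weight A).
  by apply/matrixP => i j; rewrite !mxE rmorphN.
rewrite /llen (negPf fx) (negPf fy) /= /laminar_dir; case/orP: xy => xy.
  have xy' := covers_proper (valP x) xy; rewrite xy' (laminar_pos_parent fx fy xy).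
  by rewrite gtr0_norm ?subr_gt0 ?h_mono ?(valP x) ?(valP y) // NW scalerN addrK.
have yx := covers_proper (valP y) xy; rewrite (laminar_pos_parent fy fx xy).
rewrite ifF; last by apply/negP => xy'; have := proper_trans xy' yx; rewrite properxx.
by rewrite distrC gtr0_norm // subr_gt0 h_mono ?(valP x) ?(valP y).
Qed.

Lemma laminar_dir_leg l : laminar_dir (vend l) (vfoot l) = Delta l.
Proof.
have := vend_vfoot l; rewrite /laminar_dir /ladj val_vend val_vfoot /end_set /foot_set.
have [->|lr] := eqVneq l rho => _.
  rewrite properT ?N_neqT //; apply/eqP; rewrite eq_sym -subr_eq0 opprK -Delta0.
  rewrite (bigD1 rho) //=; apply/eqP; congr (_ + _).
  by apply: eq_bigl => l'; rewrite !inE.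
rewrite ifF; first by rewrite /weight big_set1.
apply/negP => pl; have := proper_trans pl (parent_proper (leafF lr) (set1_neqT l)).
by rewrite properxx.
Qed.

Fact laminar_edge_inner x y : ladj x y -> inner ladj x -> inner ladj y ->
  laminar_pos y = laminar_pos x + fine (llen x y) *: to_real R (laminar_dir x y).
Proof. by rewrite /inner !foot_ladj; exact: laminar_edge. Qed.
Fact laminar_balanced_inner x : inner ladj x -> \sum_(y | ladj x y) laminar_dir x y = 0.
Proof. by rewrite /inner foot_ladj; exact: laminar_balanced. Qed.
Fact laminar_leg_dir l x y : laminar_leg l = [set x; y] -> ladj x y ->
  inner ladj x -> foot ladj y -> laminar_dir x y = Delta l.
Proof.
rewrite /inner !foot_ladj => e _ fx fy.
by have [-> ->] := laminar_leg_pair e fx fy; exact: laminar_dir_leg.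
Qed.

Definition laminar_param_curve : param_trop_curve R Delta :=
  @ParamTropCurve R r T Delta laminar_curve laminar_leg laminar_leg_inj laminar_leg_legs
    laminar_pos laminar_dir laminar_edge_inner laminar_balanced_inner laminar_leg_dir.

Lemma end_set_sub l A : l != rho -> A \in F -> ~~ is_foot A -> l \in A -> end_set l \subset A.
Proof.
move=> lr AF fA lA; rewrite /end_set (negPf lr); apply: parent_min => //; first exact: leafF.
by rewrite properEcard sub1set lA cards1; case: (card_gt1 AF fA).
Qed.

Lemma end_set_mem l : l != rho -> l \in end_set l.
Proof.
move=> lr; rewrite /end_set (negPf lr).
by apply: (subsetP (proper_sub (parent_proper (leafF lr) (set1_neqT l)))); rewrite inE.
Qed.

(** The distances are given as a sum [k a + k b] minus twice a height, because the first part is in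
    the image of Phi. *)
Lemma laminar_moduli_point :
  exists (C : param_trop_curve R Delta) (e : T -> vert C) (k : T -> R),
  [/\ forall l, leg_end l (e l), tpos (e rho) = P0,
      forall a b A, a != rho -> b != rho -> A \in F -> ~~ is_foot A -> a \in A -> b \in A ->
        (forall B, B \in F -> a \in B -> b \in B -> A \subset B) ->
        has_dist (e a) (e b) (k a + k b - h A *+ 2) &
      forall a, a != rho ->
        has_dist (e a) (e rho) (k a + k rho) /\ has_dist (e rho) (e a) (k rho + k a)].
Proof.
(* The end of a leg and the end of [rho] meet at [N]; the value [- h N] at [rho] absorbs the height
   of this meeting point. *)
pose k a := if a == rho then - h N else h (end_set a).
exists laminar_param_curve, vend, k; split.
- by move=> l; split; [rewrite /= !inE eqxx|rewrite /inner /= foot_ladj vend_inner].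
- rewrite /= -laminar_pos_stem; congr laminar_pos; apply: val_inj.
  by rewrite val_vend /end_set eqxx.
- move=> a b A ar br AF fA aA bA Amin.
  rewrite /k (negPf ar) (negPf br).
  apply: (@meet_dist (vend a) (vend b) (Sub A AF)); rewrite ?vend_inner // ?end_set_sub //.
  move=> B BF sa sb; apply: Amin => //; first exact: (subsetP sa) (end_set_mem ar).
  exact: (subsetP sb) (end_set_mem br).
have rE : end_set rho = N by rewrite /end_set eqxx.
move=> a ar; rewrite /k eqxx (negPf ar).
have sN l : val (vend l) \subset N.
  rewrite val_vend; have [->|lr] := eqVneq l rho; first by rewrite rE.
  by apply: end_set_sub; rewrite ?stem_inner // !inE.
split; [have -> : h (end_set a) - h N = h (end_set a) + h (end_set rho) - h N *+ 2
       |have -> : - h N + h (end_set a) = h (end_set rho) + h (end_set a) - h N *+ 2];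
  do ?[by rewrite rE; ring].
  apply: (@meet_dist (vend a) (vend rho) (Sub N stemF));
    do ?[exact: vend_inner|exact: stem_inner|exact: sN].
  by move=> B BF _; rewrite val_vend rE.
apply: (@meet_dist (vend rho) (vend a) (Sub N stemF));
  do ?[exact: vend_inner|exact: stem_inner|exact: sN].
by move=> B BF; rewrite val_vend rE.
Qed.

End LaminarTree.

(** * The tropical curve of an ultrametric *)

Section BallFamily.
Variables (T : finType) (rho : T) (R : realType) (u : T -> T -> R).
Local Notation N := (~: [set rho]).
Hypothesis usym : forall a b, a != rho -> b != rho -> a != b -> u a b = u b a.
Hypothesis umin : forall a b c, a != rho -> b != rho -> c != rho ->
  a != b -> b != c -> c != a -> Num.min (u b c) (u c a) <= u a b.
Hypothesis N_gt1 : (1 < #|N|)%N.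
Implicit Types (A B : {set T}) (a b x y : T) (t : R).

(** [u] behaves like the valuation of a difference: large values mean close points, so the balls
    shrink as [t] grows. *)
Definition ball a t : {set T} := [set x | (x == a) || (x != rho) && (t <= u a x)].

Lemma ball_center a t : a \in ball a t. Proof. by rewrite inE eqxx. Qed.

Lemma ball_off_root a t x : a != rho -> x \in ball a t -> x != rho.
Proof. by move=> ar; rewrite inE => /orP[/eqP -> //|/andP[]]. Qed.

Lemma ball_sub a b t : a != rho -> b \in ball a t -> ball b t \subset ball a t.
Proof.
move=> ar ba; have br := ball_off_root ar ba.
have [->//|nab] := eqVneq b a.
move: ba; rewrite inE (negPf nab) br /= => tab.
apply/subsetP => x xb; have xr := ball_off_root br xb.
rewrite inE xr; have [//|xa] := eqVneq x a; move: xb; rewrite inE xr /=.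
have [-> _ //|xnb /= tbx] := eqVneq x b.
have [an bn] : a != x /\ b != x by rewrite !(eq_sym _ x).
apply: le_trans (umin ar xr br an xnb nab); rewrite le_min.
by rewrite (usym xr br) // (usym br ar) // tab tbx.
Qed.

Lemma ball_eq a b t : a != rho -> b \in ball a t -> ball b t = ball a t.
Proof.
move=> ar ba; apply/eqP; rewrite eqEsubset ball_sub //=.
have br := ball_off_root ar ba; apply: ball_sub => //.
move: ba; rewrite !inE => /orP[/eqP -> |/andP[_ tab]]; first by rewrite eqxx.
have [//|nab] := eqVneq a b; by rewrite ar (usym br ar) // eq_sym.
Qed.

Lemma ball_mono a t t' : t <= t' -> ball a t' \subset ball a t.
Proof.
move=> tt'; apply/subsetP => x; rewrite !inE => /orP[-> //|/andP[-> /= h]].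
by rewrite (le_trans tt' h) orbT.
Qed.

Definition balls : {set {set T}} :=
  [set: T] |: ([set [set a] | a in N] :|:
    [set ball p.1 (u p.1 p.2) | p in [set p : T * T | [&& p.1 != rho, p.2 != rho & p.1 != p.2]]]).

Lemma ballsP A : A \in balls -> [\/ A = [set: T], exists2 a, a != rho & A = [set a] |
  exists a b, [/\ a != rho, b != rho, a != b & A = ball a (u a b)]].
Proof.
rewrite !inE => /orP[/eqP ->|/orP[/imsetP[a]|/imsetP[[a b]]]]; first by constructor 1.
  by rewrite !inE => ar ->; constructor 2; exists a.
by rewrite inE /= => /and3P[ar br ab] ->; constructor 3; exists a, b.
Qed.

Lemma ball_in a b : a != rho -> b != rho -> a != b -> ball a (u a b) \in balls.
Proof.
move=> ar br ab; rewrite !inE; apply/orP; right; apply/orP; right.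
by apply/imsetP; exists (a, b); rewrite ?inE //= ar br.
Qed.

Lemma balls_single a : a != rho -> [set a] \in balls.
Proof.
move=> ar; rewrite !inE; apply/orP; right; apply/orP; left.
by apply/imsetP; exists a; rewrite ?inE.
Qed.

Lemma balls_top : [set: T] \in balls. Proof. by rewrite !inE eqxx. Qed.

Lemma balls_nonempty A : A \in balls -> exists x, x \in A.
Proof.
case/ballsP => [->|[a _ ->]|[a [b [_ _ _ ->]]]]; first by exists rho.
  by exists a; rewrite inE.
by exists a; exact: ball_center.
Qed.

Lemma balls_root A : A \in balls -> rho \in A -> A = [set: T].
Proof.
case/ballsP => [//|[a ar ->]|[a [b [ar _ _ ->]]]].
  by rewrite inE eq_sym (negPf ar).
by move/(ball_off_root ar); rewrite eqxx.
Qed.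

Lemma laminar_single a A : [\/ [set a] \subset A, A \subset [set a] | [disjoint [set a] & A]].
Proof.
by have [aA|aA] := boolP (a \in A); [constructor 1; rewrite sub1set|constructor 3; rewrite disjoints1].
Qed.

Lemma laminar_sym A B : [\/ A \subset B, B \subset A | [disjoint A & B]] ->
  [\/ B \subset A, A \subset B | [disjoint B & A]].
Proof. by case=> ?; [constructor 2|constructor 1|constructor 3; rewrite disjoint_sym]. Qed.

(** Balls that meet can be recentred at a common point and are then compared by their radii. *)
Lemma balls_laminar A B : A \in balls -> B \in balls ->
  [\/ A \subset B, B \subset A | [disjoint A & B]].
Proof.
case/ballsP => [-> _|[a _ ->] _|[a [b [ar br ab ->]]]].
- by constructor 2; exact: subsetT.
- exact: laminar_single.
case/ballsP => [->|[c _ ->]|[c [d [cr dr cd ->]]]].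
- by constructor 1; exact: subsetT.
- exact/laminar_sym/laminar_single.
have [dis|] := boolP [disjoint ball a (u a b) & ball c (u c d)]; first by constructor 3.
rewrite -setI_eq0 => /set0Pn[x]; rewrite inE => /andP[xa xc].
rewrite -(ball_eq ar xa) -(ball_eq cr xc).
have [le|/ltW le] := leP (u a b) (u c d).
  by constructor 2; exact: ball_mono.
by constructor 1; exact: ball_mono.
Qed.

Lemma ball_minimal A a b : A \in balls -> a != rho -> b != rho -> a != b ->
  a \in A -> b \in A -> ball a (u a b) \subset A.
Proof.
move=> AF ar br ab; case/ballsP: AF => [-> _ _|[c cr ->]|[c [d [cr dr cd ->]]] ac].
- exact: subsetT.
- by rewrite !inE => /eqP ea /eqP eb; rewrite ea eb eqxx in ab.
rewrite -(ball_eq cr ac) => bc; apply: ball_mono; move: bc.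
by rewrite inE eq_sym (negPf ab) br.
Qed.

(** The complement of [rho] is the ball around a point of a pair on which [u] is least. *)
Lemma balls_stem : N \in balls.
Proof.
have [a [b [ar br ab]]] : exists a b, [/\ a != rho, b != rho & a != b].
  by case/card_gt1P: N_gt1 => a [b []]; rewrite !inE => ar br ab; exists a, b.
pose P (p : T * T) := [&& p.1 != rho, p.2 != rho & p.1 != p.2].
have P0 : P (a, b) by rewrite /P /= ar br.
case: (arg_minP (fun p => u p.1 p.2) P0) => -[c d] /and3P[/= cr dr cd] cdmin.
suff -> : N = ball c (u c d) by exact: ball_in.
apply/setP => x; rewrite !inE; have [->|xr /=] := eqVneq x rho.
  by rewrite andFb orbF eq_sym (negPf cr).
have [//|xc /=] := eqVneq x c; apply/esym/(cdmin (c, x)).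
by rewrite /P /= cr xr eq_sym.
Qed.

(** Recovers the radius [u a b] of a ball from the bare set, as the least value of [u] on its
    pairs. *)
Definition height A : R :=
  if [pick p : T * T | [&& p.1 \in A, p.2 \in A, p.1 != p.2 &
      [forall x in A, forall y in A, (x != y) ==> (u p.1 p.2 <= u x y)]]] is Some p
  then u p.1 p.2 else 0.

Lemma height_ball a b : a != rho -> b != rho -> a != b ->
  height (ball a (u a b)) = u a b.
Proof.
move=> ar br ab; set A := ball _ _.
have aA : a \in A by exact: ball_center.
have bA : b \in A by rewrite inE br lexx orbT.
have le x y : x \in A -> y \in A -> x != y -> u a b <= u x y.
  move=> xA; rewrite /A -(ball_eq ar xA) inE => /orP[/eqP -> |/andP[] //].
  by rewrite eqxx.
rewrite /height; case: pickP => [[c d] /and4P[/= cA dA cd]|/(_ (a, b))/=].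
  move=> /forall_inP/(_ a aA)/forall_inP/(_ b bA)/implyP/(_ ab) le'.
  by apply/le_anti; rewrite le' le.
rewrite aA bA ab /= => /negbT/negP[].
apply/forall_inP => x xA; apply/forall_inP => y yA; apply/implyP; exact: le.
Qed.

Lemma balls_inner A : A \in balls -> ~~ is_foot A ->
  exists a b, [/\ a != rho, b != rho, a != b & A = ball a (u a b)].
Proof.
case/ballsP => [->|[a _ ->]|//]; first by rewrite /is_foot eqxx.
by rewrite /is_foot cards1 eqxx orbT.
Qed.

Lemma height_mono A B : A \in balls -> B \in balls -> ~~ is_foot A -> ~~ is_foot B ->
  A \proper B -> height B < height A.
Proof.
move=> AF BF /(balls_inner AF)[a [b [ar br ab eA]]] /(balls_inner BF)[c [d [cr dr cd eB]]].
rewrite eA eB !height_ball // => pAB; rewrite ltNge; apply: contraTN pAB => le.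
rewrite properE negb_and negbK; have [sub|//] := boolP (ball a _ \subset ball c _).
by rewrite -(ball_eq cr (subsetP sub _ (ball_center _ _))) ball_mono.
Qed.

Lemma ball_inner a b : a != rho -> b != rho -> a != b -> ~~ is_foot (ball a (u a b)).
Proof.
move=> ar br ab; have aA := ball_center a (u a b).
rewrite /is_foot negb_or; apply/andP; split.
  apply: contraNneq ar => e; have := ball_off_root (a := a) (t := u a b) (x := rho).
  by rewrite e inE eqxx => h; apply: contraT => /h /(_ isT).
rewrite gtn_eqF //; apply/card_gt1P; exists a, b; split=> //.
by rewrite inE br lexx orbT.
Qed.

Section Curve.
Variables (r : nat) (Delta : T -> 'rV[int]_r) (P0 : 'rV[R]_r).
Hypothesis Delta0 : \sum_l Delta l = 0.

Lemma ultrametric_curve : exists (C : param_trop_curve R Delta) (e : T -> vert C) (k : T -> R),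
  [/\ forall l, leg_end l (e l), tpos (e rho) = P0,
      forall a b, a != rho -> b != rho -> a != b ->
        has_dist (e a) (e b) (k a + k b - u a b *+ 2) &
      forall a, a != rho ->
        has_dist (e a) (e rho) (k a + k rho) /\ has_dist (e rho) (e a) (k rho + k a)].
Proof.
have [C [e [k [eE e0 dN dr]]]] := laminar_moduli_point balls_laminar balls_nonempty
  balls_single balls_top balls_stem balls_root N_gt1 height_mono P0 Delta0.
exists C, e, k; split=> // a b ar br ab; rewrite -(height_ball ar br ab).
apply: dN => //; rewrite ?ball_in ?ball_inner ?ball_center //.
  by rewrite inE br lexx orbT.
by move=> B BF aB bB; exact: ball_minimal.
Qed.

End Curve.
End BallFamily.

From mathcomp Require Import finmap ring_quotient generic_quotient fraction.
From mathcomp Require Import boolp classical_sets cardinality fsbigop.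
From mathcomp Require Import reals constructive_ereal lra ring zify.
Import Order.TTheory GRing.Theory Num.Theory.
Local Open Scope classical_set_scope.
Local Open Scope ring_scope.

(** * Group algebras and ideals *)

Section GroupAlgebraMaps.
Variable M : zmodType.

Lemma gmon_mul (F : comNzRingType) (c d : F) (m n : M) :
  (gmon c m : group_algebra F M) * gmon d n = gmon (c * d) (m + n).
Proof. exact: gmulUU. Qed.

Lemma gcoefB (F : comNzRingType) (f g : group_algebra F M) m :
  gcoef (f - g) m = gcoef f m - gcoef g m.
Proof. by rewrite gcoefD gcoefN. Qed.

Lemma group_algebra_ind (F : comNzRingType) (P : group_algebra F M -> Prop) :
  P 0 -> (forall c m f, P f -> P (gmon c m + f)) -> forall f, P f.
Proof.
move=> P0 PD f; rewrite [f]gsumE; elim: (enum_fset (gsupp f)) => [|m s IH].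
  by rewrite big_nil.
by rewrite big_cons; exact: PD.
Qed.

Lemma gmon_coefM (F : comNzRingType) (c : F) m (f : group_algebra F M) n :
  gcoef (gmon c m * f) n = c * gcoef f (n - m).
Proof.
elim/group_algebra_ind: f => [|d k f IH]; first by rewrite mulr0 !gcoef0 mulr0.
rewrite mulrDr !gcoefD IH gmon_mul !gcoef_mon mulrDr mulrnAr.
by rewrite [m + k]addrC -subr_eq.
Qed.

Section Map.
Variables (F G : comNzRingType) (phi : {rmorphism F -> G}).

Lemma gcoef_gmap (f : group_algebra F M) m :
  gcoef (gmap phi f) m = phi (gcoef f m).
Proof.
by rewrite /gmap gcoef_mk; case: ifPn => // /gcoef_out ->; rewrite rmorph0.
Qed.

Lemma gmapD (f g : group_algebra F M) :
  gmap phi (f + g) = gmap phi f + gmap phi g.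
Proof. by apply: gcoefP => m; rewrite gcoefD !gcoef_gmap gcoefD rmorphD. Qed.

Lemma gmap0 : gmap phi (0 : group_algebra F M) = 0.
Proof. by apply: gcoefP => m; rewrite gcoef_gmap !gcoef0 rmorph0. Qed.

Lemma gmap_mon c (m : M) : gmap phi (gmon c m) = gmon (phi c) m.
Proof. by apply: gcoefP => n; rewrite gcoef_gmap !gcoef_mon rmorphMn. Qed.

Lemma gmap1 : gmap phi (1 : group_algebra F M) = 1.
Proof. by apply: etrans (gmap_mon 1 0) _; rewrite rmorph1. Qed.

Lemma gmapM (f g : group_algebra F M) :
  gmap phi (f * g) = gmap phi f * gmap phi g.
Proof.
elim/group_algebra_ind: f => [|c m f IH]; first by rewrite mul0r gmap0 mul0r.
rewrite mulrDl !gmapD IH mulrDl; congr (_ + _).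
apply: gcoefP => n; rewrite gcoef_gmap gmon_coefM gmap_mon gmon_coefM.
by rewrite gcoef_gmap rmorphM.
Qed.
End Map.

Section Translate.
Variables (F : fieldType).
Implicit Types (t y : torus_point M F) (f g : group_algebra F M).

Lemma tfunN t m : t m * t (- m) = 1.
Proof. by rewrite -tfunD subrr tfun0. Qed.

Lemma tfun_neq0 t m : t m != 0.
Proof.
apply/eqP => t0; have := tfunN t m; rewrite t0 mul0r => /esym/eqP.
by rewrite oner_eq0.
Qed.

Lemma tfunV t m : t (- m) = (t m)^-1.
Proof. by apply: (mulfI (tfun_neq0 t m)); rewrite tfunN divff ?tfun_neq0. Qed.

Lemma gcoef_translate t f m : gcoef (translate t f) m = gcoef f m * t m.
Proof. by rewrite /translate gcoef_mk_supp // => ->; rewrite mul0r. Qed.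

Lemma translateD t f g : translate t (f + g) = translate t f + translate t g.
Proof.
by apply: gcoefP => m; rewrite gcoefD !gcoef_translate gcoefD mulrDl.
Qed.

Lemma translate0 t : translate t 0 = 0.
Proof. by apply: gcoefP => m; rewrite gcoef_translate !gcoef0 mul0r. Qed.

Lemma translate_mon t c m : translate t (gmon c m) = gmon (c * t m) m.
Proof.
apply: gcoefP => n; rewrite gcoef_translate !gcoef_mon.
by case: eqP => [->|_]; rewrite ?mul0r.
Qed.

Lemma translateM t f g : translate t (f * g) = translate t f * translate t g.
Proof.
elim/group_algebra_ind: f => [|c m f IH]; first by rewrite mul0r translate0 mul0r.
rewrite mulrDl !translateD IH mulrDl; congr (_ + _).
apply: gcoefP => n; rewrite gcoef_translate translate_mon !gmon_coefM.
by rewrite gcoef_translate mulrACA -tfunD [m + _]addrC subrK.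
Qed.

Fact tinv0 t : (fun m => t (- m)) 0 = 1.
Proof. by rewrite /= oppr0 tfun0. Qed.
Fact tinvD t m n : t (- (m + n)) = t (- m) * t (- n).
Proof. by rewrite opprD tfunD. Qed.
Definition tinv t : torus_point M F := TorusPoint (tinv0 t) (tinvD t).

Lemma translateK t f : translate t (translate (tinv t) f) = f.
Proof.
apply: gcoefP => m; rewrite !gcoef_translate /= -mulrA [t (- m) * _]mulrC.
by rewrite tfunN mulr1.
Qed.
End Translate.

Section Evaluation.
Variables (F : comNzRingType) (G : fieldType) (phi : {rmorphism F -> G}).
Variable y : torus_point M G.
Implicit Types (f g : group_algebra F M).

Definition gmap_eval f : G := \sum_(m <- gsupp f) phi (gcoef f m) * y m.

Lemma gmap_evalE f (s : seq M) : uniq s -> {subset gsupp f <= s} ->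
  gmap_eval f = \sum_(m <- s) phi (gcoef f m) * y m.
Proof.
move=> us sub; rewrite /gmap_eval [RHS](bigID (fun m => m \in gsupp f)) /=.
rewrite [X in _ + X]big1 => [|m ?]; last by rewrite gcoef_out // rmorph0 mul0r.
rewrite addr0 -[RHS]big_filter.
have p : perm_eq (enum_fset (gsupp f)) [seq m <- s | m \in gsupp f].
  apply: uniq_perm; [exact: fset_uniq|exact: filter_uniq|move=> m].
  rewrite mem_filter; case: (boolP (m \in gsupp f)) => [h|/negPf //].
  by rewrite sub //; exact: h.
by rewrite (perm_big _ p).
Qed.

Lemma gmap_evalD f g : gmap_eval (f + g) = gmap_eval f + gmap_eval g.
Proof.
pose s := undup (gsupp f ++ gsupp g ++ gsupp (f + g)).
have us : uniq s by exact: undup_uniq.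
rewrite !(@gmap_evalE _ s) //; last 3 first.
- by move=> m h; rewrite mem_undup !mem_cat h !orbT.
- by move=> m h; rewrite mem_undup !mem_cat h.
- by move=> m h; rewrite mem_undup !mem_cat h !orbT.
by rewrite -big_split; apply: eq_bigr => m _; rewrite gcoefD rmorphD mulrDl.
Qed.

Lemma gmap_eval0 : gmap_eval 0 = 0.
Proof. by apply: (addrI (gmap_eval 0)); rewrite -gmap_evalD !addr0. Qed.

Lemma gmap_eval_mon c m : gmap_eval (gmon c m) = phi c * y m.
Proof.
rewrite (@gmap_evalE _ [:: m]) //; first by rewrite big_seq1 gcoef_mon eqxx.
move=> n; rewrite inE; apply: contraLR => h.
by rewrite /gsupp mem_finsupp negbK -/(gcoef _ _) gcoef_mon (negPf h).
Qed.

Lemma gmap_eval1 : gmap_eval 1 = 1.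
Proof. by apply: etrans (gmap_eval_mon 1 0) _; rewrite rmorph1 tfun0 mul1r. Qed.

Lemma gmap_evalM f g : gmap_eval (f * g) = gmap_eval f * gmap_eval g.
Proof.
elim/group_algebra_ind: f => [|c m f IH].
  by rewrite mul0r gmap_eval0 mul0r.
rewrite mulrDl !gmap_evalD IH mulrDl; congr (_ + _).
rewrite gmap_eval_mon {f IH}; elim/group_algebra_ind: g => [|d n g IHg].
  by rewrite mulr0 gmap_eval0 mulr0.
rewrite mulrDr !gmap_evalD gmon_mul IHg mulrDr !gmap_eval_mon rmorphM tfunD.
by rewrite mulrACA.
Qed.

End Evaluation.
End GroupAlgebraMaps.

(** * Ideals and multiplicities *)

Section Ideals.
Variable A : comNzRingType.
Implicit Types (I J P Q : set A).

Lemma ideal_gen_ideal (S : set A) : is_ideal (ideal_gen S).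
Proof.
split=> [I [? _ _] _ //|a b ha hb I hI hS|a b hb I hI hS].
- by have [_ D _] := hI; apply: D; [exact: ha|exact: hb].
- by have [_ _ X] := hI; apply: X; exact: hb.
Qed.

Lemma ideal_gen_sub (S : set A) : S `<=` ideal_gen S.
Proof. by move=> a Sa I _; apply. Qed.

Lemma ideal_gen_min (S I : set A) : is_ideal I -> S `<=` I -> ideal_gen S `<=` I.
Proof. by move=> hI hS a; apply. Qed.

Lemma ideal_mul_congr I a b c d : is_ideal I ->
  I (a - c) -> I (b - d) -> I (a * b - c * d).
Proof.
move=> [_ ID IM] hac hbd; have := ID _ _ (IM b _ hac) (IM c _ hbd).
by rewrite !mulrBr addrA [b * c]mulrC subrK [b * a]mulrC.
Qed.

Lemma ideal_inv_congr I a b c d : is_ideal I -> a * b = 1 -> c * d = 1 ->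
  I (a - c) -> I (b - d).
Proof.
move=> [_ _ IM] ab cd h; have := IM (- (b * d)) _ h.
rewrite mulrBr mulNr mulrAC [b * a]mulrC ab mul1r mulNr opprK.
by rewrite -mulrA [d * c]mulrC cd mulr1 addrC.
Qed.

Lemma minimal_primes_prime P : is_prime P -> minimal_primes P = [set P].
Proof.
move=> pP; apply/seteqP; split=> [Q [pQ PQ]|_ ->].
  by move/(_ P pP (fun _ => id) PQ) ->.
by split=> // Q _ PQ QP; apply/seteqP; split.
Qed.

(** The local ring is a field. The chain consists of its zero ideal, at index 0, and the unit ideal.
    In any chain the first strict step already produces a unit, which leaves no room for a second
    one. *)
Lemma field_localization_length P : is_prime P -> has_length P P 1.
Proof.
move=> pP; have [[P0 PD PM] P1 Pm] := pP; have Pn a : P a -> P (- a).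
  by rewrite -mulN1r; exact: PM.
have PB a b : P a -> P b -> P (a - b) by move=> ? /Pn; exact: PD.
split.
  exists (fun i a s => (i == 0)%N -> P a); split=> [[|i] _|i].
  - split=> [a s a' s' ns ns' [w nw h] Pa _|_|a s a' s' _ _ ha ha' _|].
    + have {}h : P (s' * a - s * a') by case: (Pm _ _ h).
      have : P (s * a').
        by rewrite -[s * a'](subKr (s' * a)); apply: PB h; exact: PM (Pa _).
      by case/Pm.
    + exact: P0.
    + by apply: PD; apply: PM; [exact: ha|exact: ha'].
    + by move=> b r a s _ _ ha _; apply: PM; exact: ha.
  - by split=> //.
  - rewrite ltnS leqn0 => /eqP ->; split=> //; exists 1, 1; split=> //.
    by move/(_ isT).
case=> [//|[//|k]] [W [hW sW]]; exfalso.
have [_ [a [s [ns W1a nW0a]]]] := sW 0%N isT.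
have [_ [b [r [nr W2b nW1b]]]] := sW 1%N isT.
have [W0eq W00 _ _] := hW 0%N isT.
have [W1eq _ _ W1M] := hW 1%N isT.
have nPa : ~ P a.
  move=> Pa; apply: nW0a; apply: (W0eq 0 1) W00 => //.
  by exists 1; rewrite // mul1r mulr0 mul1r sub0r; exact: Pn.
apply: nW1b; have nar : ~ P (a * r) by case/Pm.
have := W1M (b * s) (a * r) a s nar ns W1a; apply: W1eq => //.
  by case/Pm.
exists 1; rewrite // mul1r.
suff -> : r * (b * s * a) - a * r * s * b = 0 by [].
by rewrite -!mulrA [b * _]mulrC -!mulrA [s * (a * b)]mulrCA [r * _]mulrCA subrr.
Qed.

Lemma sum_multiplicities_prime P : is_prime P -> sum_multiplicities P = 1%N.
Proof.
move=> pP; rewrite /sum_multiplicities minimal_primes_prime // fsbig_set1.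
have h1 := field_localization_length pP.
apply: (xget_unique _ (field_localization_length pP)) => n [hn mn]; apply/eqP; rewrite eqn_leq.
by have [h m] := h1; rewrite mn //= m.
Qed.
End Ideals.

(** * Valuations *)

Section Valuations.
Variables (R : realType) (F : fieldType) (v : valuation R F).
Implicit Types (x y : F) (r : R).

Lemma v_sum_ge (T : Type) (s : seq T) (P : pred T) (a : T -> F) (e : \bar R) :
  (forall i, P i -> (e <= v (a i))%E) -> (e <= v (\sum_(i <- s | P i) a i)%R)%E.
Proof.
move=> h; apply: (big_ind (fun x => (e <= v x)%E)) => //.
  by rewrite v0 leey.
by move=> x y hx hy; apply: le_trans (vD v x y); rewrite le_min hx.
Qed.

Lemma v_sum_gt (T : Type) (s : seq T) (P : pred T) (a : T -> F) r :
  (forall i, P i -> (r%:E < v (a i))%E) -> (r%:E < v (\sum_(i <- s | P i) a i)%R)%E.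
Proof.
move=> h; apply: (big_ind (fun x => (r%:E < v x)%E)) => //.
  by rewrite v0 ltry.
by move=> x y hx hy; apply: lt_le_trans (vD v x y); rewrite lt_min hx.
Qed.

Lemma vB x y : (Order.min (v x) (v y) <= v (x - y)%R)%E.
Proof. by rewrite -(vN v y); exact: vD. Qed.

Lemma v_addl x y : (v x < v y)%E -> v (x + y) = v x.
Proof.
move=> h; apply/le_anti/andP; split.
  rewrite leNgt; apply/negP => h'.
  have := vB (x + y) y; rewrite addrK leNgt lt_min h h' //.
by apply: le_trans (vD v x y); rewrite le_min lexx ltW.
Qed.

Lemma v_addr x y : (v y < v x)%E -> v (x + y) = v y.
Proof. by rewrite addrC; exact: v_addl. Qed.

Lemma v_neq0 x r : v x = r%:E -> x != 0.
Proof. by move=> h; apply/eqP => /(v_pinfty v); rewrite h. Qed.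

Lemma v_mulE x y r r' : v x = r%:E -> v y = r'%:E -> v (x * y) = (r + r')%:E.
Proof. by move=> hx hy; rewrite vM hx hy. Qed.

Lemma v_invE x r : v x = r%:E -> v x^-1 = (- r)%:E.
Proof.
move=> h; have x0 := v_neq0 h; have [r' h'] := v_fin v (invr_neq0 x0).
have := vV v x0; rewrite h h' -EFinD => -[] /eqP.
by rewrite addr_eq0 => /eqP ->; rewrite opprK.
Qed.

Lemma v_expE x r n : v x = r%:E -> v (x ^+ n) = (r *+ n)%:E.
Proof.
move=> h; elim: n => [|n IH]; first by rewrite expr0 v1 mulr0n.
by rewrite exprS mulrS; exact: v_mulE.
Qed.

Lemma v_exprzE x r (n : int) : v x = r%:E -> v (x ^ n) = (r *~ n)%:E.
Proof.
by case: n => n h; [exact: v_expE|rewrite NegzE -exprnN mulrNz; apply/v_invE/v_expE].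
Qed.

Lemma v_prodE (T : Type) (s : seq T) (P : pred T) (a : T -> F) (h : T -> R) :
  (forall i, P i -> v (a i) = (h i)%:E) ->
  v (\prod_(i <- s | P i) a i) = (\sum_(i <- s | P i) h i)%:E.
Proof.
move=> ha; elim/big_rec2: _ => [|i r x Pi IH]; first exact: v1.
by apply: v_mulE => //; exact: ha.
Qed.

Local Notation k := (residue_field v).
Local Notation vval := (val : vring v -> F).

Definition vring_residue : vring v -> k := \pi_({ideal_quot @vmax R F v})%qT.
HB.instance Definition _ := GRing.RMorphism.copy vring_residue
  (\pi_({ideal_quot @vmax R F v})%qT).

Lemma residue_val (x : vring v) : residue v (val x) = vring_residue x.
Proof. by rewrite /residue valKd. Qed.

Lemma vring_residue_eq0 (x : vring v) : (vring_residue x == 0) = (0 < v (val x))%E.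
Proof.
transitivity (x \in @vmax R F v); last by [].
by rewrite -[x in RHS]subr0 Quotient.idealrBE -(rmorph0 vring_residue).
Qed.

Lemma residue0 : residue v 0 = 0.
Proof.
by rewrite -(rmorph0 (val : vring v -> F)) residue_val rmorph0.
Qed.

Variable M : zmodType.
Implicit Types (g : group_algebra F M) (h : group_algebra (vring v) M).

Definition integral g := forall m, (0 <= v (gcoef g m))%E.

Lemma integral_lift g : integral g ->
  exists2 h, gmap vval h = g & gsupp h = gsupp g.
Proof.
move=> ig; pose c (x : F) : vring v := insubd (0 : vring v) x.
pose h := gmk (gsupp g) (fun m => c (gcoef g m)).
have hE m : val (gcoef h m) = gcoef g m.
  rewrite gcoef_mk; case: ifPn => [_|/gcoef_out -> //].
  by rewrite val_insubd ifT //; exact: ig.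
exists h; first by apply: gcoefP => m; rewrite gcoef_gmap; exact: hE.
apply/fsetP => m; rewrite !mem_finsupp.
rewrite -/(gcoef h m) -/(gcoef g m) -hE.
by apply/idP/idP; apply: contra => /eqP e; apply/eqP; [exact: val_inj|rewrite e].
Qed.

Lemma integral_gmap_val h : integral (gmap vval h).
Proof. by move=> m; rewrite gcoef_gmap; exact: (valP (gcoef h m)). Qed.

Lemma gcoef_residue g m : gcoef (gmap (residue v) g) m = residue v (gcoef g m).
Proof.
by rewrite /gmap gcoef_mk; case: ifPn => // /gcoef_out ->; rewrite residue0.
Qed.

Lemma gmap_residue_val h : gmap (residue v) (gmap vval h) = gmap vring_residue h.
Proof.
by apply: gcoefP => m; rewrite gcoef_residue !gcoef_gmap residue_val.
Qed.

(** The lift has no larger support, so that it can be evaluated as a sum over the support of [f]. *)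
Lemma gmap_residue_surj (f : group_algebra k M) :
  exists2 h, gmap vring_residue h = f & {subset gsupp h <= gsupp f}.
Proof.
pose c (a : k) : vring v := repr (a : {ideal_quot @vmax R F v}).
pose h := gmk (gsupp f) (fun m => c (gcoef f m)).
exists h; last first.
  move=> m; apply: contraLR => mf; rewrite mem_finsupp negbK -/(gcoef _ _).
  by rewrite gcoef_mk (negPf mf).
apply: gcoefP => m; rewrite gcoef_gmap gcoef_mk; case: ifPn => [_|/gcoef_out ->].
  exact: reprK.
exact: rmorph0.
Qed.

End Valuations.

(** * Initial ideals *)

Section InitialIdeal.
Variables (R : realType) (F : fieldType) (v : valuation R F) (M : zmodType).
Variables (I : set (group_algebra F M)) (t : torus_point M F).
Hypothesis idI : is_ideal I.
Local Notation vval := (val : vring v -> F).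
Local Notation k := (residue_field v).
Local Notation vres := (@vring_residue R F v).
Local Notation J := (@initial_ideal M R F v I t).

Lemma translate_ideal : is_ideal (translate t @` I).
Proof.
have [I0 ID IM] := idI; split=> [|_ _ [f If <-] [g Ig <-]|f _ [g Ig <-]].
- by exists 0; rewrite ?translate0.
- by exists (f + g); rewrite ?translateD //; exact: ID.
- exists (translate (tinv t) f * g); first exact: IM.
  by rewrite translateM translateK.
Qed.

(** With coefficients in the valuation ring, reduction is a ring morphism, which [residue] on the
    whole field is not. *)
Lemma initial_idealP (a : group_algebra k M) : J a <->
  exists2 h, (translate t @` I) (gmap vval h) & gmap vres h = a.
Proof.
split=> [[g [Ig ig] <-]|[h Ih <-]].
  have [h hg _] := integral_lift ig; exists h; rewrite ?hg //.
  by rewrite -gmap_residue_val hg.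
exists (gmap vval h); last exact: gmap_residue_val.
by split=> //; exact: integral_gmap_val.
Qed.

Lemma initial_ideal_ideal : is_ideal J.
Proof.
have [T0 TD TM] := translate_ideal; split.
- by apply/initial_idealP; exists 0; rewrite gmap0.
- move=> a b /initial_idealP[f hf <-] /initial_idealP[g hg <-].
  by apply/initial_idealP; exists (f + g); rewrite gmapD //; exact: TD.
- move=> a b /initial_idealP[g hg <-].
  have [f <- _] := gmap_residue_surj a.
  by apply/initial_idealP; exists (f * g); rewrite gmapM //; exact: TM.
Qed.

(* Translated by t and divided by its monomial of lowest valuation, an element
   of I with coefficients 1 specializes to its initial form. *)
Lemma initial_form (s : M -> R) (m0 : M) (ms : seq M) :
  (forall m, v (t m) = (s m)%:E) ->
  I (gmon 1 m0 + \sum_(m <- ms) gmon 1 m) -> {in ms, forall m, s m0 <= s m} ->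
  exists c : M -> k, {in ms, forall m, (c m == 0) = (s m0 < s m)} /\
    J (1 + \sum_(m <- ms) gmon (c m) (m - m0)).
Proof.
move=> vt If hs; have [_ _ IM] := idI.
have vB m : v (t (m - m0)) = (s m - s m0)%:E.
  by rewrite tfunD tfunV (v_mulE (vt m) (v_invE (vt m0))).
pose c (m : M) : vring v := insubd (0 : vring v) (t (m - m0)).
have cE m : m \in ms -> vval (c m) = t (m - m0).
  by move=> hm; rewrite val_insubd ifT // inE vB lee_fin subr_ge0 hs.
exists (fun m => vres (c m)); split=> [m hm|].
  by rewrite vring_residue_eq0 cE // vB lte_fin subr_gt0.
apply/initial_idealP; exists (1 + \sum_(m <- ms) gmon (c m) (m - m0)); last first.
  rewrite gmapD gmap1; congr (_ + _).
  by elim: (ms) => [|m l IH]; rewrite ?big_nil ?gmap0 // !big_cons gmapD IH gmap_mon.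
exists (gmon 1 (- m0) * (gmon 1 m0 + \sum_(m <- ms) gmon 1 m)); first exact: IM.
rewrite mulrDr translateD gmapD; congr (_ + _).
  by rewrite gmon_mul mulr1 addNr translate_mon tfun0 gmap1 mulr1.
elim: (ms) cE => [|m l IH] cE; first by rewrite !big_nil mulr0 translate0 gmap0.
rewrite !big_cons mulrDr translateD IH; last first.
  by move=> i il; rewrite cE // inE il orbT.
rewrite gmapD gmap_mon gmon_mul translate_mon !mul1r [- m0 + m]addrC.
by rewrite -[X in gmon X _]cE ?inE ?eqxx.
Qed.

(** * The prime ideal of the specialization of a point *)

Section Point.
Variables (F' : fieldType) (v' : valuation R F') (j : {rmorphism F -> F'}).
Hypothesis vj : forall x, v' (j x) = v x.
Variables (y : torus_point M F') (s : M -> R).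
Hypothesis vt : forall m, v (t m) = (s m)%:E.
Hypothesis vy : forall m, v' (y m) = (s m)%:E.
Hypothesis Iy : forall f, I f -> gmap_eval j y f = 0.

Fact yt0 : y 0 / j (t 0) = 1.
Proof. by rewrite !tfun0 rmorph1 divr1. Qed.
Fact ytD m n : y (m + n) / j (t (m + n)) = (y m / j (t m)) * (y n / j (t n)).
Proof. by rewrite !tfunD rmorphM invfM mulrACA. Qed.
(** Both [y] and [t] have valuation [s], so all characters have valuation 0 at the quotient, which
    therefore specializes to a point of the torus. *)
Definition ytrans : torus_point M F' := TorusPoint yt0 ytD.

Lemma v_ytrans m : v' (ytrans m) = 0%E.
Proof.
have hj : v' (j (t m)) = (s m)%:E by rewrite vj.
by rewrite vM vy (v_invE hj) -EFinD subrr.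
Qed.

Local Notation ev := (gmap_eval (j \o vval) ytrans).

Lemma ev_val (h : group_algebra (vring v) M) :
  ev h = gmap_eval j ytrans (gmap vval h).
Proof.
elim/group_algebra_ind: h => [|c m h IH]; first by rewrite gmap0 !gmap_eval0.
by rewrite gmapD !gmap_evalD IH gmap_mon !gmap_eval_mon.
Qed.

Lemma ev_translate f : gmap_eval j ytrans (translate t f) = gmap_eval j y f.
Proof.
elim/group_algebra_ind: f => [|c m h IH]; first by rewrite translate0 !gmap_eval0.
rewrite translateD !gmap_evalD IH translate_mon !gmap_eval_mon /= rmorphM.
by rewrite mulrA mulrAC mulfK // fmorph_eq0 tfun_neq0.
Qed.

Lemma ev_ge0 h : (0 <= v' (ev h))%E.
Proof.
rewrite /gmap_eval; apply: v_sum_ge => m _; rewrite vM v_ytrans adde0 /= vj.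
exact: (valP (gcoef h m)).
Qed.

Lemma ev_gt0 h : gmap vres h = 0 -> (0 < v' (ev h))%E.
Proof.
move=> h0; rewrite /gmap_eval; apply: v_sum_gt => m _.
rewrite vM v_ytrans adde0 /= vj -vring_residue_eq0 -gcoef_gmap h0.
by rewrite gcoef0.
Qed.

(* The ideal of the closure of the specialization of the point y / t; the
   residue field of F' is avoided by testing lifts. *)
Definition point_ideal : set (group_algebra k M) :=
  [set a | exists2 h, gmap vres h = a & (0 < v' (ev h))%E].
Local Notation P := point_ideal.

(** Two lifts differ by coefficients of positive valuation, and characters have valuation 0 at
    [ytrans], so any lift may be tested. *)
Lemma point_idealP h : P (gmap vres h) <-> (0 < v' (ev h))%E.
Proof.
split=> [[g e hg]|]; last by exists h.
rewrite -[h](subrK g) gmap_evalD; apply: lt_le_trans (vD _ _ _).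
rewrite lt_min hg andbT; apply: ev_gt0; apply: gcoefP => m.
by rewrite gcoef_gmap gcoefB rmorphB -!gcoef_gmap e subrr gcoef0.
Qed.

Lemma point_ideal_prime : is_prime P.
Proof.
split; first split.
- by exists 0; rewrite ?gmap0 // gmap_eval0 v0 ltry.
- move=> _ _ [f <- hf] [g <- hg]; exists (f + g); first exact: gmapD.
  by rewrite gmap_evalD; apply: lt_le_trans (vD _ _ _); rewrite lt_min hf.
- move=> a _ [g <- hg]; have [f <- _] := gmap_residue_surj a.
  exists (f * g); first exact: gmapM.
  by rewrite gmap_evalM vM; apply: lt_le_trans hg _; rewrite leeDr // ev_ge0.
- by rewrite -(gmap1 _ vres) => /point_idealP; rewrite gmap_eval1 v1 ltxx.
- move=> a b; have [f <- _] := gmap_residue_surj a.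
  have [g <- _] := gmap_residue_surj b; rewrite -gmapM => /point_idealP.
  rewrite gmap_evalM vM => hfg; have := ev_ge0 f; rewrite le_eqVlt.
  case/orP => [/eqP e|]; last by left; apply/point_idealP.
  by right; apply/point_idealP; rewrite -e add0e in hfg.
Qed.

Lemma initial_sub_point_ideal : J `<=` P.
Proof.
move=> _ /initial_idealP[h [f If e] <-]; exists h => //.
by rewrite ev_val -e ev_translate Iy // v0 ltry.
Qed.

Lemma initial_ideal_proper : ~ J 1.
Proof. by move/initial_sub_point_ideal; case: point_ideal_prime. Qed.

Variables (T : eqType) (phi : M -> T).
Hypothesis phiJ : forall m m', phi m = phi m' ->
  exists c, J (gmon 1 m - gmon c m').
Hypothesis phi_indep : forall (S : seq M) (c : M -> F), uniq (map phi S) ->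
  forall m, m \in S ->
  (v' (\sum_(n <- S) j (c n) * y n)%R <= v (c m) + (s m)%:E)%E.

(** [phi m] is to be read as the leading monomial of the character [m] at [y]. Induction on the size
    of the support: two characters with the same [phi] allow one of them to be eliminated modulo
    [J]; once all [phi] are distinct, independence passes the positive valuation of the value on to
    every coefficient. *)
Lemma point_ideal_sub_initial : P `<=` J.
Proof.
have [J0 JD JM] := initial_ideal_ideal; have [[_ PD PM] _ _] := point_ideal_prime.
move=> f; have [n] := ubnP #|` gsupp f|; elim: n f => // n IH f sf Pf.
have [u|nu] := boolP (uniq (map phi (gsupp f))).
  suff -> : f = 0 by [].
  have [h hf sub] := gmap_residue_surj f; apply: gcoefP => m; rewrite gcoef0.
  have [mf|] := boolP (m \in gsupp f); last exact: gcoef_out.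
  rewrite -hf gcoef_gmap; apply/eqP; rewrite vring_residue_eq0.
  have := Pf; rewrite -hf => /point_idealP hv.
  (* Division by [t n] turns the values of [y] into those of [ytrans]. *)
  have := phi_indep (fun n => vval (gcoef h n) / t n) u mf.
  rewrite vM -addeA (v_invE (vt m)) -EFinD addNr adde0.
  apply: lt_le_trans; move: hv; congr (_ < v' _)%E.
  rewrite (gmap_evalE _ _ _ sub); last exact: fset_uniq.
  apply: eq_bigr => i _ /=; rewrite rmorphM fmorphV -!mulrA; congr (_ * _).
  by rewrite mulrC.
have [m [m' [mf mf' e ne]]] : exists m m', [/\ m \in gsupp f, m' \in gsupp f,
    phi m = phi m' & m != m'].
  apply: contrapT => hn; move/negP: nu; apply; rewrite map_inj_in_uniq.
    exact: fset_uniq.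
  move=> m m' mf mf' e; apply: contrapT => ne; apply: hn; exists m, m'.
  by split=> //; apply/eqP.
have [c Jc] := phiJ e; set b := _ - _ in Jc.
(* Subtracting [d] cancels the term at [m] and changes only the one at [m'], which is already in the
   support. *)
pose d : group_algebra k M := gmon (gcoef f m) 0 * b.
have Jd : J d by exact: JM.
rewrite -[f](subrK d); apply: JD => //; apply: IH; last first.
  apply: PD => //; rewrite -mulN1r; apply: PM; exact: initial_sub_point_ideal.
have dE i : gcoef d i = gcoef f m * ((i == m)%:R - c *+ (i == m')).
  by rewrite gmon_coefM subr0 gcoefB !gcoef_mon.
move: sf; rewrite ltnS; apply: leq_trans.
rewrite [X in (_ < X)%N](cardfsD1 m) mf add1n ltnS; apply: fsubset_leq_card.
apply/fsubsetP => i; rewrite in_fsetD1; apply: contraLR; rewrite negb_and negbK.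
move=> h; rewrite mem_finsupp negbK -/(gcoef (f - d) i) gcoefB dE.
have [e1|im] := eqVneq i m.
  by rewrite e1 (negPf ne) mulr0n subr0 mulr1 subrr.
move: h; rewrite (negPf im) /= sub0r => h; rewrite (gcoef_out h) sub0r.
case: (eqVneq i m') h => [->|_ _]; first by rewrite mf'.
by rewrite mulr0n oppr0 mulr0 oppr0.
Qed.

Lemma initial_ideal_prime : is_prime J.
Proof.
suff -> : J = P by exact: point_ideal_prime.
apply/seteqP; split; [exact: initial_sub_point_ideal|exact: point_ideal_sub_initial].
Qed.

End Point.

(** The characters that are a nonzero constant modulo the initial ideal. They form a subgroup of
    [M], so it is enough to exhibit generators. *)
Definition binomial_mem (m : M) := exists2 c, c != 0 & J (gmon 1 m - gmon c 0).

Lemma binomial_mem0 : binomial_mem 0.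
Proof.
exists 1; first exact: oner_neq0.
by rewrite subrr; case: initial_ideal_ideal.
Qed.

Lemma binomial_memD m n : binomial_mem m -> binomial_mem n -> binomial_mem (m + n).
Proof.
case=> c c0 hc [d d0 hd]; exists (c * d); first exact: mulf_neq0.
have := ideal_mul_congr initial_ideal_ideal hc hd.
by rewrite !gmon_mul mulr1 addr0.
Qed.

Lemma binomial_memN m : binomial_mem m -> binomial_mem (- m).
Proof.
case=> c c0 hc; exists c^-1; first by rewrite invr_eq0.
apply: ideal_inv_congr initial_ideal_ideal _ _ hc.
  by rewrite gmon_mul mulr1 subrr.
by rewrite gmon_mul divff // addr0.
Qed.

Lemma binomial_mem_gmon m n : binomial_mem (m - n) ->
  exists c, J (gmon 1 m - gmon c n).
Proof.
have [J0 _ _] := initial_ideal_ideal.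
case=> c c0 hc; exists c.
have h0 : J (gmon 1 n - gmon 1 n) by rewrite subrr.
have := ideal_mul_congr initial_ideal_ideal hc h0.
by rewrite !gmon_mul !mulr1 add0r subrK.
Qed.

End InitialIdeal.

(** * Gauss extensions *)

Section FractionValuation.
Variables (R : realType) (A : idomainType) (w : A -> \bar R).
Hypothesis w_pinfty : forall x, w x = +oo%E <-> x = 0.
Hypothesis w_ninfty : forall x, w x <> -oo%E.
Hypothesis wM : forall x y, w (x * y) = (w x + w y)%E.
Hypothesis wD : forall x y, (Order.min (w x) (w y) <= w (x + y)%R)%E.
Local Notation Q := {fraction A}.
Local Notation "x %:F" := (@FracField.tofrac A x).

Lemma fraction_numden (x : Q) :
  exists p q, [/\ q != 0 & x = p%:F / q%:F].
Proof.
elim/quotW: x => r; exists \n_r, \d_r; have d0 : \d_r != 0 by exact: denom_ratioP.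
split=> //; apply: (canRL (mulfK _)); first by rewrite tofrac_eq0.
apply/eqP; rewrite /GRing.mul /= !piE /FracField.mulf /FracField.equivf.
by rewrite !numden_Ratio ?mulf_neq0 ?oner_eq0 // !mulr1 mulrC.
Qed.

Let wf (x : A) : R := fine (w x).

Lemma wfE x : x != 0 -> w x = (wf x)%:E.
Proof.
rewrite /wf => x0; case E : (w x) => [r| |] //; last by case: (w_ninfty E).
by move/w_pinfty: E x0 => ->; rewrite eqxx.
Qed.

Lemma wfM x y : x != 0 -> y != 0 -> wf (x * y) = wf x + wf y.
Proof.
by move=> x0 y0; rewrite {1}/wf wM !wfE // -EFinD.
Qed.

(** [xget] picks the common value of all ways to write [x] as a fraction with nonzero numerator; for
    0 there is none, and the default [+oo] is the right value. *)
Definition frac_val (x : Q) : \bar R :=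
  xget +oo%E [set e | exists p q,
    [/\ p != 0, q != 0, x = p%:F / q%:F & e = (wf p - wf q)%:E]].

Lemma frac_valE p q : p != 0 -> q != 0 ->
  frac_val (p%:F / q%:F) = (wf p - wf q)%:E.
Proof.
move=> p0 q0; apply: xget_unique; first by exists p, q.
move=> _ [p' [q' [p0' q0' + ->]]] => /eqP.
rewrite eqr_div ?tofrac_eq0 // -!tofracM tofrac_eq => /eqP /(congr1 wf).
by rewrite !wfM // => e; congr EFin; lra.
Qed.

Lemma frac_val0 : frac_val 0 = +oo%E.
Proof.
apply: xgetPN => e [p [q [p0 q0 /esym/eqP]]]; rewrite mulf_eq0 invr_eq0.
by rewrite !tofrac_eq0 (negPf p0) (negPf q0).
Qed.

Lemma frac_val_tofrac p : frac_val p%:F = w p.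
Proof.
have [->|p0] := eqVneq p 0; first by rewrite tofrac0 frac_val0; apply/esym/w_pinfty.
rewrite -[p%:F]divr1 -tofrac1 frac_valE ?oner_eq0 // wfE //.
have := wfM (oner_neq0 A) (oner_neq0 A); rewrite mulr1 => e.
by congr EFin; lra.
Qed.

Lemma fraction_ind (P : Q -> Prop) :
  P 0 -> (forall p q, p != 0 -> q != 0 -> P (p%:F / q%:F)) -> forall x, P x.
Proof.
move=> P0 PE x; have [p [q [q0 ->]]] := fraction_numden x.
have [->|p0] := eqVneq p 0; first by rewrite tofrac0 mul0r.
exact: PE.
Qed.

Fact frac_val_pinfty x : frac_val x = +oo%E <-> x = 0.
Proof.
elim/fraction_ind: x => [|p q p0 q0]; first by rewrite frac_val0.
rewrite frac_valE //; split=> // /eqP; rewrite mulf_eq0 invr_eq0.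
by rewrite !tofrac_eq0 (negPf p0) (negPf q0).
Qed.

Fact frac_val_ninfty x : frac_val x <> -oo%E.
Proof. by elim/fraction_ind: x => [|p q p0 q0]; rewrite ?frac_val0 ?frac_valE. Qed.

Fact frac_valM x y : frac_val (x * y) = (frac_val x + frac_val y)%E.
Proof.
elim/fraction_ind: x => [|p q p0 q0].
  by rewrite mul0r frac_val0 addye //; apply/eqP/frac_val_ninfty.
elim/fraction_ind: y => [|p' q' p0' q0'].
  by rewrite mulr0 frac_val0 addey //; apply/eqP/frac_val_ninfty.
rewrite mulf_div -!tofracM !frac_valE ?mulf_neq0 // !wfM // -EFinD.
by rewrite opprD addrACA.
Qed.

Fact frac_valD x y :
  (Order.min (frac_val x) (frac_val y) <= frac_val (x + y)%R)%E.
Proof.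
elim/fraction_ind: x => [|p q p0 q0].
  by rewrite add0r ge_min lexx orbT.
elim/fraction_ind: y => [|p' q' p0' q0'].
  by rewrite addr0 ge_min lexx.
rewrite addf_div ?tofrac_eq0 // -!tofracM -tofracD.
rewrite [frac_val (p%:F / _)]frac_valE // [frac_val (p'%:F / _)]frac_valE //.
set n : A := p * q' + p' * q; have [->|n0] := eqVneq n 0.
  by rewrite tofrac0 mul0r frac_val0 leey.
rewrite frac_valE ?mulf_neq0 // -EFin_min lee_fin wfM //.
have := wD (p * q') (p' * q); rewrite -/n !wfE ?mulf_neq0 // !wfM //.
rewrite -EFin_min lee_fin !ge_min => /orP[] h; apply/orP; [left|right].
  by lra.
by lra.
Qed.

Definition fraction_valuation : valuation R Q :=
  Valuation frac_val_pinfty frac_val_ninfty frac_valM frac_valD.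

End FractionValuation.

Section GaussValuation.
Variables (R : realType) (F : fieldType) (v : valuation R F) (h : R).
Implicit Types p q : {poly F}.

Definition poly_val p : \bar R :=
  \big[Order.min/+oo%E]_(i < size p) (v p`_i + (h *+ i)%:E)%E.

Lemma le_poly_val p e :
  (e <= poly_val p)%E <-> forall i, (e <= v p`_i + (h *+ i)%:E)%E.
Proof.
split=> [le i|hi].
  have [ip|ip] := ltnP i (size p); last by rewrite nth_default // v0 addye // leey.
  apply: le_trans le _; exact: (bigmin_le _ (Ordinal ip)).
by apply: le_bigmin => [|i _]; rewrite ?leey.
Qed.

Lemma poly_val_le p i : (poly_val p <= v p`_i + (h *+ i)%:E)%E.
Proof. by move: i; apply/le_poly_val. Qed.

(** The strict inequality before [i] says that [i] is the first index of minimal valuation, as the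
    proof of Gauss's lemma needs. *)
Lemma poly_val_attained p : p != 0 -> exists i a,
  [/\ v p`_i = a%:E, poly_val p = (a + h *+ i)%:E &
      forall j, (j < i)%N -> (poly_val p < v p`_j + (h *+ j)%:E)%E].
Proof.
move=> p0; have sp : (0 < size p)%N by rewrite size_poly_gt0.
have ex : exists i, poly_val p == (v p`_i + (h *+ i)%:E)%E.
  have [i _ e] := @eq_bigmin _ _ _ +oo%E (Ordinal sp) xpredT
    (fun i : 'I_(size p) => v p`_i + (h *+ i)%:E)%E isT (fun _ _ => leey _).
  by exists i; apply/eqP; exact: e.
have [i /eqP hi min] := ex_minnP ex.
have [b hb] : exists b, v (lead_coef p) = b%:E by apply: v_fin; rewrite lead_coef_eq0.
have : (poly_val p < +oo)%E.
  by apply: le_lt_trans (poly_val_le p (size p).-1) _; rewrite -/(lead_coef p) hb ltry.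
case E : (v p`_i) hi => [a| |] // hi; last first.
- by case: (v_ninfty E).
- by rewrite hi ltxx.
exists i, a; split=> // j ji; rewrite lt_neqAle poly_val_le andbT.
by apply/negP => /min; rewrite leqNgt ji.
Qed.

Lemma poly_val_fin p : p != 0 -> exists a, poly_val p = a%:E.
Proof. by move=> /poly_val_attained[i [a [_ -> _]]]; eexists. Qed.

Lemma poly_val0 : poly_val 0 = +oo%E.
Proof. by rewrite /poly_val size_poly0 big_ord0. Qed.

Fact poly_val_pinfty p : poly_val p = +oo%E <-> p = 0.
Proof.
split=> [e|->]; last exact: poly_val0.
by apply/eqP; apply/negPn/negP => /poly_val_fin[a]; rewrite e.
Qed.

Fact poly_val_ninfty p : poly_val p <> -oo%E.
Proof.
have [->|/poly_val_fin[a ->] //] := eqVneq p 0; by rewrite poly_val0.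
Qed.

Fact poly_valD p q : (Order.min (poly_val p) (poly_val q) <= poly_val (p + q)%R)%E.
Proof.
apply/le_poly_val => i; rewrite coefD.
have := vD v p`_i q`_i; rewrite !ge_min => /orP[] l; apply/orP; [left|right].
  by apply: le_trans (leeD2r _ l); exact: poly_val_le.
by apply: le_trans (leeD2r _ l); exact: poly_val_le.
Qed.

(* Gauss's lemma: the product of the first coefficients of minimal valuation
   is the only contribution of minimal valuation to its degree. *)
Fact poly_valM p q : poly_val (p * q) = (poly_val p + poly_val q)%E.
Proof.
have [->|p0] := eqVneq p 0.
  by rewrite mul0r poly_val0 addye //; apply/eqP/poly_val_ninfty.
have [->|q0] := eqVneq q 0.
  by rewrite mulr0 poly_val0 addey //; apply/eqP/poly_val_ninfty.
have [i [a [pi pE ltp]]] := poly_val_attained p0.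
have [j [b [qj qE ltq]]] := poly_val_attained q0.
have gep n : ((a + h *+ i)%:E <= v p`_n + (h *+ n)%:E)%E by rewrite -pE poly_val_le.
have geq n : ((b + h *+ j)%:E <= v q`_n + (h *+ n)%:E)%E by rewrite -qE poly_val_le.
rewrite pE qE -EFinD; apply/le_anti/andP; split.
  apply: le_trans (poly_val_le _ (i + j)) _.
  suff -> : v (p * q)`_(i + j) = (a + b)%:E.
    by rewrite -EFinD lee_fin mulrnDr addrACA.
  have ij : (i < (i + j).+1)%N by rewrite ltnS leq_addr.
  rewrite coefM (bigD1 (Ordinal ij)) //= addKn -(v_mulE pi qj).
  apply: v_addl; rewrite (v_mulE pi qj); apply: v_sum_gt => n ni.
  have nij : (n <= i + j)%N by rewrite -ltnS.
  have {}ni : (n : nat) != i by [].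
  rewrite vM; move: (ltp n) (gep n) (ltq (i + j - n)%N) (geq (i + j - n)%N).
  rewrite pE qE.
  case: (v p`_n) (@v_ninfty _ _ v p`_n) => [x| |] //= _;
   case: (v q`_(i + j - n)) (@v_ninfty _ _ v q`_(i + j - n)) => [y| |] //= _; 
   rewrite ?ltry // -?EFinD ?lte_fin ?lee_fin.
  have -> : h *+ (i + j - n) = h *+ i + h *+ j - h *+ n by rewrite mulrnBr // mulrnDr.
  move=> l1 l2 l3 l4; have [lt|lt|e] := ltngtP n i.
  - by have := l1 lt; lra.
  - have /l3 : (i + j - n < j)%N by rewrite ltn_subLR // ltn_add2r.
    by lra.
  - by rewrite e eqxx in ni.
apply/le_poly_val => n; rewrite coefM.
suff le : ((a + h *+ i + (b + h *+ j) - h *+ n)%:E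
    <= v (\sum_(k < n.+1) p`_k * q`_(n - k))%R)%E.
  by apply: le_trans (leeD2r _ le); rewrite -EFinD lee_fin subrK.
apply: v_sum_ge => k _; have kn : (k <= n)%N by rewrite -ltnS.
rewrite vM; move: (gep k) (geq (n - k)%N).
case: (v p`_k) (@v_ninfty _ _ v p`_k) => [x| |] //= _;
  case: (v q`_(n - k)) (@v_ninfty _ _ v q`_(n - k)) => [y| |] //= _;
  rewrite ?leey // -?EFinD ?lee_fin mulrnBr //.
by lra.
Qed.

End GaussValuation.

Section GaussExtension.
Variable R : realType.

(** [z] is the variable of the rational function field. The last clause expresses its independence:
    terms with distinct exponents of [z] never cancel. *)
Lemma gauss_extension1 (F : fieldType) (v : valuation R F) (h : R) :
  exists (F' : fieldType) (v' : valuation R F') (j : {rmorphism F -> F'}) (z : F'),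
  [/\ forall x, v' (j x) = v x, v' z = h%:E &
      forall p i, (v' (map_poly j p).[z] <= v p`_i + (h *+ i)%:E)%E].
Proof.
pose v' := fraction_valuation (poly_val_pinfty v h) (@poly_val_ninfty _ _ v h)
  (poly_valM v h) (poly_valD v h).
pose j : {rmorphism F -> {fraction {poly F}}} := @FracField.tofrac _ \o polyC.
have v'E p : v' (FracField.tofrac p) = poly_val v h p.
  apply: frac_val_tofrac; [exact: poly_val_pinfty|exact: poly_val_ninfty|].
  exact: poly_valM.
exists {fraction {poly F}}, v', j, (FracField.tofrac 'X); split=> [x||p i].
- rewrite -[j x]/(FracField.tofrac x%:P) v'E.
  have [->|x0] := eqVneq x 0; first by rewrite polyC0 poly_val0 v0.
  by rewrite /poly_val size_polyC x0 big_ord1 coefC eqxx mulr0n adde0.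
- rewrite v'E; apply/le_anti/andP; split.
    by apply: le_trans (poly_val_le _ _ _ 1) _; rewrite coefX eqxx v1 add0e.
  apply/le_poly_val => i; rewrite coefX; case: eqP => [->|_].
    by rewrite v1 add0e.
  by rewrite v0 addye // leey.
- rewrite (map_poly_comp (@FracField.tofrac _) polyC) horner_map v'E.
  by rewrite -/(comp_poly _ _) comp_polyXr; exact: poly_val_le.
Qed.

(** The sum is read as a polynomial in the last variable; the terms with a given exponent of it are
    separated by the previous extension. The predicate [A] serves to pass to these subfamilies. *)
Lemma gauss_extension_nat (F : fieldType) (v : valuation R F) (h : nat -> R) d :
  exists (F' : fieldType) (v' : valuation R F') (j : {rmorphism F -> F'})
    (z : nat -> F'),
  [/\ forall x, v' (j x) = v x, forall i, (i < d)%N -> v' (z i) = (h i)%:E &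
    forall (T : finType) (A : pred T) (c : T -> F) (al : T -> nat -> nat),
      {in A &, forall t t', (forall i, (i < d)%N -> al t i = al t' i) -> t = t'} ->
      {in A, forall t,
        (v' (\sum_(t | A t) j (c t) * \prod_(i < d) z i ^+ al t i)%R
          <= v (c t) + (\sum_(i < d) h i *+ al t i)%R%:E)%E}].
Proof.
elim: d => [|d [F1 [v1' [j1 [z1 [v1E z1E ind1]]]]]].
  exists F, v, idfun, (fun=> 1); split=> // T A c al inj t; rewrite unfold_in => At.
  rewrite (bigD1 t) //= [X in _ + X]big1 => [|k /andP[Ak] /eqP kt]; last first.
    by case: kt; apply: inj.
  by rewrite addr0 !big_ord0 mulr1 adde0.
have [F' [v' [j [z [vE zE ind]]]]] := gauss_extension1 v1' (h d).
pose z' i := if (i < d)%N then j (z1 i) else z.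
exists F', v', (j \o j1), z'; split=> [x|i|T A c al inj t At].
- by rewrite /= vE v1E.
- rewrite ltnS leq_eqVlt => /orP[/eqP ->|id]; first by rewrite /z' ltnn zE.
  by rewrite /z' id vE z1E.
pose C t := j1 (c t) * \prod_(i < d) z1 i ^+ al t i.
pose p : {poly F1} := \sum_(t | A t) C t *: 'X^(al t d).
have -> : \sum_(t | A t) (j \o j1) (c t) * \prod_(i < d.+1) z' i ^+ al t i
  = (map_poly j p).[z].
  rewrite rmorph_sum horner_sum; apply: eq_bigr => k _ /=.
  rewrite map_polyZ map_polyXn hornerZ hornerXn big_ord_recr /= mulrA.
  rewrite /z' ltnn rmorphM rmorph_prod; congr (_ * _ * _).
  by apply: eq_bigr => i _; rewrite ltn_ord rmorphXn.
apply: le_trans (ind p (al t d)) _; rewrite big_ord_recr EFinD addeA leeD2r //.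
have -> : p`_(al t d) = \sum_(k | A k && (al k d == al t d)) C k.
  rewrite coef_sum big_mkcondr; apply: eq_bigr => k _.
  by rewrite coefZ coefXn eq_sym; case: eqP => _; rewrite ?mulr1 ?mulr0.
apply: ind1; last by rewrite unfold_in /= eqxx andbT.
move=> k k' /andP[Ak /eqP ke] /andP[Ak' /eqP ke'] e; apply: inj => // i.
by rewrite ltnS leq_eqVlt => /orP[/eqP ->|]; [rewrite ke ke'|exact: e].
Qed.

(** Multiplying by a high common power [ZB] of all variables turns Laurent monomials into monomials
    and shifts both sides by the same valuation. *)
Lemma gauss_extension (F : fieldType) (v : valuation R F) (Z : finType) (h : Z -> R) :
  exists (F' : fieldType) (v' : valuation R F') (j : {rmorphism F -> F'})
    (z : Z -> F'),
  [/\ forall x, v' (j x) = v x, forall i, v' (z i) = (h i)%:E &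
    forall (T : eqType) (S : seq T) (c : T -> F) (al : T -> {ffun Z -> int}),
      uniq (map al S) -> {in S, forall t,
        (v' (\sum_(t <- S) j (c t) * \prod_i z i ^ al t i)%R
          <= v (c t) + (\sum_i h i *~ al t i)%R%:E)%E}].
Proof.
pose d := #|Z|; pose rk (i : Z) : nat := enum_rank i.
have rkd i : (rk i < d)%N by exact: ltn_ord.
pose h' n : R := if insub n is Some k then h (@enum_val _ Z k) else 0.
have enum_SubK i : @enum_val _ Z (Sub (rk i) (rkd i)) = i.
  by rewrite -[RHS]enum_rankK; congr enum_val; apply: val_inj.
have h'E i : h' (rk i) = h i.
  by rewrite /h' (insubT (fun n => n < d)%N (rkd i)) enum_SubK.
have [F' [v' [j [z' [vE zE ind]]]]] := gauss_extension_nat v h' d.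
exists F', v', j, (z' \o rk); split=> // [i|T S c al uS t tS].
  by rewrite /= zE // h'E.
pose B := (\sum_(t <- S) \sum_i `|al t i|)%N.
have Bal (k : 'I_(size S)) i : 0 <= al (tnth (in_tuple S) k) i + B%:Z.
  have : (`|al (tnth (in_tuple S) k) i| <= B)%N.
    rewrite /B (big_rem (tnth (in_tuple S) k)) ?mem_tnth //= (bigD1 i) //=.
    by rewrite -addnA leq_addr.
  by lia.
pose be (k : 'I_(size S)) n : nat :=
  if insub n is Some l then
    absz (al (tnth (in_tuple S) k) (@enum_val _ Z l) + B%:Z) else 0%N.
have beE k i : be k (rk i) = absz (al (tnth (in_tuple S) k) i + B%:Z).
  by rewrite /be (insubT (fun n => n < d)%N (rkd i)) enum_SubK.
have prodE (X : Type) (one : X) (op : Monoid.com_law one) (f : nat -> X) :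
    \big[op/one]_(k < d) f k = \big[op/one]_i f (rk i).
  by rewrite (reindex (@enum_rank Z)) //; apply: onW_bij; exact: enum_rank_bij.
have z0 i : z' (rk i) != 0 by apply: (v_neq0 (v := v') (r := h i)); rewrite zE // h'E.
have index_k : (index t S < size S)%N by rewrite index_mem.
pose kt := Ordinal index_k.
have ktE : tnth (in_tuple S) kt = t by rewrite (tnth_nth t) /= nth_index.
pose ZB := \prod_i z' (rk i) ^ B%:Z.
have vZB : v' ZB = (\sum_i h i *~ B%:Z)%:E.
  by apply: v_prodE => i _; apply: v_exprzE; rewrite zE // h'E.
have inj : {in xpredT &, forall k k' : 'I_(size S),
    (forall i, (i < d)%N -> be k i = be k' i) -> k = k'}.
  move=> k k' _ _ e; have {}e : al (tnth (in_tuple S) k) = al (tnth (in_tuple S) k').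
    apply/ffunP => i; have := e _ (rkd i).
    rewrite !beE => /(congr1 Posz); have := Bal k i; have := Bal k' i.
    by lia.
  have uE (l : 'I_(size S)) : al (tnth (in_tuple S) l) = nth (al t) (map al S) l.
    by rewrite (tnth_nth t) (nth_map t).
  apply/val_inj/eqP; move/eqP: e; rewrite !uE nth_uniq ?size_map //.
have := ind _ _ (fun k => c (tnth (in_tuple S) k)) be inj kt isT.
have -> : \sum_(k | xpredT k) j (c (tnth (in_tuple S) k)) *
    \prod_(i < d) z' i ^+ be k i =
    (\sum_(k <- S) j (c k) * \prod_i (z' \o rk) i ^ al k i) * ZB.
  rewrite [in RHS]big_tnth mulr_suml; apply: eq_bigr => k _.
  rewrite -mulrA -big_split (prodE _ _ _ (fun i => z' i ^+ be k i)); congr (_ * _).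
  apply: eq_bigr => i _; rewrite /= -expfzDr // beE exprnP gez0_abs //.
rewrite vM vZB ktE (prodE _ _ _ (fun i => h' i *+ be kt i)).
have -> : \sum_i h' (rk i) *+ be kt (rk i) = \sum_i h i *~ al t i + \sum_i h i *~ B%:Z.
  rewrite -big_split; apply: eq_bigr => i _.
  have := Bal kt i; rewrite beE h'E ktE => B0.
  by rewrite /= -mulrzDr -[in RHS](gez0_abs B0).
by rewrite EFinD addeA leeD2rE.
Qed.
End GaussExtension.

(** * Characters of the Pluecker torus *)

Section Characters.
Variables (L0 : finType) (rho a0 b0 : L0) (r : nat).
Hypotheses (a0rho : a0 != rho) (b0rho : b0 != rho) (a0b0 : a0 != b0).
Local Notation D := (dpairs L0).
Local Notation ZD := {ffun D -> int}.
Implicit Types (a b c l : L0) (p : D).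

Definition unit_char a b : ZD := [ffun p => (val p == (a, b))%:R].

Definition char_degree l (f : ZD) : int :=
  \sum_p f p *+ (((val p).1 == l) + ((val p).2 == l)).

Lemma pl_charP (f : ZD) :
  reflect (forall l, char_degree l f = 0) (f \in @pl_char_pred L0).
Proof. by apply: (iffP forallP) => h l; apply/eqP; exact: h. Qed.

Lemma char_degreeD l f g : char_degree l (f + g) = char_degree l f + char_degree l g.
Proof.
by rewrite -big_split; apply: eq_bigr => p _; rewrite ffunE mulrnDl.
Qed.

Lemma char_degreeN l f : char_degree l (- f) = - char_degree l f.
Proof.
by rewrite -sumrN; apply: eq_bigr => p _; rewrite ffunE mulNrn.
Qed.

Lemma sum_dpair (V : zmodType) a b (F : D -> V) (ab : a != b) :
  \sum_p F p *+ (val p == (a, b)) = F (exist _ (a, b) ab).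
Proof.
rewrite (bigD1 (exist _ (a, b) ab)) //= eqxx mulr1n big1 ?addr0 // => p.
by rewrite -val_eqE /= => /negPf ->.
Qed.

Lemma char_degree_unit l a b : a != b ->
  char_degree l (unit_char a b) = ((a == l) + (b == l))%:R.
Proof.
move=> ab; rewrite /char_degree.
rewrite -(sum_dpair (fun p => ((((val p).1 == l) + ((val p).2 == l))%N%:R : int)) ab).
by apply: eq_bigr => p _; rewrite ffunE; case: eqP => _; rewrite ?mulr1n ?mulr0n ?mul0rn.
Qed.

(** This is x_a - x_b when [rho] is at infinity and the other marks have the form (x : 1). Its
    degree is -2 at [rho] and 0 elsewhere, whatever [a] and [b] are, so the quotient of two of them
    is a function on the quotient torus. *)
Definition root_char a b : ZD := unit_char a b - unit_char a rho - unit_char b rho.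

Lemma char_degree_root l a b : a != rho -> b != rho -> a != b ->
  char_degree l (root_char a b) = - (rho == l)%:R *+ 2.
Proof.
move=> ar br ab; rewrite /root_char !char_degreeD !char_degreeN.
rewrite !char_degree_unit // !natrD; ring.
Qed.

Fact plucker_char_subproof a b : a != rho -> b != rho -> a != b ->
  root_char a b - root_char a0 b0 \in @pl_char_pred L0.
Proof.
move=> ar br ab; apply/pl_charP => l.
by rewrite char_degreeD char_degreeN !char_degree_root // subrr.
Qed.

Fact sign_char_subproof a : a != rho ->
  unit_char a rho - unit_char rho a \in @pl_char_pred L0.
Proof.
move=> ar; apply/pl_charP => l.
by rewrite char_degreeD char_degreeN char_degree_unit // char_degree_unit 1?eq_sym // addnC subrr.
Qed.

(* In the affine coordinates that put the marking rho at infinity and a0, b0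
   at distance 1, plucker_char a b is the function x_a - x_b, and sign_char a
   is the constant -1; both are 0 outside of the intended range. *)
Definition plucker_char a b : pl_char L0 :=
  insubd 0 (root_char a b - root_char a0 b0).
Definition sign_char a : pl_char L0 :=
  insubd 0 (unit_char a rho - unit_char rho a).

Lemma val_plucker_char a b : a != rho -> b != rho -> a != b ->
  val (plucker_char a b) = root_char a b - root_char a0 b0.
Proof. by move=> *; rewrite val_insubd plucker_char_subproof. Qed.

Lemma val_sign_char a : a != rho ->
  val (sign_char a) = unit_char a rho - unit_char rho a.
Proof. by move=> *; rewrite val_insubd sign_char_subproof. Qed.

Definition off_root p := ((val p).1 != rho) && ((val p).2 != rho).

Lemma ffun_sumE (V : zmodType) (T : finType) (I : Type) (s : seq I) (P : pred I)
  (F : I -> {ffun T -> V}) x :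
  (\sum_(i <- s | P i) F i) x = \sum_(i <- s | P i) F i x.
Proof. by elim/big_rec2: _ => [|i y1 y2 _ <-]; rewrite !ffunE. Qed.

Lemma ffun_mulrzE (V : zmodType) (T : finType) (f : {ffun T -> V}) (z : int) x :
  (f *~ z) x = f x *~ z.
Proof.
have hn (n : nat) : (f *+ n) x = f x *+ n.
  by elim: n => [|n IH]; rewrite ?mulr0n ?ffunE // !mulrS ffunE IH.
by case: z => n; [exact: hn|rewrite NegzE !mulrNz ffunE; congr (- _); exact: hn].
Qed.

Lemma sum_dpair_split (V : zmodType) (F : D -> V) :
  \sum_p F p = \sum_(p | off_root p) F p + \sum_(p : D | (val p).1 == rho) F p
    + \sum_(p : D | (val p).2 == rho) F p.
Proof.
rewrite (bigID off_root) /= -addrA; congr (_ + _).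
rewrite (bigID (fun p : D => (val p).1 == rho)) /=; congr (_ + _).
  by apply: eq_bigl => p; rewrite negb_and !negbK; case: eqP => //=; rewrite andbF.
apply: eq_bigl => p; have := valP p; rewrite negb_and !negbK.
by have [->|n1] := eqVneq (val p).1 rho; rewrite ?andbT //= eq_sym => /negPf ->.
Qed.

(** All degrees together are twice the sum of all exponents, so that sum is 0; the degree at [rho]
    is the part from the pairs that contain [rho], so the rest is 0 as well. *)
Lemma pl_char_off_root (m : pl_char L0) : \sum_(p | off_root p) val m p = 0.
Proof.
have /pl_charP h := valP m.
have all0 : \sum_p val m p = 0.
  have : \sum_l char_degree l (val m) = 0 by rewrite big1.
  rewrite exchange_big /= => e.
  suff : (\sum_p val m p) *+ 2 = 0 by move/eqP; rewrite mulrn_eq0 => /eqP.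
  rewrite -[RHS]e -sumrMnl; apply: eq_bigr => p _; rewrite sumrMnr /=.
  congr (_ *+ _); rewrite big_split /= (bigD1 (val p).1) //= eqxx big1 => [|l].
    by rewrite (bigD1 (val p).2) //= eqxx big1 // => l; rewrite eq_sym => /negPf ->.
  by rewrite eq_sym => /negPf ->.
have := h rho; rewrite /char_degree sum_dpair_split big1 ?add0r => [|p]; last first.
  by case/andP => /negPf -> /negPf ->.
move=> e; suff e' : \sum_(p : D | (val p).1 == rho) val m p
    + \sum_(p : D | (val p).2 == rho) val m p = 0.
  by move: all0; rewrite sum_dpair_split -addrA e' addr0.
rewrite -[RHS]e; congr (_ + _); apply: eq_bigr => p /eqP e1; have := valP p.
  by rewrite e1 eqxx eq_sym => /negPf ->; rewrite mulr1n.
by rewrite e1 eqxx => /negPf ->; rewrite mulr1n.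
Qed.

Lemma val_pl_charMz (m : pl_char L0) z : val (m *~ z) = val m *~ z.
Proof. exact: raddfMz. Qed.

Lemma val_pl_charB (m n : pl_char L0) : val (m - n) = val m - val n.
Proof. exact: raddfB. Qed.

Lemma val_pl_char_sum (T : Type) (s : seq T) (P : pred T) (F : T -> pl_char L0) :
  val (\sum_(i <- s | P i) F i) = \sum_(i <- s | P i) val (F i).
Proof. exact: raddf_sum. Qed.

(** By [pl_char_off_root] the normalizing [root_char a0 b0] cancels in the first sum. The sign
    characters account for the pairs that begin with [rho]; for a pair that ends with it, both sides
    agree because the degree at its first element is 0. *)
Lemma pl_char_decomp (m : pl_char L0) :
  m = \sum_(p | off_root p) plucker_char (val p).1 (val p).2 *~ val m p
    - \sum_(p : D | (val p).1 == rho) sign_char (val p).2 *~ val m p.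
Proof.
apply: val_inj; rewrite val_pl_charB !val_pl_char_sum; apply/ffunP => p0.
rewrite ffunE [X in _ + X]ffunE !ffun_sumE.
have -> : \sum_(p | off_root p)
    (val (plucker_char (val p).1 (val p).2 *~ val m p)) p0 =
    \sum_(p | off_root p) (root_char (val p).1 (val p).2 p0) * val m p.
  transitivity (\sum_(p | off_root p) (root_char (val p).1 (val p).2 p0
     - root_char a0 b0 p0) * val m p).
    apply: eq_bigr => p /andP[p1 p2]; rewrite val_pl_charMz ffun_mulrzE.
    by rewrite val_plucker_char ?(valP p) // !ffunE -mulrzr intz.
  under eq_bigr do rewrite mulrBl.
  by rewrite sumrB -mulr_sumr pl_char_off_root mulr0 subr0.
have -> : \sum_(p : D | (val p).1 == rho)
    (val (sign_char (val p).2 *~ val m p)) p0 =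
    \sum_(p : D | (val p).1 == rho)
      ((val p0 == ((val p).2, rho))%:R - (val p0 == (rho, (val p).2))%:R) * val m p.
  apply: eq_bigr => p /eqP p1; rewrite val_pl_charMz ffun_mulrzE.
  rewrite val_sign_char; last by have := valP p; rewrite p1 eq_sym.
  by rewrite !ffunE -mulrzr intz.
have pE (p : D) : (val p0 == val p) = (p == p0) by rewrite val_eqE eq_sym.
have rootE (p : D) : root_char (val p).1 (val p).2 p0 =
    (val p0 == val p)%:R - (val p0 == ((val p).1, rho))%:R
      - (val p0 == ((val p).2, rho))%:R by rewrite !ffunE -surjective_pairing.
have p0E a b : (val p0 == (a, b)) = ((val p0).1 == a) && ((val p0).2 == b).
  by case: (val p0).
have [/[dup] offp /andP[x0 y0]|] := boolP (off_root p0).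
  rewrite (bigD1 p0) // [X in _ + X - _]big1 => [|p /andP[_ np]].
    rewrite [X in _ - X]big1 => [|p _].
      by rewrite rootE eqxx !p0E (negPf y0) !andbF !subr0 ?addr0 mul1r.
    by rewrite !p0E (negPf x0) (negPf y0) andbF subr0 mul0r.
  by rewrite rootE pE (negPf np) !p0E (negPf y0) !andbF !subr0 mul0r.
rewrite negb_and !negbK; have [x0 _|x0 /= /eqP y0] := eqVneq (val p0).1 rho.
  have y0 : (val p0).2 != rho by have := valP p0; rewrite x0 eq_sym.
  rewrite big1 => [|p /andP[p1 p2]]; last first.
    rewrite rootE pE !p0E (negPf y0) !andbF !subr0; case: eqP => [pp|]; last by rewrite mul0r.
    by rewrite -x0 pp eqxx in p1.
  rewrite sub0r -sumrN (bigD1 p0) /= ?x0 // big1 => [|p /andP[/eqP p1 np]].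
    by rewrite !p0E x0 !eqxx (negPf y0) andbF sub0r mulN1r opprK addr0.
  rewrite -{2}p1 -surjective_pairing pE (negPf np).
  by rewrite !p0E (negPf y0) andbF subr0 mul0r oppr0.
have /pl_charP/(_ (val p0).1) := valP m; rewrite /char_degree sum_dpair_split => e.
rewrite -[LHS]add0r -[X in X + _]oppr0 -[in LHS]e !opprD -!addrA; congr (_ + _).
  rewrite -sumrN; apply: eq_bigr => p /andP[p1 p2].
  rewrite rootE pE; case: (eqVneq p p0) => [pp|_]; first by rewrite pp y0 eqxx in p2.
  rewrite sub0r !p0E y0 !eqxx !andbT ![(val p0).1 == _]eq_sym.
  by rewrite mulrnDr opprD mulrBl mulNr !mulr_natl.
rewrite -[RHS]addr0; congr (_ + _); last first.
  rewrite (bigD1 p0) ?y0 // big1 => [|p /andP[/eqP p2 np]].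
    by rewrite eqxx /= [rho == _]eq_sym (negPf x0) mulr1n addr0 addNr.
  have [p1|_] := eqVneq (val p).1 (val p0).1; last first.
    by rewrite p2 [rho == _]eq_sym (negPf x0).
  case/eqP: np; apply: val_inj.
  by rewrite [LHS]surjective_pairing [RHS]surjective_pairing p1 p2 y0.
congr (- _); apply: eq_bigr => p /eqP p1.
rewrite !p0E y0 eqxx (negPf x0) andbT subr0 p1 [rho == _]eq_sym (negPf x0) /= add0n.
by rewrite [_ == (val p0).1]eq_sym mulrC mulr_natr.
Qed.
End Characters.

Opaque plucker_char sign_char.

(* [coord a b] stands for the function x_a - x_b on the moduli space and
   [minus a] for the constant -1. *)
Section PluckerRelations.
Variables (L0 : eqType) (rho : L0) (M : zmodType).
Variables (coord : L0 -> L0 -> M) (minus : L0 -> M).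

Definition is_ultrametric (R : realType) (u : L0 -> L0 -> R) :=
  (forall a b, a != rho -> b != rho -> a != b -> u a b = u b a) /\
  (forall a b c, a != rho -> b != rho -> c != rho -> a != b -> b != c -> c != a ->
    Num.min (u b c) (u c a) <= u a b).

Definition ultrametric_char (R : realType) (s : {additive M -> R}) :=
  (forall a, a != rho -> s (minus a) = 0) /\
  is_ultrametric (fun a b => s (coord a b)).

(** One monomial is set apart in each relation, in the form that [initial_form] takes. *)
Definition plucker_relations (F : fieldType) (I : set (group_algebra F M)) :=
  [/\ forall a, a != rho -> I (gmon 1 0 + \sum_(m <- [:: minus a]) gmon 1 m),
      forall a b, a != rho -> b != rho -> a != b ->
        I (gmon 1 (coord a b) + \sum_(m <- [:: coord b a]) gmon 1 m) &
      forall a b c, a != rho -> b != rho -> c != rho -> a != b -> b != c -> c != a ->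
        I (gmon 1 (coord a b)
           + \sum_(m <- [:: coord b c; coord c a]) gmon 1 m)].

End PluckerRelations.

Section Ambient.
Variables (L0 : finType) (rho a0 b0 : L0) (r : nat).
Hypotheses (a0rho : a0 != rho) (b0rho : b0 != rho) (a0b0 : a0 != b0).
Local Notation D := (dpairs L0).
Local Notation M := (ambient_char L0 r).
Local Notation off_root := (@off_root L0 rho).
Implicit Types (a b c : L0).

Definition coord_char a b : M := (plucker_char rho a0 b0 a b, 0).
Definition minus_char a : M := (sign_char rho a, 0).
Definition torus_char (i : 'I_r) : M := (0, delta_mx 0 i).

Lemma val_coord_char a b : a != rho -> b != rho -> a != b ->
  val (coord_char a b).1 = root_char rho a b - root_char rho a0 b0.
Proof. exact: val_plucker_char. Qed.

Lemma val_minus_char a : a != rho ->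
  val (minus_char a).1 = unit_char a rho - unit_char rho a.
Proof. exact: val_sign_char. Qed.

Lemma coord_char_torus a b : (coord_char a b).2 = 0. Proof. by []. Qed.

Lemma minus_char_torus a : (minus_char a).2 = 0. Proof. by []. Qed.

Let pl_part (x : pl_char L0) : M := (x, 0).
Let torus_part (y : 'rV[int]_r) : M := (0, y).

Fact pl_part_morphism : zmod_morphism pl_part.
Proof. by move=> x y; rewrite -[RHS]/(_, _) subrr. Qed.
HB.instance Definition _ := GRing.isZmodMorphism.Build _ _ pl_part pl_part_morphism.

Fact torus_part_morphism : zmod_morphism torus_part.
Proof. by move=> x y; rewrite -[RHS]/(_, _) subrr. Qed.
HB.instance Definition _ :=
  GRing.isZmodMorphism.Build _ _ torus_part torus_part_morphism.

Lemma ambient_decomp (m : M) :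
  m = \sum_(p : D | off_root p) coord_char (val p).1 (val p).2 *~ val m.1 p
    - \sum_(p : D | (val p).1 == rho) minus_char (val p).2 *~ val m.1 p
    + \sum_i torus_char i *~ m.2 0 i.
Proof.
have mE : m = pl_part m.1 + torus_part m.2.
  by case: m => x y; rewrite -[RHS]/(x + 0, 0 + y) addr0 add0r.
rewrite {1}mE; congr (_ + _).
  apply: etrans (congr1 pl_part (pl_char_decomp a0rho b0rho a0b0 m.1)) _.
  apply: etrans (raddfB pl_part _ _) _.
  have sumE (T : finType) (P : pred T) (f : T -> pl_char L0) (z : T -> int) :
      pl_part (\sum_(i | P i) f i *~ z i) = \sum_(i | P i) pl_part (f i) *~ z i.
    by rewrite (raddf_sum pl_part); apply: eq_bigr => i _; exact: (raddfMz pl_part).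
  by congr (_ - _); exact: sumE.
rewrite {1}[m.2]matrix_sum_delta big_ord1 (raddf_sum torus_part); apply: eq_bigr => i _.
by rewrite -[torus_char i]/(torus_part _) -(raddfMz torus_part) -[m.2 0 i in LHS]intz scaler_int.
Qed.

Lemma additive_decomp (R : realType) (s : {additive M -> R}) (m : M) :
  s m = \sum_(p : D | off_root p) s (coord_char (val p).1 (val p).2) *~ val m.1 p
    - \sum_(p : D | (val p).1 == rho) s (minus_char (val p).2) *~ val m.1 p
    + \sum_i s (torus_char i) *~ m.2 0 i.
Proof.
have sumE (T : finType) (P : pred T) (f : T -> M) (z : T -> int) :
    s (\sum_(i | P i) f i *~ z i) = \sum_(i | P i) s (f i) *~ z i.
  by rewrite (raddf_sum s); apply: eq_bigr => i _; exact: (raddfMz s).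
apply: etrans (congr1 s (ambient_decomp m)) _.
apply: etrans (raddfD s _ _) _; congr (_ + _); last exact: sumE.
by apply: etrans (raddfB s _ _) _; congr (_ - _); exact: sumE.
Qed.

Section WedgePoint.
Variables (F : fieldType) (W : L0 -> L0 -> F) (t : 'I_r -> F).
Hypothesis W0 : forall a b, a != b -> W a b != 0.
Hypothesis t0 : forall i, t i != 0.

Definition wedge_prod (f : {ffun D -> int}) :=
  \prod_(p : D) W (val p).1 (val p).2 ^ f p.

Lemma wedge_prodD f g : wedge_prod (f + g) = wedge_prod f * wedge_prod g.
Proof.
rewrite -big_split; apply: eq_bigr => p _.
by rewrite ffunE expfzDr // W0 // (valP p).
Qed.

Lemma wedge_prod0 : wedge_prod 0 = 1.
Proof. by rewrite /wedge_prod big1 // => p _; rewrite ffunE expr0z. Qed.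

Lemma wedge_prodN f : wedge_prod (- f) = (wedge_prod f)^-1.
Proof.
rewrite -prodfV; apply: eq_bigr => p _.
by rewrite ffunE -invr_expz.
Qed.

Lemma wedge_prod_unit a b : a != b -> wedge_prod (unit_char a b) = W a b.
Proof.
move=> ab; rewrite /wedge_prod (bigD1 (exist _ (a, b) ab)) //=.
rewrite ffunE eqxx expr1z big1 ?mulr1 // => p np.
rewrite ffunE; case: eqP => [e|_]; last by rewrite expr0z.
by case/eqP: np; apply: val_inj.
Qed.

Lemma wedge_prod_root a b : a != rho -> b != rho -> a != b ->
  wedge_prod (root_char rho a b) = W a b / (W a rho * W b rho).
Proof.
move=> ar br ab; rewrite !wedge_prodD !wedge_prodN !wedge_prod_unit //.
by rewrite invfM mulrA.
Qed.

Lemma wedge_prod_plucker a b : a != rho -> b != rho -> a != b ->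
  wedge_prod (val (plucker_char rho a0 b0 a b)) =
  W a b / (W a rho * W b rho) / (W a0 b0 / (W a0 rho * W b0 rho)).
Proof.
move=> ar br ab; rewrite val_plucker_char // wedge_prodD wedge_prodN.
by rewrite !wedge_prod_root.
Qed.

Fact wedge_point0 : wedge_prod (val (0 : M).1) * \prod_i t i ^ (0 : M).2 0 i = 1.
Proof.
by rewrite wedge_prod0 mul1r big1 // => i _; rewrite mxE expr0z.
Qed.
Fact wedge_pointD (m n : M) :
  wedge_prod (val (m + n).1) * \prod_i t i ^ (m + n).2 0 i =
  (wedge_prod (val m.1) * \prod_i t i ^ m.2 0 i) *
  (wedge_prod (val n.1) * \prod_i t i ^ n.2 0 i).
Proof.
rewrite mulrACA; congr (_ * _); first exact: wedge_prodD.
by rewrite -big_split; apply: eq_bigr => i _; rewrite mxE expfzDr.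
Qed.
Definition wedge_point : torus_point M F := TorusPoint wedge_point0 wedge_pointD.

Lemma wedge_prod_sign a : (forall b, W b a = - W a b) -> a != rho ->
  wedge_prod (val (sign_char rho a)) = -1.
Proof.
move=> WN ar; rewrite val_sign_char // wedge_prodD wedge_prodN.
rewrite wedge_prod_unit // wedge_prod_unit 1?eq_sym // WN invrN mulrN divff //.
exact: W0.
Qed.

Lemma wedge_prod_plucker2 a b : (forall a b, W b a = - W a b) ->
  a != rho -> b != rho -> a != b ->
  wedge_prod (val (plucker_char rho a0 b0 a b)) +
  wedge_prod (val (plucker_char rho a0 b0 b a)) = 0.
Proof.
move=> WN ar br ab; have ba : b != a by rewrite eq_sym.
apply: etrans (congr2 +%R (wedge_prod_plucker ar br ab) (wedge_prod_plucker br ar ba)) _.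
by rewrite [W b a]WN [W b rho * _]mulrC !mulNr subrr.
Qed.

(** The three-term Pluecker relation with fourth index [rho], divided by the three wedges with
    [rho]. *)
Lemma wedge_prod_plucker3 a b c :
  W a b * W c rho + W b c * W a rho + W c a * W b rho = 0 ->
  a != rho -> b != rho -> c != rho -> a != b -> b != c -> c != a ->
  wedge_prod (val (plucker_char rho a0 b0 a b)) +
  wedge_prod (val (plucker_char rho a0 b0 b c)) +
  wedge_prod (val (plucker_char rho a0 b0 c a)) = 0.
Proof.
move=> rel ar br cr ab bc ca.
apply: etrans (congr2 +%R (congr2 +%R (wedge_prod_plucker ar br ab)
  (wedge_prod_plucker br cr bc)) (wedge_prod_plucker cr ar ca)) _.
rewrite -!mulrDl.
suff -> : W a b / (W a rho * W b rho) + W b c / (W b rho * W c rho) +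
  W c a / (W c rho * W a rho) = 0 by rewrite mul0r.
have -> : W a b / (W a rho * W b rho) + W b c / (W b rho * W c rho) +
  W c a / (W c rho * W a rho) = (W a b * W c rho + W b c * W a rho + W c a * W b rho)
   / (W a rho * W b rho * W c rho) by field; rewrite !W0.
by rewrite rel mul0r.
Qed.

End WedgePoint.

Lemma geval_sum (F : fieldType) (m0 : M) (ms : seq M) (y : torus_point M F) :
  geval (gmon 1 m0 + \sum_(m <- ms) gmon 1 m) y = y m0 + \sum_(m <- ms) y m.
Proof.
rewrite -[LHS]/(gmap_eval idfun y _) gmap_evalD gmap_eval_mon mul1r; congr (_ + _).
elim: ms => [|m ms IH]; first by rewrite !big_nil gmap_eval0.
by rewrite !big_cons gmap_evalD gmap_eval_mon mul1r IH.
Qed.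

Lemma vanishing_plucker_relations (F : fieldType) (Y : set (torus_point M F)) :
  (forall y, Y y -> exists (W : L0 -> L0 -> F) (g : 'rV[int]_r -> F),
    [/\ forall a b, a != b -> W a b != 0, forall a b, W b a = - W a b,
        forall a b c d, W a b * W c d + W b c * W a d + W c a * W b d = 0,
        g 0 = 1 & forall m : M, y m = wedge_prod W (val m.1) * g m.2]) ->
  plucker_relations rho coord_char minus_char (vanishing_ideal Y).
Proof.
move=> hY; split=> [a ar y /hY|a b ar br ab y /hY|a b c ar br cr ab bc ca y /hY];
  case=> W [g [W0 WN WP g0 yE]]; rewrite geval_sum.
- have e : y (minus_char a) = wedge_prod W (val (sign_char rho a)).
    by rewrite yE -[RHS]mulr1 -g0.
  by rewrite big_seq1 tfun0 e wedge_prod_sign // subrr.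
- have e a' b' : y (coord_char a' b') =
      wedge_prod W (val (plucker_char rho a0 b0 a' b')).
    by rewrite yE -[RHS]mulr1 -g0.
  by rewrite big_seq1 (e a b) (e b a); exact: wedge_prod_plucker2.
- have e a' b' : y (coord_char a' b') =
      wedge_prod W (val (plucker_char rho a0 b0 a' b')).
    by rewrite yE -[RHS]mulr1 -g0.
  rewrite big_cons big_seq1 (e a b) (e b c) (e c a) addrA.
  by apply: wedge_prod_plucker3; rewrite // WP.
Qed.

End Ambient.

Opaque coord_char minus_char torus_char.

(** * Degenerations of the Pluecker relations *)

Section Lifting.
Variables (L0 : eqType) (rho : L0) (M : zmodType).
Variables (coord : L0 -> L0 -> M) (minus : L0 -> M).
Variables (R : realType) (K : fieldType) (v : valuation R K).
Variable I : set (group_algebra K M).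
Hypothesis relI : plucker_relations rho coord minus I.
Variables (s : {additive M -> R}) (l : lifting v s).
Local Notation J := (@initial_degeneration _ _ _ _ I _ l).
Local Notation IL := (base_change (lift_emb l) I).
Local Notation k := (residue_field (lift_val l)).
Local Notation u := (fun a b => s (coord a b)).
Implicit Types (a b c : L0).

Lemma base_change_ideal : is_ideal IL.
Proof. exact: ideal_gen_ideal. Qed.

Lemma base_change_form m0 ms : I (gmon 1 m0 + \sum_(m <- ms) gmon 1 m) ->
  IL (gmon 1 m0 + \sum_(m <- ms) gmon 1 m).
Proof.
move=> If; apply: ideal_gen_sub; exists (gmon 1 m0 + \sum_(m <- ms) gmon 1 m) => //.
rewrite gmapD gmap_mon rmorph1; congr (_ + _).
elim: ms {If} => [|m ms IH]; first by rewrite !big_nil gmap0.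
by rewrite !big_cons gmapD gmap_mon rmorph1 IH.
Qed.

Lemma degeneration_form m0 ms : I (gmon 1 m0 + \sum_(m <- ms) gmon 1 m) ->
  {in ms, forall m, s m0 <= s m} ->
  exists c : M -> k, {in ms, forall m, (c m == 0) = (s m0 < s m)} /\
    J (1 + \sum_(m <- ms) gmon (c m) (m - m0)).
Proof.
move=> /base_change_form If; apply: (initial_form base_change_ideal _ If).
exact: lift_pointE.
Qed.

Lemma degeneration_1 m0 ms : I (gmon 1 m0 + \sum_(m <- ms) gmon 1 m) ->
  {in ms, forall m, s m0 < s m} -> J 1.
Proof.
move=> If hs; have [m /hs /ltW //|c [c0]] := degeneration_form If.
rewrite big_seq big1 ?addr0 // => m hm.
by have := c0 m hm; rewrite hs // => /eqP ->; rewrite gmon0.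
Qed.

(** Exactly two terms survive the reduction, both with nonzero coefficient. *)
Lemma degeneration_binomial m0 m1 ms :
  I (gmon 1 m0 + \sum_(m <- m1 :: ms) gmon 1 m) -> s m0 = s m1 ->
  {in ms, forall m, s m0 < s m} -> binomial_mem (lift_val l) IL (lift_point l) (m1 - m0).
Proof.
move=> If e hs; have [m|c [c0]] := degeneration_form If.
  by rewrite inE => /orP[/eqP ->|/hs /ltW //]; rewrite e.
rewrite big_cons big_seq big1 ?addr0 => [|m hm]; last first.
  by have := c0 m; rewrite inE hm orbT hs // => /(_ isT)/eqP ->; rewrite gmon0.
have cm : c m1 != 0 by rewrite c0 ?inE ?eqxx // e ltxx.
move=> Jc; exists (- (c m1)^-1); first by rewrite oppr_eq0 invr_eq0.
have [_ _ JM] := initial_ideal_ideal (lift_val l) (lift_point l) base_change_ideal.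
have := JM (gmon (c m1)^-1 0) _ Jc.
rewrite mulrDr mulr1 gmon_mul mulVf // add0r; congr J.
by apply: gcoefP => i; rewrite !gcoefD gcoefN !gcoef_mon mulNrn opprK addrC.
Qed.

(** A relation with a single term of least valuation would reduce to a unit. *)
Lemma degeneration_ultrametric : ~ J 1 -> ultrametric_char rho coord minus s.
Proof.
have [I1 I2 I3] := relI; move=> J1.
have le2 m m' : I (gmon 1 m + \sum_(m <- [:: m']) gmon 1 m) -> s m' <= s m.
  move=> If; rewrite leNgt; apply/negP => lt; apply: J1; apply: degeneration_1 If _.
  by move=> i; rewrite inE => /eqP ->.
have le2' m m' : I (gmon 1 m + \sum_(m <- [:: m']) gmon 1 m) -> s m <= s m'.
  by move=> If; apply: le2; move: If; rewrite !big_seq1 addrC.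
split; last split.
- move=> a ar; have If := I1 a ar; have := le2 _ _ If; have := le2' _ _ If.
  by rewrite raddf0 => h1 h2; apply/le_anti/andP.
- move=> a b ar br ab; have If := I2 a b ar br ab.
  by apply/le_anti; rewrite (le2 _ _ If) (le2' _ _ If).
- move=> a b c ar br cr ab bc ca; rewrite leNgt; apply/negP; rewrite lt_min.
  case/andP => l1 l2; apply: J1; apply: degeneration_1 (I3 a b c ar br cr ab bc ca) _.
  by move=> i; rewrite !inE => /orP[]/eqP ->.
Qed.

Local Notation binomial := (binomial_mem (lift_val l) IL (lift_point l)).

Lemma binomial_minus a : ultrametric_char rho coord minus s -> a != rho ->
  binomial (minus a).
Proof.
move=> [s0 _] ar; have [I1 _ _] := relI.
rewrite -[minus a]subr0; apply: degeneration_binomial (I1 a ar) _ _ => //.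
by rewrite s0 // raddf0.
Qed.

Lemma binomial_swap a b : ultrametric_char rho coord minus s ->
  a != rho -> b != rho -> a != b -> binomial (coord a b - coord b a).
Proof.
move=> [_ [us _]] ar br ab; have [_ I2 _] := relI.
have ba : b != a by rewrite eq_sym.
by apply: degeneration_binomial (I2 b a br ar ba) _ _ => //; exact: us.
Qed.

Lemma binomial_triple a b c : a != rho -> b != rho -> c != rho ->
  a != b -> b != c -> c != a -> u b c = u c a -> u b c < u a b ->
  binomial (coord b c - coord c a).
Proof.
move=> ar br cr ab bc ca e lt; have [_ _ I3] := relI.
have If : I (gmon 1 (coord c a)
    + \sum_(m <- [:: coord b c; coord a b]) gmon 1 m).
  have := I3 c a b cr ar br ca ab bc; rewrite !big_cons big_nil.
  by rewrite !addr0 [gmon 1 (coord a b) + _]addrC.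
apply: degeneration_binomial If _ _ => // m.
by rewrite inE => /eqP ->; rewrite -e.
Qed.

End Lifting.

(** * Realizing ultrametrics *)

Section LeadingTerm.
Variables (R : realType) (F : fieldType) (v : valuation R F).
Implicit Types a b x y : F.

(** The quotient x / a reduces to 1; this is compatible with products and inverses, hence with
    characters. *)
Definition leading a x := a != 0 /\ (v a < v (x - a)%R)%E.

Lemma leading_val a x : leading a x -> v x = v a.
Proof. by case=> _ h; rewrite -{1}[x](subrK a) v_addr. Qed.

Lemma leading_refl a : a != 0 -> leading a a.
Proof.
by move=> a0; split=> //; have [r ->] := v_fin v a0; rewrite subrr v0 ltry.
Qed.

Lemma leading_neq0 a x : leading a x -> x != 0.
Proof.
move=> h; have [a0 _] := h; have [r e] := v_fin v a0.
by apply: (v_neq0 (v := v) (r := r)); rewrite (leading_val h).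
Qed.

Lemma leading_addr a x y : leading a x -> (v a < v y)%E -> leading a (x + y).
Proof.
case=> a0 h hy; split=> //; rewrite addrAC; apply: lt_le_trans (vD _ _ _).
by rewrite lt_min h.
Qed.

Lemma leadingN a x : leading a x -> leading (- a) (- x).
Proof. by case=> a0 h; split; rewrite ?oppr_eq0 // vN -opprD vN. Qed.

Lemma leadingM a b x y : leading a x -> leading b y -> leading (a * b) (x * y).
Proof.
move=> ha hb; have [a0 h] := ha; have [b0 h'] := hb.
split; first exact: mulf_neq0.
have -> : x * y - a * b = (x - a) * y + a * (y - b) by ring.
have [r ar] := v_fin v a0; have [r' br] := v_fin v b0.
rewrite vM ar br; apply: lt_le_trans (vD _ _ _); rewrite lt_min !vM.
rewrite (leading_val hb) br ar; apply/andP; split.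
  by rewrite lteD2rE // -ar.
by rewrite lteD2lE // -br.
Qed.

Lemma leadingV a x : leading a x -> leading a^-1 x^-1.
Proof.
move=> ha; have [a0 h] := ha; have x0 := leading_neq0 ha.
split; first by rewrite invr_eq0.
have -> : x^-1 - a^-1 = - ((x - a) * (x^-1 * a^-1)) by field; rewrite x0 a0.
have [r ar] := v_fin v a0; have xr : v x = r%:E by rewrite (leading_val ha).
rewrite vN !vM (v_invE ar) (v_invE xr); move: h; rewrite ar.
case: (v (x - a)) => [t| |] //=; last by move=> _; rewrite -EFinD addye // ltry.
by rewrite -!EFinD !lte_fin; lra.
Qed.

Lemma leadingX a x n : leading a x -> leading (a ^+ n) (x ^+ n).
Proof.
move=> h; elim: n => [|n IH]; first by rewrite !expr0; apply/leading_refl/oner_neq0.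
by rewrite !exprS; exact: leadingM.
Qed.

Lemma leading_expz a x (n : int) : leading a x -> leading (a ^ n) (x ^ n).
Proof.
case: n => n h; first exact: leadingX.
by rewrite NegzE -!exprnN; apply/leadingV/leadingX.
Qed.

Lemma leading_prod (T : Type) (s : seq T) (P : pred T) (a x : T -> F) :
  (forall i, P i -> leading (a i) (x i)) ->
  leading (\prod_(i <- s | P i) a i) (\prod_(i <- s | P i) x i).
Proof.
move=> h; elim/big_rec2: _ => [|i y1 y2 Pi IH]; first by apply/leading_refl/oner_neq0.
by apply: leadingM => //; exact: h.
Qed.

End LeadingTerm.

Lemma seq_argmin d (O : orderType d) (T : eqType) (f : T -> O) (s : seq T) :
  s != [::] -> exists2 x, x \in s & forall y, y \in s -> (f x <= f y)%O.
Proof.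
elim: s => // x s IH _; have [->|/IH[y ys hy]] := eqVneq s [::].
  by exists x => [|y]; rewrite inE // => /eqP ->.
have [le|/ltW le] := leP (f x) (f y).
  exists x => [|w]; rewrite inE ?eqxx // => /orP[/eqP -> //|/hy h].
  exact: le_trans le h.
by exists y => [|w]; rewrite inE ?ys ?orbT // => /orP[/eqP -> //|/hy].
Qed.

Section UltrametricPoints.
Variables (R : realType) (L0 : finType) (rho : L0) (u : L0 -> L0 -> R).
Hypothesis ultra : is_ultrametric rho u.
Implicit Types (a b c : L0).

Let us a b : a != rho -> b != rho -> a != b -> u a b = u b a.
Proof. by case: ultra => h _; exact: h. Qed.

Let uu a b c : a != rho -> b != rho -> c != rho -> a != b -> b != c -> c != a ->
  Num.min (u b c) (u c a) <= u a b.
Proof. by case: ultra => _ h; exact: h. Qed.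

Let nsym a b : a != b -> b != a. Proof. by rewrite eq_sym. Qed.

Lemma nearest_exists (E : seq L0) : uniq E -> exists par : L0 -> L0,
  forall E1 a S, E = E1 ++ a :: S -> S != [::] ->
    par a \in S /\ forall b, b \in S -> u a b <= u a (par a).
Proof.
elim: E => [|x E IH] /=.
  by exists id => -[].
case/andP => xE /IH[par hpar].
have [E0|En] := eqVneq E [::].
  exists id => E1 a S; rewrite E0; case: E1 => [[_ <-] //|y E1 [_]].
  by move/(congr1 size); rewrite size_cat /= addnS.
have [y yE hy] := seq_argmin (fun b => - u x b) En.
exists (fun b => if b == x then y else par b) => -[|z E1] a S /= [].
  move=> <- <- _; rewrite eqxx; split=> // b /hy.
  by rewrite lerN2.
move=> _ e Sn; have [ax|_] := eqVneq a x; last exact: (hpar E1).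
by move: xE; rewrite e -ax mem_cat inE eqxx orbT.
Qed.

Variables (F F' : fieldType) (v' : valuation R F') (j : {rmorphism F -> F'}).
Variables (z : L0 -> F') (par : L0 -> L0) (E : seq L0).
Hypotheses (uniqE : uniq E) (rhoE : rho \notin E).
Hypothesis parP : forall E1 a S, E = E1 ++ a :: S -> S != [::] ->
    par a \in S /\ forall b, b \in S -> u a b <= u a (par a).
Hypothesis vz : forall a, v' (z a) = (u a (par a))%:E.
Hypothesis z_indep : forall (n : L0 -> F) a, n a = 1 ->
  (v' (\sum_b j (n b) * z b)%R <= (u a (par a))%:E)%E.

(** An abstract congruence between the pairs (a, b) and (c, d); it is used for the characters
    [coord a b] and [coord c d] modulo a subgroup. *)
Definition tree_relation (rel : L0 -> L0 -> L0 -> L0 -> Prop) :=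
  [/\ forall a b, rel a b a b,
      forall a b c d e f, rel a b c d -> rel c d e f -> rel a b e f,
      forall a b, a != rho -> b != rho -> a != b -> rel a b b a &
      forall a b c, a != rho -> b != rho -> c != rho -> a != b -> b != c -> c != a ->
        u b c = u c a -> u b c < u a b -> rel b c c a].

Definition no_equal_triple := forall a b c, a != rho -> b != rho -> c != rho ->
  a != b -> b != c -> c != a -> ~ (u a b = u b c /\ u b c = u c a).

(** Induction from the end of the list. The first clause keeps the points in the span of the z_b
    already used, so that a new z_a cannot cancel; the last clause records the parent edge whose z
    leads x_a - x_b. *)
Lemma ultrametric_points E1 S : E = E1 ++ S -> exists x : L0 -> F',
  [/\ forall a, a \in S -> exists2 n : L0 -> F, x a = \sum_b j (n b) * z b &
        forall b, b \notin S -> n b = 0,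
      forall a b, a \in S -> b \in S -> a != b -> v' (x a - x b) = (u a b)%:E &
      no_equal_triple -> forall rel, tree_relation rel ->
        forall a b, a \in S -> b \in S -> a != b -> exists c (e : bool), [/\ c != rho, par c != rho, c != par c,
          leading v' ((-1) ^+ e * z c) (x a - x b) & rel a b c (par c)]].
Proof.
elim: S E1 => [|a S IH] E1 ES; first by exists (fun=> 0); split.
have SE b : b \in a :: S -> b != rho.
  by move=> bS; apply: contraNneq rhoE => <-; rewrite ES mem_cat bS orbT.
have aS : a \notin S.
  by move: uniqE; rewrite ES cat_uniq => /and3P[_ _] /= /andP[].
have [x [xn xv xl]] := IH (rcons E1 a) (etrans ES (esym (cat_rcons _ _ _))).
have [S0|Sn] := eqVneq S [::].
  exists (fun=> 0); rewrite S0; split=> [b _|b c|_ rel _ b c].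
  - by exists (fun=> 0) => //; rewrite big1 // => c _; rewrite rmorph0 mul0r.
  - by rewrite !inE => /eqP -> /eqP ->; rewrite eqxx.
  - by rewrite !inE => /eqP -> /eqP ->; rewrite eqxx.
have [paS hpar] := parP ES Sn; set p := par a in paS hpar.
have ar : a != rho by apply: SE; rewrite inE eqxx.
have sr b : b \in S -> b != rho by move=> bS; apply: SE; rewrite inE bS orbT.
have neqa b : b \in S -> b != a by apply: contraTneq => ->.
pose x' b := if b == a then x p + z a else x b.
have x'S b : b \in S -> x' b = x b by move=> /neqa; rewrite /x' => /negPf ->.
have x'a : x' a = x p + z a by rewrite /x' eqxx.
(* the new point is compared with an old one through its parent *)
have vnew b : b \in S -> b != p -> v' (x p - x b + z a) = (Order.min (u p b) (u a p))%:E.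
  move=> bS bp; have vpb := xv p b paS bS (nsym bp).
  have [lt|ge] := ltP (u p b) (u a p).
    by rewrite v_addl ?vpb // vz lte_fin.
  apply/le_anti/andP; split; last first.
    by apply: le_trans (vD _ _ _); rewrite le_min vpb vz !lee_fin ge lexx.
  have [n1 e1 n1S] := xn p paS; have [n2 e2 n2S] := xn b bS.
  have := z_indep (n := fun c => n1 c - n2 c + (c == a)%:R) (a := a).
  rewrite n1S // n2S // eqxx subrr add0r => /(_ erefl); congr (v' _ <= _)%E.
  rewrite e1 e2 -sumrB -[z a]mul1r -(rmorph1 j).
  rewrite (eq_bigr (fun c => (j (n1 c) * z c - j (n2 c) * z c)
     + j (c == a)%:R * z c)) => [|c _]; last by rewrite rmorphD rmorphB mulrDl mulrBl.
  rewrite big_split /=; congr (_ + _); rewrite (bigD1 a) //= eqxx big1 ?addr0 // => c.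
  by move=> /negPf ->; rewrite rmorph0 mul0r.
(* All triangles are isosceles. In the case of equality, it is the choice of [p] as the nearest
   marking that excludes a larger [u a b]. *)
have tri b : b \in S -> b != p ->
    [/\ u p b < u a p -> u a b = u p b, u a p < u p b -> u a b = u a p &
        u p b = u a p -> u a b = u a p].
  move=> bS bp; have pr := sr p paS; have br := sr b bS; have na := neqa b bS.
  have np := neqa p paS.
  have h1 := uu ar pr br (nsym np) (nsym bp) na.
  have h2 := uu pr br ar (nsym bp) na (nsym np).
  have h3 := uu br ar pr na (nsym np) (nsym bp).
  have h4 := hpar b bS.
  rewrite (us br ar na) in h1 h2 h3.
  move: h1 h2 h3; rewrite !ge_min => h1 h2 h3.
  by case/orP: h1 => l1; case/orP: h2 => l2; case/orP: h3 => l3; split=> lt; lra.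
have vab b : b \in S -> v' (x' a - x' b) = (u a b)%:E.
  move=> bS; rewrite x'a x'S // addrAC; have [->|bp] := eqVneq b p.
    by rewrite subrr add0r vz.
  rewrite vnew //; have [h1 h2 h3] := tri b bS bp.
  have [lt|lt|e] := ltgtP (u p b) (u a p).
  - by rewrite h1 // min_l // ltW.
  - by rewrite h2 // min_r // ltW.
  - by rewrite h3 // ?e ?minxx.
have vxx (b c : L0) : v' (x' b - x' c) = v' (x' c - x' b) by rewrite -vN opprB.
exists x'; split.
- move=> b; rewrite inE; have [-> _|nb /= bS] := eqVneq b a.
    have [n e nS] := xn p paS; exists (fun c => n c + (c == a)%:R); last first.
      by move=> c; rewrite inE negb_or => /andP[/negPf -> /nS ->]; rewrite addr0.
    rewrite x'a e [RHS](eq_bigr (fun c => j (n c) * z c + j (c == a)%:R * z c)) => [|c _].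
      rewrite big_split /=; congr (_ + _); rewrite (bigD1 a) //= eqxx rmorph1 mul1r.
      by rewrite big1 ?addr0 // => c /negPf ->; rewrite rmorph0 mul0r.
    by rewrite rmorphD mulrDl.
  have [n e nS] := xn b bS; exists n; first by rewrite x'S.
  by move=> c; rewrite inE negb_or => /andP[_ /nS].
- move=> b c; rewrite !inE; have [-> _|nb /= bS] := eqVneq b a.
    by case/orP => [/eqP -> |cS _]; [rewrite eqxx|exact: vab].
  have [-> _ _|nc /= cS bc] := eqVneq c a; last by rewrite !x'S //; exact: xv.
    by rewrite vxx vab // (us ar (sr _ bS) (nsym nb)).
move=> ne rel trel; have [rr rt rs r3] := trel.
have base b : b \in S -> exists c (e : bool),
    [/\ c != rho, par c != rho, c != par c,
        leading v' ((-1) ^+ e * z c) (x' a - x' b) & rel a b c (par c)].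
  move=> bS; rewrite x'a x'S // addrAC; have pr := sr p paS; have br := sr b bS.
  have ap : a != p := nsym (neqa p paS).
  have za0 : z a != 0 by apply: (v_neq0 (v := v') (r := u a p)).
  have [->|bp] := eqVneq b p.
    exists a, false; rewrite subrr add0r mul1r -/p; split=> //.
    exact: leading_refl.
  have [h1 h2 h3] := tri b bS bp; have vpb := xv p b paS bS (nsym bp).
  (* In x_a - x_b = (x_p - x_b) + z_a the summand of smaller valuation leads; a tie would make [a],
     [p], [b] an equal triple. *)
  have [lt|lt|e] := ltgtP (u p b) (u a p).
  - have [c [e [cr pcr cpc lead rl]]] := xl ne rel trel p b paS bS (nsym bp).
    exists c, e; split=> //.
      by apply: leading_addr => //; rewrite -(leading_val lead) vpb vz lte_fin.
    apply: (rt) rl; apply: (rt) (rs _ _ br pr bp).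
    have na := neqa b bS; have ub : u a b = u b p by rewrite h1 // us // nsym.
    apply: (r3 p a b pr ar br) => //; [exact: nsym|exact: nsym|].
    by rewrite h1 // (us pr ar (nsym ap)).
  - exists a, false; rewrite mul1r addrC; split=> //.
      by apply: leading_addr; [exact: leading_refl|rewrite vpb vz lte_fin].
    have na := neqa b bS; apply: (rt) (rs _ _ ar br (nsym na)) _.
    have ub : u b a = u a p by rewrite (us br ar na) h2.
    by apply: (r3 p b a pr br ar) => //; [exact: nsym|rewrite ub].
  - case: (ne a p b ar pr br ap (nsym bp) (neqa b bS)).
    by rewrite e (us br ar (neqa b bS)) h3.
move=> b c; rewrite !inE; have [-> _|nb /= bS] := eqVneq b a.
  by case/orP => [/eqP -> |cS _]; [rewrite eqxx|exact: base].
have [-> _ _|nc /= cS bc] := eqVneq c a; last first.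
  by rewrite !x'S //; exact: xl.
have [d [e [dr pdr dd lead rl]]] := base b bS; exists d, (~~ e); split=> //.
  have := leadingN lead; rewrite opprB; congr (leading _ _ _).
  by case: (e); rewrite !(expr1, expr0, mulN1r, mul1r, opprK).
by apply: (rt) rl; apply: rs => //; exact: sr.
Qed.
End UltrametricPoints.

(** * Extending the vanishing from K-points to larger fields *)

Section SeparatelyPolynomial.
Variables (K F : fieldType) (i : {rmorphism K -> F}) (T : finType).
Hypothesis natK : forall m n : nat, m%:R = n%:R :> K -> m = n.

Definition update (e : T -> F) (t : T) (x : F) : T -> F :=
  fun t' => if t' == t then x else e t'.

(** Polynomiality in each variable with the others fixed is enough to propagate zeros and avoids
    polynomials in several variables. *)
Definition separately_poly (Q : (T -> F) -> F) :=
  forall e t, exists p : {poly F}, forall x, Q (update e t x) = p.[x].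

Lemma separately_poly_const c : separately_poly (fun=> c).
Proof. by move=> e t; exists c%:P => x; rewrite hornerC. Qed.

Lemma separately_poly_var t0 : separately_poly (fun e => e t0).
Proof.
move=> e t; rewrite /update; have [_|_] := eqVneq t0 t.
  by exists 'X => x; rewrite hornerX.
by exists (e t0)%:P => x; rewrite hornerC.
Qed.

Lemma separately_polyD Q Q' : separately_poly Q -> separately_poly Q' ->
  separately_poly (fun e => Q e + Q' e).
Proof.
move=> h h' e t; have [p hp] := h e t; have [p' hp'] := h' e t.
by exists (p + p') => x; rewrite hornerD hp hp'.
Qed.

Lemma separately_polyM Q Q' : separately_poly Q -> separately_poly Q' ->
  separately_poly (fun e => Q e * Q' e).
Proof.
move=> h h' e t; have [p hp] := h e t; have [p' hp'] := h' e t.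
by exists (p * p') => x; rewrite hornerM hp hp'.
Qed.

Lemma separately_polyN Q : separately_poly Q -> separately_poly (fun e => - Q e).
Proof. by move=> h e t; have [p hp] := h e t; exists (- p) => x; rewrite hornerN hp. Qed.

Lemma separately_polyX Q n : separately_poly Q -> separately_poly (fun e => Q e ^+ n).
Proof.
by move=> h e t; have [p hp] := h e t; exists (p ^+ n) => x; rewrite horner_exp hp.
Qed.

Lemma separately_poly_sum (X : Type) (s : seq X) (Q : X -> (T -> F) -> F) :
  (forall k, separately_poly (Q k)) ->
  separately_poly (fun e => \sum_(k <- s) Q k e).
Proof.
move=> h; elim: s => [|k s IH] e t.
  by exists 0 => x; rewrite big_nil horner0.
have [p hp] := IH e t; have [p' hp'] := h k e t.
by exists (p' + p) => x; rewrite big_cons hornerD hp hp'.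
Qed.

Lemma separately_poly_prod (X : Type) (s : seq X) (Q : X -> (T -> F) -> F) :
  (forall k, separately_poly (Q k)) ->
  separately_poly (fun e => \prod_(k <- s) Q k e).
Proof.
move=> h; elim: s => [|k s IH] e t.
  by exists 1 => x; rewrite big_nil hornerC.
have [p hp] := IH e t; have [p' hp'] := h k e t.
by exists (p' * p) => x; rewrite big_cons hornerM hp hp'.
Qed.

(** The coordinates leave K one at a time: as a function of the coordinate being freed, [Q] is a
    polynomial with more roots, among the natural numbers, than its degree permits. *)
Lemma separately_poly_eq0 Q : separately_poly Q ->
  (forall e : T -> K, Q (i \o e) = 0) -> forall e, Q e = 0.
Proof.
move=> hQ Q0; suff h (S : seq T) e :
    (forall t, t \notin S -> exists k, e t = i k) -> Q e = 0.
  by move=> e; apply: (h (enum T)) => t; rewrite mem_enum.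
elim: S e => [|t S IH] e he.
  have [k hk] := choice (fun t => he t isT).
  by rewrite (_ : e = i \o k) //; apply/funext => t; exact: hk.
have upd : e = update e t (e t).
  by apply/funext => t'; rewrite /update; case: eqP => [->|].
have [p hp] := hQ e t; rewrite upd hp; suff -> : p = 0 by rewrite horner0.
apply: contrapT => /eqP p0.
have := @max_poly_roots _ p [seq i n%:R | n <- iota 0 (size p)] p0.
rewrite size_map size_iota ltnn => h; suff : false by []; apply: h.
  apply/allP => _ /mapP[n _ ->]; rewrite /root -hp; apply/eqP/IH => t' t'S.
  rewrite /update; have [_|ne] := eqVneq t' t; first by exists n%:R.
  by apply: he; rewrite inE negb_or ne.
by rewrite map_inj_uniq ?iota_uniq // => m n /fmorph_inj /natK.
Qed.

End SeparatelyPolynomial.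

Section AffineWedge.
Variables (L0 : finType) (rho : L0).

Definition affine_mark (F : fieldType) (x : L0 -> F) (a : L0) : F * F :=
  if a == rho then (1, 0) else (x a, 1).

Definition affine_wedge (F : fieldType) (x : L0 -> F) (a b : L0) : F :=
  wedge (affine_mark x a) (affine_mark x b).

Lemma affine_wedgeE (F : fieldType) (x : L0 -> F) a b : affine_wedge x a b =
  if a == rho then (b != rho)%:R else if b == rho then -1 else x a - x b.
Proof.
rewrite /affine_wedge /affine_mark /wedge.
case: (a == rho); case: (b == rho); rewrite /= ?mulr0 ?mul0r ?mulr1 ?mul1r ?subrr //.
  by rewrite subr0.
by rewrite sub0r.
Qed.

Lemma affine_wedge_neq0 (F : fieldType) (x : L0 -> F) :
  (forall a b, a != rho -> b != rho -> a != b -> x a != x b) ->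
  forall a b, a != b -> affine_wedge x a b != 0.
Proof.
move=> hx a b ab; rewrite affine_wedgeE.
have [ar|ar] := eqVneq a rho; first by rewrite (_ : b != rho) ?oner_eq0 // -ar eq_sym.
have [br|br] := eqVneq b rho; first by rewrite oppr_eq0 oner_eq0.
by rewrite subr_eq0 hx.
Qed.

End AffineWedge.

Section VanishingExtension.
Variables (L0 : finType) (rho : L0) (r : nat).
Variables (K F : fieldType) (i : {rmorphism K -> F}).
Hypothesis natK : forall m n : nat, m%:R = n%:R :> K -> m = n.
Local Notation M := (ambient_char L0 r).
Local Notation T := (L0 + 'I_r)%type.
Local Notation D := (dpairs L0).

Lemma wedge_pointE (W : L0 -> L0 -> F) t W0 t0 (m : M) :
  wedge_point (W := W) (t := t) W0 t0 m =
  (\prod_(p : D) W (val p).1 (val p).2 ^ val m.1 p) * \prod_k t k ^ m.2 0 k.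
Proof. by []. Qed.

(* Multiplying by a high power of the denominators turns evaluation of an
   element of the ideal into a polynomial in the coordinates of the marked
   points, which vanishes on K-points and hence identically. *)
Lemma vanishing_extend (Y : set (torus_point M K)) :
  (forall (x : L0 -> K) t (W0 : forall a b, a != b -> affine_wedge rho x a b != 0)
     (t0 : forall k, t k != 0), Y (wedge_point W0 t0)) ->
  forall f, vanishing_ideal Y f ->
  forall (x : L0 -> F) t (W0 : forall a b, a != b -> affine_wedge rho x a b != 0)
     (t0 : forall k, t k != 0), gmap_eval i (wedge_point W0 t0) f = 0.
Proof.
move=> hY f If x t W0 t0.
(* Bounds the absolute value of every exponent in [f], so that adding [B] makes all of them
   nonnegative. *)
pose B := (\sum_(m <- gsupp f) (\sum_(p : D) `|val m.1 p| + \sum_k `|m.2 0%R k|))%N.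
have B1 m (p : D) : m \in gsupp f -> 0 <= val m.1 p + B%:Z.
  move=> mf; have : (`|val m.1 p| <= B)%N.
    rewrite /B (big_rem m) //= (bigD1 p) //= -!addnA; exact: leq_addr.
  by lia.
have B2 m k : m \in gsupp f -> 0 <= m.2 0 k + B%:Z.
  move=> mf; have : (`|m.2 0%R k| <= B)%N.
    rewrite /B (big_rem m) //= [X in (_ + X + _)%N](bigD1 k) //=.
    by rewrite [X in (X + _)%N]addnCA -!addnA leq_addr.
  by lia.
pose W (e : T -> F) := affine_wedge rho (e \o inl).
pose mon (e : T -> F) (m : M) := (\prod_(p : D) W e (val p).1 (val p).2 ^+ absz (val m.1 p + B%:Z))
  * \prod_k e (inr k) ^+ absz (m.2 0 k + B%:Z).
(* As a factor of [Q] it enforces zeros also where marks coincide or a torus coordinate is 0, where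
   [Y] gives no information. *)
pose disc (e : T -> F) := (\prod_(p : D) W e (val p).1 (val p).2) * \prod_k e (inr k).
pose Q (e : T -> F) := disc e * \sum_(m <- gsupp f) i (gcoef f m) * mon e m.
have sepW a b : separately_poly (fun e => W e a b).
  have -> : (fun e => W e a b) = (fun e => if a == rho then (b != rho)%:R
      else if b == rho then -1 else e (inl a) - e (inl b)).
    by apply/funext => e; rewrite /W affine_wedgeE.
  case: (a == rho); first exact: separately_poly_const.
  case: (b == rho); first exact: separately_poly_const.
  apply: separately_polyD; first exact: separately_poly_var.
  by apply: separately_polyN; exact: separately_poly_var.
have sepQ : separately_poly Q.
  apply: separately_polyM.
    apply: separately_polyM; first by apply: separately_poly_prod => p; exact: sepW.
    by apply: separately_poly_prod => k; exact: separately_poly_var.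
  apply: separately_poly_sum => m; apply: separately_polyM.
    exact: separately_poly_const.
  apply: separately_polyM.
    by apply: separately_poly_prod => p; apply: separately_polyX; exact: sepW.
  by apply: separately_poly_prod => k; apply: separately_polyX; exact: separately_poly_var.
have evalE (e : T -> F) (V0 : forall a b, a != b -> W e a b != 0)
    (s0 : forall k, e (inr k) != 0) :
    \sum_(m <- gsupp f) i (gcoef f m) * mon e m =
    (\prod_(p : D) W e (val p).1 (val p).2 ^+ B * \prod_k e (inr k) ^+ B)
      * gmap_eval i (wedge_point V0 s0) f.
  rewrite /gmap_eval mulr_sumr big_seq [RHS]big_seq; apply: eq_bigr => m mf.
  rewrite [RHS]mulrCA; congr (_ * _); rewrite wedge_pointE mulrACA -!big_split /=.
  congr (_ * _); apply: eq_bigr => k _ /=.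
    have W1 : W e (val k).1 (val k).2 != 0 by apply: V0; exact: (valP k).
    by rewrite !exprnP gez0_abs ?B1 // addrC expfzDr.
  by rewrite !exprnP gez0_abs ?B2 // addrC expfzDr.
have Q0 e : Q (i \o e) = 0.
  have [d0|d0] := eqVneq (disc (i \o e)) 0; first by rewrite /Q d0 mul0r.
  have WE a b : W (i \o e) a b = i (affine_wedge rho (e \o inl) a b).
    rewrite /W !affine_wedgeE; case: ifP => _; first by rewrite rmorph_nat.
    by case: ifP => _; rewrite ?rmorphN1 //= rmorphB.
  have V0 a b : a != b -> W (i \o e) a b != 0.
    move=> ab; apply: contraNneq d0 => e0; rewrite /disc.
    by rewrite (bigD1 (exist _ (a, b) ab)) //= e0 !mul0r.
  have s0 k : (i \o e) (inr k) != 0.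
    apply: contraNneq d0 => /= e0; rewrite /disc [X in _ * X](bigD1 k) //= e0.
    by rewrite mul0r mulr0.
  have V0' a b : a != b -> affine_wedge rho (e \o inl) a b != 0.
    by move=> /V0; rewrite WE fmorph_eq0.
  have s0' k : e (inr k) != 0 by have := s0 k; rewrite /= fmorph_eq0.
  rewrite /Q (evalE _ V0 s0).
  suff -> : gmap_eval i (wedge_point V0 s0) f = 0 by rewrite !mulr0.
  have := congr1 i (If _ (hY _ _ V0' s0')); rewrite rmorph0 => e0; rewrite -[RHS]e0.
  rewrite rmorph_sum; apply: eq_bigr => m _; rewrite rmorphM; congr (_ * _).
  rewrite !wedge_pointE rmorphM !rmorph_prod; congr (_ * _).
    by apply: eq_bigr => p _; rewrite WE -fmorphXz.
  by apply: eq_bigr => k _; rewrite /= -fmorphXz.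
pose e (k : T) := match k with inl a => x a | inr k => t k end.
have := separately_poly_eq0 natK sepQ Q0 e; rewrite /Q (evalE e W0 t0) => /eqP.
have P1 : \prod_(p : D) W e (val p).1 (val p).2 != 0.
  by apply/prodf_neq0 => p _; apply: W0; exact: (valP p).
have P2 : \prod_k e (inr k) != 0 by apply/prodf_neq0 => k _; exact: t0.
rewrite !prodrXl /disc !mulf_eq0 !expf_eq0 (negPf P1) (negPf P2) !andbF /=.
by move/eqP.
Qed.

End VanishingExtension.

Section Realization.
Variables (L0 : finType) (rho a0 b0 : L0) (r : nat) (R : realType).
Hypotheses (a0rho : a0 != rho) (b0rho : b0 != rho) (a0b0 : a0 != b0).
Local Notation M := (ambient_char L0 r).
Local Notation D := (dpairs L0).
Local Notation T := (L0 + 'I_r)%type.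
Local Notation off_root := (@off_root L0 rho).
Local Notation coord := (coord_char rho a0 b0 r).
Local Notation minus := (minus_char rho r).
Variable s : {additive M -> R}.
Hypothesis ultra_s : ultrametric_char rho coord minus s.
Local Notation u := (fun a b => s (coord a b)).
Variables (F : fieldType) (v : valuation R F).

Definition subgroup_pred (B : M -> Prop) :=
  [/\ B 0, forall m n, B m -> B n -> B (m + n) & forall m, B m -> B (- m)].

Definition tree_relations (B : M -> Prop) :=
  [/\ forall a, a != rho -> B (minus a),
      forall a b, a != rho -> b != rho -> a != b -> B (coord a b - coord b a) &
      forall a b c, a != rho -> b != rho -> c != rho -> a != b -> b != c -> c != a ->
        u b c = u c a -> u b c < u a b -> B (coord b c - coord c a)].

(** The last clause provides what [point_ideal_sub_initial] asks for; the abstract subgroup [B] will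
    be [binomial_mem]. *)
Lemma valued_point : exists (F' : fieldType) (v' : valuation R F')
    (j : {rmorphism F -> F'}) (x : L0 -> F') (t : 'I_r -> F')
    (W0 : forall a b, a != b -> affine_wedge rho x a b != 0)
    (t0 : forall k, t k != 0),
  [/\ forall c, v' (j c) = v c,
      forall m, v' (wedge_point W0 t0 m) = (s m)%:E &
      no_equal_triple rho u ->
      forall B, subgroup_pred B -> tree_relations B ->
      exists phi : M -> {ffun T -> int},
        (forall m m', phi m = phi m' -> B (m - m')) /\
        forall (S : seq M) (c : M -> F), uniq (map phi S) -> forall m, m \in S ->
          (v' (\sum_(n <- S) j (c n) * wedge_point W0 t0 n)%R <= v (c m) + (s m)%:E)%E].
Proof.
have [s_minus ultra] := ultra_s.
pose E := [seq a <- enum L0 | a != rho].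
have uE : uniq E by rewrite filter_uniq // enum_uniq.
have rE : rho \notin E by rewrite mem_filter eqxx.
have memE a : a != rho -> a \in E by move=> ar; rewrite mem_filter ar mem_enum.
have [par parP] := nearest_exists u uE.
pose h (k : T) := match k with inl a => u a (par a) | inr i => s (torus_char L0 i) end.
have [F' [v' [j [z [vj vz ind]]]]] := gauss_extension v h.
have indl (n : L0 -> F) a : n a = 1 ->
    (v' (\sum_b j (n b) * z (inl b))%R <= (u a (par a))%:E)%E.
  move=> na; pose al b : {ffun T -> int} := [ffun k => (k == inl b)%:R].
  have prodE b : \prod_k z k ^ al b k = z (inl b).
    rewrite (bigD1 (inl b)) //= ffunE eqxx expr1z big1 ?mulr1 // => k /negPf kb.
    by rewrite ffunE kb expr0z.
  have ual : uniq (map al (enum L0)).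
    rewrite map_inj_uniq ?enum_uniq // => b b' /ffunP/(_ (inl b)).
    by rewrite !ffunE eqxx; case: eqP => // -[].
  have := ind _ (enum L0) n al ual a (mem_enum _ a); rewrite na v1 add0e.
  rewrite big_enum /=; under eq_bigr do rewrite prodE.
  move/le_trans; apply; rewrite lee_fin (bigD1 (inl a)) //= ffunE eqxx mulr1z.
  rewrite big1 ?addr0 // => k /negPf kb.
  by rewrite ffunE kb mulr0z.
pose z1 a := z (inl a).
have vz1 a : v' (z1 a) = (u a (par a))%:E by exact: vz.
pose t i := z (inr i).
have t0 k : t k != 0 by exact: (v_neq0 (vz (inr k))).
have z10 k : z1 k != 0 by exact: (v_neq0 (vz (inl k))).
have [x [_ xv xl]] := ultrametric_points ultra uE rE parP vz1 indl (E1 := [::]) erefl.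
have xab a b : a != rho -> b != rho -> a != b -> v' (x a - x b) = (u a b)%:E.
  by move=> /memE ? /memE ? ?; exact: xv.
have W0 := affine_wedge_neq0 (rho := rho) (x := x).
have {}W0 : forall a b, a != b -> affine_wedge rho x a b != 0.
  apply: W0 => a b ar br ab; rewrite -subr_eq0; exact: (v_neq0 (xab a b ar br ab)).
have offP (p : D) : ~~ off_root p -> affine_wedge rho x (val p).1 (val p).2 =
    if (val p).1 == rho then 1 else -1.
  rewrite affine_wedgeE negb_and !negbK.
  have [e _|_ /= -> //] := eqVneq (val p).1 rho.
  by have := valP p; rewrite e eq_sym => ->.
have vy m : v' (wedge_point W0 t0 m) = (s m)%:E.
  rewrite (additive_decomp a0rho b0rho a0b0 s m) wedge_pointE.
  rewrite [X in _ - X]big1 => [|p /eqP p1]; last first.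
    by rewrite s_minus ?mul0rz //; have := valP p; rewrite p1 eq_sym.
  rewrite subr0 EFinD vM; congr (_ + _)%E.
    rewrite [in RHS]big_mkcond; apply: v_prodE => p _.
    have [/andP[p1 p2]|op] := boolP (off_root p).
      apply: v_exprzE; rewrite affine_wedgeE (negPf p1) (negPf p2).
      by apply: xab; rewrite // (valP p).
    rewrite offP //; have e1 : v' (if (val p).1 == rho then 1 else -1) = 0%:E.
      by case: ifP => _; rewrite ?vN v1.
    by rewrite (v_exprzE _ e1) mul0rz.
  by apply: v_prodE => k _; apply: v_exprzE; exact: vz.
exists F', v', j, x, t, W0, t0; split=> // ne B [B0 BD BN] [Bm Bs Bt].
have BMz m (k : int) : B m -> B (m *~ k).
  move=> Bmm; have hn (n : nat) : B (m *+ n).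
    by elim: n => // n IH; rewrite mulrS; exact: BD.
  by case: k => n; [exact: hn|rewrite NegzE mulrNz; exact/BN/hn].
have BS (X : Type) (q : seq X) (P : pred X) (f : X -> M) :
    (forall k, P k -> B (f k)) -> B (\sum_(k <- q | P k) f k).
  by move=> hf; apply: big_ind.
pose rel (a b c d : L0) : Prop := B (coord a b - coord c d).
have trel : tree_relation rho u rel.
  split=> [a b|a b c d e f h1 h2|a b|a b c]; rewrite /rel.
  - by rewrite subrr.
  - by have := BD _ _ h1 h2; rewrite addrA subrK.
  - exact: Bs.
  - exact: Bt.
(* Each pair away from [rho] gets the parent edge, with a sign, that leads its difference. *)
have nodes (p : D) : exists ce : L0 * bool, off_root p ->
    [/\ leading v' ((-1) ^+ ce.2 * z1 ce.1) (x (val p).1 - x (val p).2) &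
        rel (val p).1 (val p).2 ce.1 (par ce.1)].
  have [/andP[p1 p2]|_] := boolP (off_root p); last by exists (rho, false).
  have [c [e [_ _ _ h1 h2]]] := xl ne rel trel _ _ (memE _ p1) (memE _ p2) (valP p).
  by exists (c, e).
have {}[node hnode] := choice nodes.
pose cls (p : D) := (node p).1.
(* The exponent vector of the leading monomial of [m]: all pairs led by the same edge contribute to
   the same variable. *)
pose phi (m : M) : {ffun T -> int} := [ffun k => match k with
  | inl c => \sum_(p : D | off_root p && (cls p == c)) val m.1 p
  | inr i => m.2 0 i end].
exists phi; split=> [m m' e|S c uS m mS].
  have d1 c : \sum_(p : D | off_root p && (cls p == c)) val (m - m').1 p = 0.
    have /ffunP/(_ (inl c)) := e; rewrite !ffunE => /eqP; rewrite -subr_eq0 => /eqP.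
    by rewrite -sumrB => e0; rewrite -[RHS]e0; apply: eq_bigr => p _; rewrite !ffunE.
  have d2 i : (m - m').2 0 i = 0.
    by have /ffunP/(_ (inr i)) := e; rewrite !ffunE !mxE => ->; rewrite subrr.
  rewrite (ambient_decomp a0rho b0rho a0b0 (m - m')).
  apply: (BD); last first.
    by apply: BS => i _; rewrite d2 mulr0z.
  apply: (BD); last first.
    apply/BN/BS => p /eqP p1; apply/BMz/Bm.
    by have := valP p; rewrite p1 eq_sym.
  rewrite (eq_bigr (fun p : D => (coord (val p).1 (val p).2
      - coord (cls p) (par (cls p))) *~ val (m - m').1 p +
      coord (cls p) (par (cls p)) *~ val (m - m').1 p)) => [|p _]; last first.
    by rewrite -mulrzDl subrK.
  rewrite big_split /=; apply: (BD).
    by apply: BS => p op; apply: BMz; have [_] := hnode p op.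
  rewrite (partition_big cls xpredT) //=; apply: BS => c _.
  rewrite (eq_bigr (fun p : D => coord c (par c) *~ val (m - m').1 p)) => [|p]; last first.
    by case/andP => _ /eqP ->.
  by rewrite -mulrz_sumr d1 mulr0z.
pose C (p : D) : F := if off_root p then (-1) ^+ (node p).2
  else if (val p).1 == rho then 1 else -1.
pose cc (n : M) := \prod_p C p ^ val n.1 p.
pose lt_ (n : M) := j (cc n) * \prod_k z k ^ phi n k.
have lead n : leading v' (lt_ n) (wedge_point W0 t0 n).
  have -> : lt_ n = (\prod_(p : D) (if off_root p then (-1) ^+ (node p).2 * z1 (cls p)
      else affine_wedge rho x (val p).1 (val p).2) ^ val n.1 p) * \prod_k t k ^ n.2 0 k.
    rewrite /lt_ big_sumType /= mulrA; congr (_ * _); last first.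
      by apply: eq_bigr => k _; rewrite ffunE.
    rewrite rmorph_prod [RHS](eq_bigr (fun p => j (C p) ^ val n.1 p *
        (if off_root p then z1 (cls p) else 1) ^ val n.1 p)) => [|p _]; last first.
      rewrite -expfzMl /C; case: ifP => [_|/negbT/offP ->].
        by rewrite rmorphXn rmorphN1.
      by case: ifP => _; rewrite mulr1 ?rmorphN1 ?rmorph1.
    rewrite [RHS]big_split /=; congr (_ * _).
      by apply: eq_bigr => p _; rewrite fmorphXz.
    rewrite [RHS](bigID off_root) /= [X in _ * X]big1 => [|p /negPf ->]; last first.
      by rewrite exp1rz.
    rewrite mulr1 (partition_big cls xpredT) //=; apply: eq_bigr => c' _.
    rewrite ffunE (big_morph (fun k => z1 c' ^ k) (fun k l => expfzDr k l (z10 c')) (expr0z _)).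
    by apply: eq_bigr => p /andP[-> /eqP ->].
  rewrite wedge_pointE; apply: leadingM; apply: leading_prod => k _; apply: leading_expz.
    case: ifP => [ok|_]; last by apply/leading_refl/W0; exact: (valP k).
    have [h1 _] := hnode k ok; rewrite affine_wedgeE.
    by case/andP: ok => /negPf -> /negPf ->.
  exact: leading_refl.
(* The sum of the leading terms has valuation at most every [w n]. If the full sum had valuation
   above some [w m], hence above the least value [w m0], so would the sum of the leading terms,
   since all corrections have valuation above [w m0]. *)
pose w n := (v (c n) + (s n)%:E)%E.
have vlt n : v' (lt_ n) = (s n)%:E by rewrite -(leading_val (lead n)) vy.
have hA n : n \in S -> (v' (\sum_(n <- S) j (c n) * lt_ n)%R <= w n)%E.
  move=> nS; have := ind _ S (fun n => c n * cc n) phi uS n nS.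
  have vpr : v' (\prod_k z k ^ phi n k) = (\sum_k h k *~ phi n k)%:E.
    by apply: v_prodE => k _; apply: v_exprzE; exact: vz.
  rewrite -vpr.
  rewrite vM -addeA -(vj (cc n)) -vM vlt; congr (v' _ <= _)%E.
  by apply: eq_bigr => k _; rewrite rmorphM mulrA.
have Sn : S != [::] by apply: contraTneq mS => ->.
have [m0 m0S hm0] := seq_argmin w Sn.
rewrite leNgt; apply/negP => lt_m.
have {lt_m} lt0 := le_lt_trans (hm0 m mS) lt_m.
have [mu muE] : exists mu, w m0 = mu%:E.
  have := hm0 m0 m0S; move: lt0; rewrite /w; have := @v_ninfty _ _ v (c m0).
  by case: (v (c m0)) => [q| |] //= _; [exists (q + s m0)|rewrite ltNge leey].
have := hA m0 m0S; rewrite leNgt => /negP; apply; rewrite muE.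
rewrite muE in lt0 hm0.
have -> : \sum_(n <- S) j (c n) * lt_ n = \sum_(n <- S) j (c n) * wedge_point W0 t0 n
    - \sum_(n <- S) j (c n) * (wedge_point W0 t0 n - lt_ n).
  by rewrite -sumrB; apply: eq_bigr => n _; rewrite mulrBr opprB addrC subrK.
apply: lt_le_trans (vB _ _ _); rewrite lt_min lt0 /= big_seq.
apply: v_sum_gt => n nS; have [->|c0] := eqVneq (c n) 0.
  by rewrite rmorph0 mul0r v0 ltry.
apply: le_lt_trans (hm0 n nS) _; have [q vq] := v_fin v c0.
by rewrite /w vM vj vq lteD2lE // -vlt; have [_] := lead n.
Qed.

End Realization.

(** * The algebraic moduli space *)

Local Notation form := Defs.form.

Section Forms.
Variable K : fieldType.
Implicit Types (q p : K * K) (d e : nat) (g : K * K -> K).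

(** [form d] ignores the coefficients beyond [d]; the size bound makes products of polynomials
    correspond to products of forms. *)
Definition is_form d g :=
  exists2 h : {poly K}, (size h <= d.+1)%N & forall q, form d h q = g q.

Lemma form_horner d (h : {poly K}) q : (size h <= d.+1)%N -> q.2 != 0 ->
  form d h q = q.2 ^+ d * h.[q.1 / q.2].
Proof.
move=> sh q2; rewrite (horner_coef_wide _ sh) mulr_sumr; apply: eq_bigr => k _.
have kd : (k <= d)%N by rewrite -ltnS.
have -> : q.2 ^+ d = q.2 ^+ (d - k) * q.2 ^+ k by rewrite -exprD subnK.
by rewrite expr_div_n; field; rewrite expf_neq0.
Qed.

Lemma form_infinity d (h : {poly K}) q : q.2 = 0 -> form d h q = h`_d * q.1 ^+ d.
Proof.
move=> q2; rewrite /form big_ord_recr /= q2 subnn expr0 mulr1 big1 ?add0r // => k _.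
by rewrite expr0n subn_eq0 leqNgt ltn_ord mulr0.
Qed.

Lemma formM d e (h k : {poly K}) q : (size h <= d.+1)%N -> (size k <= e.+1)%N ->
  form (d + e) (h * k) q = form d h q * form e k q.
Proof.
move=> sh sk; have shk : (size (h * k)%R <= (d + e).+1)%N.
  by apply: leq_trans (size_polyMleq _ _) _; lia.
have [q2|q2] := eqVneq q.2 0; last first.
  by rewrite !form_horner // hornerM exprD mulrACA.
rewrite !form_infinity // exprD mulrACA; congr (_ * _).
have de : (d < (d + e).+1)%N by rewrite ltnS leq_addr.
rewrite coefM (bigD1 (Ordinal de)) //= addKn big1 ?addr0 // => i ne.
have {}ne : (i : nat) != d by [].
have [lt|le] := ltnP d i.
  by rewrite nth_default ?mul0r //; apply: leq_trans sh _.
rewrite [k`_ _]nth_default ?mulr0 //; apply: leq_trans sk _.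
by have := ltn_ord i; lia.
Qed.

Lemma is_form_const (c : K) : is_form 0 (fun=> c).
Proof.
exists c%:P; first by rewrite size_polyC_leq1.
by move=> q; rewrite /form big_ord1 coefC eqxx !mulr1.
Qed.

Lemma is_form_wedge p : is_form 1 (fun q => wedge q p).
Proof.
exists (p.2 *: 'X - p.1%:P) => [|q].
  rewrite (leq_trans (size_polyD _ _)) // geq_max size_polyN.
  rewrite (leq_trans (size_scale_leq _ _)) ?size_polyX //=.
  by rewrite (leq_trans (size_polyC_leq1 _)).
rewrite /form /wedge !big_ord_recr big_ord0 /= !coefB !coefZ !coefX !coefC /=.
by ring.
Qed.

Lemma is_formM d e g g' : is_form d g -> is_form e g' ->
  is_form (d + e) (fun q => g q * g' q).
Proof.
move=> [h sh hE] [k sk kE]; exists (h * k) => [|q].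
  by apply: leq_trans (size_polyMleq _ _) _; lia.
by rewrite formM // hE kE.
Qed.

Lemma is_formX d g n : is_form d g -> is_form (n * d) (fun q => g q ^+ n).
Proof.
move=> gf; elim: n => [|n IH]; first exact: is_form_const.
have [h sh hE] := is_formM gf IH; exists h => // q.
by rewrite exprS -hE.
Qed.

Lemma is_form_prod (T : Type) (s : seq T) (P : pred T) (d : T -> nat) (g : T -> K * K -> K) :
  (forall i, is_form (d i) (g i)) ->
  is_form (\sum_(i <- s | P i) d i) (fun q => \prod_(i <- s | P i) g i q).
Proof.
move=> gf; elim: s => [|i s [h sh hE]].
  have [h sh hE] := is_form_const 1; rewrite big_nil; exists h => // q.
  by rewrite big_nil.
have [Pi|Pi] := boolP (P i); last first.
  rewrite big_cons (negPf Pi); exists h => // q.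
  by rewrite big_cons (negPf Pi) hE.
have [k sk kE] := is_formM (gf i) (ex_intro2 _ _ h sh hE).
rewrite big_cons Pi; exists k => // q.
by rewrite big_cons Pi kE.
Qed.

Lemma wedge_eq0_scale p q : p != 0 -> q != 0 -> wedge p q = 0 ->
  exists2 a, a != 0 & q = (a * p.1, a * p.2).
Proof.
case: p q => [p1 p2] [q1 q2] p0 q0; rewrite /wedge /= => /eqP; rewrite subr_eq0 => /eqP e.
have [p10|p10] := eqVneq p1 0; last first.
  exists (q1 / p1); last first.
    by rewrite divfK //; congr pair; rewrite mulrAC [q1 * p2]mulrC -e mulrC mulKf.
  apply: contraNneq q0 => /eqP; rewrite mulf_eq0 invr_eq0 (negPf p10) orbF => /eqP q10.
  move: e; rewrite q10 mulr0 => /eqP; rewrite mulf_eq0 (negPf p10) /= => /eqP ->.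
  by [].
have p20 : p2 != 0 by apply: contraNneq p0 => ->; rewrite p10.
have q10 : q1 = 0.
  by move: e; rewrite p10 mul0r => /esym/eqP; rewrite mulf_eq0 (negPf p20) => /eqP.
exists (q2 / p2); last by rewrite divfK // p10 mulr0 q10.
rewrite mulf_neq0 ?invr_eq0 //; apply: contraNneq q0 => ->.
by rewrite q10.
Qed.

End Forms.

(** * The curve with prescribed marks and prescribed image of the mark at infinity *)

Section AlgebraicCurve.
Variables (R : realType) (r : nat) (Sigma : fan1 R r) (J I : finType).
Variables (c : tangency Sigma J) (i0 : I) (K : fieldType).
Local Notation L0 := (I + J)%type.
Local Notation rho := (inl i0 : L0).
Variables (x : L0 -> K) (t : 'I_r -> K).
Hypothesis W0 : forall a b, a != b -> affine_wedge rho x a b != 0.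
Hypothesis t0 : forall k, t k != 0.
Implicit Types (q p : K * K) (m n : 'rV[int]_r) (j : J).

Let mk : L0 -> K * K := affine_mark rho x.
Let L j q := wedge q (mk (inr j)).
(** The order of the pullback of the character [m] at the mark of [j]. The curve is given by sending
    [m] to [tch m] times the product of the linear forms [L j] to these powers. *)
Let ex m j : int := (tord c j)%:Z * pairing m (prim (tray c j)).
Let tch m := \prod_k t k ^ m 0 k.

Lemma pairingDl m n w : pairing (m + n) w = pairing m w + pairing n w.
Proof. by rewrite -big_split; apply: eq_bigr => k _; rewrite mxE mulrDl. Qed.

Lemma pairing0l w : pairing (0 : 'rV[int]_r) w = 0.
Proof. by rewrite /pairing big1 // => k _; rewrite mxE mul0r. Qed.

Lemma pairing_sumr m (T : finType) (P : pred T) (a : T -> int) (w : T -> 'rV[int]_r) :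
  pairing m (\sum_(i | P i) a i *: w i) = \sum_(i | P i) a i * pairing m (w i).
Proof.
under [RHS]eq_bigr do rewrite mulr_sumr.
rewrite exchange_big; apply: eq_bigr => k _ /=; rewrite summxE mulr_sumr.
by apply: eq_bigr => i _; rewrite mxE mulrCA.
Qed.

(** The balancing condition; it makes the pulled back characters homogeneous of degree 0. *)
Lemma contact_sum m : \sum_j ex m j = 0.
Proof.
transitivity (pairing m (\sum_rho (\sum_(j | tray c j == rho) tord c j)%N%:Z *: prim rho)).
  rewrite pairing_sumr (partition_big (tray c) xpredT) //=; apply: eq_bigr => w _.
  rewrite -natz natr_sum mulr_suml; apply: eq_bigr => j /eqP jw.
  by rewrite /ex jw natz.
by rewrite tbalanced /pairing big1 // => k _; rewrite mxE mulr0.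
Qed.

Let cone_at q := omap (tray c) [pick j | L j q == 0].

Lemma contact_unique q j j' : q != 0 -> L j q = 0 -> L j' q = 0 -> j = j'.
Proof.
move=> q0 hj hj'; apply: contrapT => /eqP ne.
have /W0 : inr j != inr j' :> L0 by [].
rewrite -[affine_wedge _ _ _ _]/(wedge (mk (inr j)) (mk (inr j'))).
have mk0 l : mk l != 0.
  rewrite /mk /affine_mark; case: ifP => _; apply/eqP => -[]; first by move/eqP; rewrite oner_eq0.
  by move=> _ /eqP; rewrite oner_eq0.
have [a a0 ->] := wedge_eq0_scale q0 (mk0 (inr j)) hj.
have [b b0 ->] := wedge_eq0_scale q0 (mk0 (inr j')) hj'.
by move/negP; apply; apply/eqP; rewrite /wedge /=; ring.
Qed.

Lemma cone_atP q j : q != 0 -> L j q = 0 -> cone_at q = Some (tray c j).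
Proof.
move=> q0 Lj; rewrite /cone_at; case: pickP => [j' /eqP Lj'|/(_ j)]; last by rewrite Lj eqxx.
by rewrite (contact_unique q0 Lj Lj').
Qed.

Lemma cone_at_contact q w : cone_at q = Some w -> exists2 j, L j q = 0 & tray c j = w.
Proof.
by rewrite /cone_at; case: pickP => //= j /eqP Lj [<-]; exists j.
Qed.

(** Since 0 ^ n is 0 for every nonzero integer n, negative ones included, this one formula also
    gives the extension by 0 that [toric_point] demands. *)
Let chi_at q m := tch m * \prod_j L j q ^ ex m j.

Fact chi_at0 q : chi_at q 0 = 1.
Proof.
rewrite /chi_at /tch !big1 ?mulr1 // => [j _|k _]; last by rewrite mxE expr0z.
by rewrite /ex pairing0l mulr0 expr0z.
Qed.

Lemma tch_neq0 m : tch m != 0.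
Proof. by apply/prodf_neq0 => k _; rewrite expfz_neq0. Qed.

Fact chi_atD q m n : q != 0 -> in_dual (cone_at q) m -> in_dual (cone_at q) n ->
  chi_at q (m + n) = chi_at q m * chi_at q n.
Proof.
move=> q0 hm hn; rewrite /chi_at mulrACA; congr (_ * _).
  by rewrite -big_split; apply: eq_bigr => k _; rewrite mxE expfzDr.
rewrite -big_split; apply: eq_bigr => j _ /=.
have -> : ex (m + n) j = ex m j + ex n j by rewrite /ex pairingDl mulrDr.
have [Lj|Lj] := eqVneq (L j q) 0; last exact: expfzDr.
move: hm hn; rewrite (cone_atP q0 Lj) /= => hm hn.
have : 0 <= ex m j by rewrite mulr_ge0.
have : 0 <= ex n j by rewrite mulr_ge0.
by case: (ex m j) => // a; case: (ex n j) => // b _ _; rewrite -PoszD -!exprnP exprD.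
Qed.

Fact chi_at_neq0 q m : q != 0 -> (chi_at q m != 0) = in_perp (cone_at q) m.
Proof.
move=> q0; rewrite /chi_at mulf_eq0 (negPf (tch_neq0 m)) /=.
case E : (cone_at q) => [w|] /=; last first.
  apply/prodf_neq0 => j _; apply: expfz_neq0; apply/eqP => Lj.
  by move: E; rewrite (cone_atP q0 Lj).
have [j Lj jw] := cone_at_contact E; have [p0|p0] := eqVneq (pairing m (prim w)) 0.
  apply/prodf_neq0 => j' _; have [Lj'|Lj'] := eqVneq (L j' q) 0; last exact: expfz_neq0.
  by rewrite /ex (contact_unique q0 Lj' Lj) jw p0 mulr0 expr0z oner_neq0.
apply/negbTE; rewrite negbK (bigD1 j) //= Lj exp0rz.
have /negPf -> : ex m j != 0.
  by rewrite /ex mulf_eq0 jw (negPf p0) orbF eqz_nat -lt0n tord_gt0.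
by rewrite mul0r.
Qed.

Definition toric_at q (q0 : q != 0) : toric_point Sigma K :=
  ToricPoint (chi_at0 q) (fun m n => @chi_atD q m n q0) (fun m => chi_at_neq0 m q0).

Lemma toric_point_ext (y z : toric_point Sigma K) :
  orbit_cone y = orbit_cone z -> chi y =1 chi z -> y = z.
Proof.
case: y z => [o f f0 fD fn] [o' f' f0' fD' fn'] /= eo /funext ef.
by case: o' / eo fD' fn' => fD' fn'; case: f' / ef f0' fD' fn' => *;
  congr ToricPoint; exact: Prop_irrelevance.
Qed.

Let infty : K * K := mk rho.

Lemma infty_neq0 : infty != 0.
Proof. by rewrite /infty /mk /affine_mark eqxx; apply/eqP => -[] /eqP; rewrite oner_eq0. Qed.

Lemma L_infty j : L j infty = 1.
Proof. by rewrite /L /infty /mk /affine_mark eqxx /wedge /=; ring. Qed.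

Definition curve_map q : toric_point Sigma K :=
  if pselect (q != 0) is left q0 then toric_at q0 else toric_at infty_neq0.

Lemma curve_mapE q (q0 : q != 0) : curve_map q = toric_at q0.
Proof.
by rewrite /curve_map; case: pselect => // q1; congr toric_at; exact: Prop_irrelevance.
Qed.

Lemma curve_map_chi q m : q != 0 -> curve_map q m = chi_at q m.
Proof. by move=> q0; rewrite (curve_mapE q0). Qed.

Lemma curve_map_cone q : q != 0 -> orbit_cone (curve_map q) = cone_at q.
Proof. by move=> q0; rewrite (curve_mapE q0). Qed.

Lemma in_chartP q sigma : q != 0 ->
  reflect (forall j, L j q = 0 -> Some (tray c j) = sigma) (in_chart sigma (curve_map q)).
Proof.
move=> q0; rewrite /in_chart curve_map_cone //; apply: (iffP orP) => [h j Lj|h].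
  by move: h; rewrite (cone_atP q0 Lj) => -[|/eqP].
case E : (cone_at q) => [w|]; [right|by left].
by have [j /h <- ->] := cone_at_contact E.
Qed.

(* The characters pull back to ratios of forms; [P] splits off the contact
   points at a given point. *)
Let num m (P : pred J) q := tch m * \prod_(j | P j && (0 <= ex m j)) L j q ^+ `|ex m j|.
Let den m (P : pred J) q := \prod_(j | P j && (ex m j < 0)) L j q ^+ `|ex m j|.
Let deg m (P : pred J) := (\sum_(j | P j && (0 <= ex m j)%R) `|ex m j|)%N.
Let deg' m (P : pred J) := (\sum_(j | P j && (ex m j < 0)%R) `|ex m j|)%N.

Lemma num_form m P : is_form (deg m P) (num m P).
Proof.
have h : is_form (\sum_(j | P j && (0 <= ex m j)%R) `|ex m j| * 1)%N
    (fun q => \prod_(j | P j && (0 <= ex m j)) L j q ^+ `|ex m j|).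
  by apply: is_form_prod => j; apply: is_formX; exact: is_form_wedge.
have := is_formM (is_form_const (tch m)) h; rewrite add0n.
by under eq_bigr do rewrite muln1.
Qed.

Lemma den_form m P : is_form (deg' m P) (den m P).
Proof.
have h : is_form (\sum_(j | P j && (ex m j < 0)%R) `|ex m j| * 1)%N
    (fun q => \prod_(j | P j && (ex m j < 0)) L j q ^+ `|ex m j|).
  by apply: is_form_prod => j; apply: is_formX; exact: is_form_wedge.
by move: h; under eq_bigr do rewrite muln1.
Qed.

Lemma prod_num_den m (P : pred J) q :
  tch m * \prod_(j | P j) L j q ^ ex m j = num m P q / den m P q.
Proof.
rewrite /num /den -mulrA; congr (_ * _).
rewrite (bigID (fun j => 0 <= ex m j)) /=; congr (_ * _).
  by apply: eq_bigr => j /andP[_ j0]; rewrite -{1}(gez0_abs j0).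
rewrite -prodfV; apply: eq_big => [j|j /andP[_]]; rewrite -ltNge // => j0.
have e : ex m j = - (`|ex m j|%N)%:Z by rewrite ltz0_abs // opprK.
by rewrite {1}e -exprnN.
Qed.

Lemma degE m (P : pred J) : (deg m P)%:Z - (deg' m P)%:Z = \sum_(j | P j) ex m j.
Proof.
rewrite /deg /deg' [RHS](bigID (fun j => 0 <= ex m j)) /= -!natz !natr_sum -sumrN.
congr (_ + _).
  by apply: eq_bigr => j /andP[_ j0]; rewrite natz gez0_abs.
apply: eq_big => [j|j /andP[_ j0]]; first by rewrite ltNge.
by rewrite natz ltz0_abs // opprK.
Qed.

Lemma curve_morphism : is_morphism curve_map.
Proof.
split=> [a q a0 q0|sigma p p0 /(in_chartP _ p0) hp|sigma p m p0 /(in_chartP _ p0) hp hm].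
- have aq0 : (a * q.1, a * q.2) != 0.
    apply: contraNneq q0 => -[/eqP + /eqP]; rewrite !mulf_eq0 (negPf a0) /=.
    by case: q => q1 q2 /= /eqP -> /eqP ->.
  have LE j : L j (a * q.1, a * q.2) = a * L j q by rewrite /L /wedge /=; ring.
  apply: toric_point_ext => [|m].
    rewrite !curve_map_cone // /cone_at; congr omap; apply: eq_pick => j.
    by rewrite LE mulf_eq0 (negPf a0).
  rewrite !curve_map_chi // /chi_at; congr (_ * _).
  under eq_bigr do rewrite LE expfzMl.
  rewrite big_split /= -[X in X * _](_ : 1 = _) ?mul1r //.
  by rewrite -(big_morph (fun k => a ^ k) (fun k l => expfzDr k l a0) (expr0z _)) contact_sum.
- have [h sh hE] : is_form (\sum_(j | Some (tray c j) != sigma) 1)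
      (fun q => \prod_(j | Some (tray c j) != sigma) L j q).
    by apply: is_form_prod => j; exact: is_form_wedge.
  exists (\sum_(j | Some (tray c j) != sigma) 1)%N, h; rewrite hE; split.
    by apply/prodf_neq0 => j; apply: contraNneq => /hp ->.
  move=> q q0; rewrite hE => /prodf_neq0 hq; apply/in_chartP => // j Lj.
  by apply/eqP; apply: contraT => /hq; rewrite Lj eqxx.
- have [h sh hE] := num_form m xpredT; have [k sk kE] := den_form m xpredT.
  have dd : deg m xpredT = deg' m xpredT.
    by have := degE m xpredT; rewrite contact_sum => /eqP; rewrite subr_eq0 => /eqP[].
  rewrite -dd in sk kE; exists (deg m xpredT), h, k; rewrite kE; split.
    apply/prodf_neq0 => j /= jn; rewrite expf_neq0 //; apply: contraTneq jn => /hp e.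
    by rewrite -leNgt mulr_ge0 //; move: hm; rewrite -e.
  by move=> q q0 _ _; rewrite hE kE curve_map_chi // -prod_num_den.
Qed.

Lemma curve_boundary : exists2 q, q != 0 & orbit_cone (curve_map q) = None.
Proof.
exists infty; first exact: infty_neq0.
rewrite curve_map_cone ?infty_neq0 // /cone_at; case: pickP => // j.
by rewrite L_infty oner_eq0.
Qed.

(** The linear form of a mark at [p] is a multiple of [wedge q p]. If [m] pairs to 1 with the ray,
    these factors have total order [n], and the remaining ones do not vanish at [p]. *)
Lemma curve_tangency w p : p != 0 -> has_pullback_mult curve_map w p
  (\sum_(j | (tray c j == w) && (wedge (mk (inr j)) p == 0%R)) tord c j).
Proof.
move=> p0; rewrite /has_pullback_mult.
have LW j : (wedge (mk (inr j)) p == 0) = (L j p == 0).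
  by rewrite /L -oppr_eq0; congr (_ == 0); rewrite /wedge; ring.
rewrite (eq_bigl (fun j => (tray c j == w) && (L j p == 0))) => [|j]; last by rewrite LW.
case: (in_chartP (Some w) p0) => [hp m m1|hn]; last first.
  rewrite big_pred0 // => j; apply/negP => /andP[/eqP jw /eqP Lj]; apply: hn => j' Lj'.
  by rewrite (contact_unique p0 Lj' Lj) jw.
rewrite (eq_bigl (fun j => L j p == 0)) => [|j]; last first.
  by apply: andb_idl => /eqP /hp[->].
set n := (\sum_(j | L j p == 0%R) tord c j)%N.
have exZ j : L j p == 0 -> ex m j = tord c j.
  by move=> /eqP /hp[e]; rewrite /ex e m1 mulr1.
have scale j : exists a, a != 0 /\ (L j p == 0 -> forall q, L j q = a * wedge q p).
  have [Lj|_] := eqVneq (L j p) 0; last by exists 1; rewrite oner_neq0.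
  have mk0 : mk (inr j) != 0.
    by apply/eqP => -[_ /eqP]; rewrite oner_eq0.
  have [a a0 e] := wedge_eq0_scale p0 mk0 Lj; exists a; split=> // _ q.
  by rewrite /L e /wedge /=; ring.
have [al hal] := choice scale.
pose A := \prod_(j | L j p == 0) al j ^+ tord c j.
have A0 : A != 0 by apply/prodf_neq0 => j _; rewrite expf_neq0 //; case: (hal j).
pose P j := L j p != 0.
have [h sh hE] := is_formM (is_form_const A) (num_form m P).
have [k sk kE] := den_form m P.
have dE : deg' m P = (n + deg m P)%N.
  have := contact_sum m; rewrite (bigID (fun j => L j p == 0)) /= -(degE m P).
  rewrite (eq_bigr (fun j => (tord c j)%:Z)) => [|j /exZ //].
  have -> : \sum_(j | L j p == 0) (tord c j)%:Z = n%:Z.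
    by rewrite -natz natr_sum; apply: eq_bigr => j _; rewrite natz.
  by lia.
rewrite add0n in hE; exists (deg m P), h, k; rewrite -dE hE kE; split.
- rewrite mulf_neq0 // mulf_neq0 ?tch_neq0 //; apply/prodf_neq0 => j /andP[Pj _].
  exact: expf_neq0.
- by apply/prodf_neq0 => j /andP[Pj _]; exact: expf_neq0.
move=> q q0 _ _; rewrite kE hE curve_map_chi //.
transitivity (wedge q p ^+ n * (A * (num m P q / den m P q))); last by rewrite !mulrA.
rewrite -prod_num_den /chi_at (bigID (fun j => L j p == 0)) /= mulrCA.
rewrite (eq_bigr (fun j => al j ^+ tord c j * wedge q p ^+ tord c j)) => [|j Zj].
  by rewrite big_split /= prodrXr -/A -/n; ring.
by rewrite exZ // -exprnP; have [_ ->] := hal j; rewrite // exprMn.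
Qed.

Lemma mk_neq0 l : mk l != 0.
Proof.
rewrite /mk /affine_mark; case: ifP => _; apply/eqP => -[]; first by move/eqP; rewrite oner_eq0.
by move=> _ /eqP; rewrite oner_eq0.
Qed.

Definition affine_curve : alg_curve I c K :=
  @AlgCurve _ _ _ _ _ c K mk mk_neq0 W0 curve_map curve_morphism curve_boundary
    curve_tangency.

Lemma wedge_point_Mlab : Mlab c i0 (wedge_point W0 t0).
Proof.
exists affine_curve => m; rewrite wedge_pointE; congr (_ * _).
rewrite -[RHS]/(curve_map infty m.2) curve_map_chi ?infty_neq0 // /chi_at.
by rewrite [X in _ * X]big1 ?mulr1 // => j _; rewrite L_infty exp1rz.
Qed.

End AlgebraicCurve.

Lemma Mlab_wedge (R : realType) (r : nat) (Sigma : fan1 R r) (J I : finType)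
    (c : tangency Sigma J) (i0 : I) (K : fieldType) (y : torus_point _ K) :
  Mlab c i0 y -> exists (W : (I + J)%type -> (I + J)%type -> K) (g : 'rV[int]_r -> K),
    [/\ forall a b, a != b -> W a b != 0, forall a b, W b a = - W a b,
        forall a b c d, W a b * W c d + W b c * W a d + W c a * W b d = 0,
        g 0 = 1 & forall m, y m = wedge_prod W (val m.1) * g m.2].
Proof.
case=> C yE; exists (fun a b => wedge (mark C a) (mark C b)),
  (fun m => cmap C (mark C (inl i0)) m); split=> //.
- exact: mark_distinct.
- by move=> a b; rewrite /wedge; ring.
- by move=> a b c' d; rewrite /wedge; ring.
- exact: chi0.
Qed.

(** * Generic ultrametrics *)

Section Perturbation.
Variables (R : realType) (L0 : finType) (rho : L0) (u : L0 -> L0 -> R).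
Hypothesis ultra : is_ultrametric rho u.
Variables (a b c : L0) (h : R).
Hypotheses (ar : a != rho) (br : b != rho) (cr : c != rho).
Hypotheses (ab : a != b) (bc : b != c) (ca : c != a).
Hypotheses (uab : u a b = h) (ubc : u b c = h) (uca : u c a = h).

(* Pulls the branches of a and b away from the others at their common branch
   point. *)
Let A x := [|| x == a, x == b, h < u x a | h < u x b].
Definition branch_pair x y : R := [&& A x, A y & u x y == h]%:R.

Let us x y : x != rho -> y != rho -> x != y -> u x y = u y x.
Proof. by case: ultra => ? _; auto. Qed.

(** [A] is the union of the open balls of radius [h] around [a] and [b]. *)
Lemma branch_closed x y : x != rho -> y != rho -> x != y -> A x -> h < u x y -> A y.
Proof.
move=> xr yr xy Ax lt; have yx : y != x by rewrite eq_sym.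
rewrite /A; have [->|ya] := eqVneq y a; rewrite //=.
have [->|yb] := eqVneq y b; rewrite //=.
have uyx : h < u y x by rewrite us.
have step w : w != rho -> y != w -> x != w -> h < u x w -> h < u y w.
  move=> wr yw xw lw; have [_ uu] := ultra; have wy : w != y by rewrite eq_sym.
  have := uu y w x yr wr xr yw (etrans (congr1 negb (eq_sym _ _)) xw) xy.
  rewrite (us wr xr (etrans (congr1 negb (eq_sym _ _)) xw)).
  by apply: lt_le_trans; rewrite lt_min lw.
case/or4P: Ax => [/eqP <-|/eqP <-|l|l]; rewrite ?uyx ?orbT //.
  have [xa|xa] := eqVneq x a; first by rewrite -xa uyx.
  by rewrite (step a).
have [xb|xb] := eqVneq x b; first by rewrite -xb uyx orbT.
by rewrite (step b) ?orbT.
Qed.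

(** The two branches now meet at [h + t], which stays below all values above [h] by the gap
    condition. The shift [k] is there because weights realize a change of distances only up to a
    constant. *)
Lemma branch_pair_ultrametric (t k : R) : 0 < t ->
  (forall x y, h < u x y -> t < u x y - h) ->
  is_ultrametric rho (fun x y => u x y + (t * branch_pair x y - k)).
Proof.
move=> t0 gap; have [_ uu] := ultra.
have symd x y : x != rho -> y != rho -> x != y -> branch_pair x y = branch_pair y x.
  by move=> xr yr xy; rewrite /branch_pair us // andbCA.
split=> [x y xr yr xy|x y z xr yr zr xy yz zx]; first by rewrite us // symd.
have d0 x' y' : 0 <= branch_pair x' y' by rewrite /branch_pair ler0n.
(* The case in which [u] satisfies the inequality through [u y' z']; exchanging [x] and [y] gives
   the other one. *)
have core x' y' z' : x' != rho -> y' != rho -> z' != rho -> x' != y' -> y' != z' ->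
    z' != x' -> u y' z' <= u x' y' ->
    u x' y' + t * branch_pair x' y' < u y' z' + t * branch_pair y' z' ->
    u x' y' + t * branch_pair x' y' < u z' x' + t * branch_pair z' x' -> False.
  move=> xr' yr' zr' xy' yz' zx' le.
  have txy := d0 x' y'; have := erefl (branch_pair y' z').
  rewrite {2}/branch_pair; case E : [&& A y', A z' & u y' z' == h] => ->; last first.
    by rewrite mulr0 addr0 => lt; have := mulr_ge0 (ltW t0) txy; lra.
  case/and3P: E => Ay Az /eqP e; rewrite mulr1 e => lt1 lt2.
  have nn := mulr_ge0 (ltW t0) txy.
  have uxy : u x' y' = h.
    apply/le_anti; rewrite -{2}e le andbT leNgt; apply/negP => /gap; lra.
  have Ax : A x'.
    move: lt2; rewrite {2}/branch_pair; case E : [&& A z', A x' & u z' x' == h].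
      by case/and3P: E.
    by rewrite mulr0 addr0 => lt2; apply: (branch_closed zr' xr' zx' Az); lra.
  by move: lt1; rewrite /branch_pair Ax Ay uxy eqxx mulr1 ltxx.
rewrite leNgt; apply/negP; rewrite lt_min => /andP[l1 l2].
have := uu x y z xr yr zr xy yz zx; rewrite ge_min => /orP[le|le].
  by apply: (core x y z) => //; lra.
have yx : y != x by rewrite eq_sym.
have xz : x != z by rewrite eq_sym.
have zy : z != y by rewrite eq_sym.
have e1 := us xr yr xy; have e2 := us yr zr yz; have e3 := us zr xr zx.
have d1 := symd x y xr yr xy; have d2 := symd y z yr zr yz; have d3 := symd z x zr xr zx.
rewrite e1 e2 d1 d2 in l1; rewrite e1 e3 d1 d3 in l2; rewrite e1 e3 in le.
by apply: (core y x z) => //; lra.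
Qed.

(** In the opposite direction [u a b] drops below [u b c] and [u c a], which stay equal to [h]
    because [c] lies on neither branch. *)
Lemma branch_pair_not_ultrametric (t k : R) : 0 < t ->
  ~ is_ultrametric rho (fun x y => u x y - (t * branch_pair x y - k)).
Proof.
move=> t0 [_ /(_ a b c ar br cr ab bc ca)]; rewrite /branch_pair.
have Ac : A c = false.
  rewrite /A uca ltxx (negPf ca) [c == b]eq_sym (negPf bc) /=.
  by rewrite us ?ubc ?ltxx // eq_sym.
have -> : A a by rewrite /A eqxx.
have -> : A b by rewrite /A eqxx orbT.
rewrite Ac uab ubc uca eqxx andbF /= mulr0 mulr1 minxx; lra.
Qed.

End Perturbation.

Section Generic.
Variables (L0 : finType) (rho : L0) (M : zmodType) (R : realType).
Variables (coord : L0 -> L0 -> M) (minus : L0 -> M).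
Hypothesis weights : forall d : L0 -> L0 -> R, exists2 w : {additive M -> R},
  forall a, a != rho -> w (minus a) = 0 &
  exists k, forall a b, a != rho -> b != rho -> a != b -> w (coord a b) = d a b - k.

Lemma generic_no_equal_triple (s : {additive M -> R}) :
  is_generic [set s | ultrametric_char rho coord minus s] s ->
  no_equal_triple rho (fun a b => s (coord a b)).
Proof.
case=> [[s0 ultra] [V [V0 VD VZ [e [ms [e0 near]]]]]] a b c ar br cr ab bc ca [e1 e2].
set u := fun a b => s (coord a b) in ultra e1 e2.
pose h := u a b; have hab : u a b = h by [].
have hbc : u b c = h by exact: esym e1.
have hca : u c a = h by exact: esym (etrans e1 e2).
pose d := branch_pair u a b h.
have [g g0 gap] : exists2 g, 0 < g & forall x y, h < u x y -> g <= u x y - h.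
  pose S := [seq u p.1 p.2 - h | p <- enum [pred p : L0 * L0 | h < u p.1 p.2]].
  have [S0|Sn] := eqVneq S [::].
    exists 1 => // x y lt; have : u x y - h \in S.
      by apply/mapP; exists (x, y); rewrite // mem_enum inE.
    by rewrite S0.
  have [g gS gmin] := seq_argmin id Sn.
  exists g.
    by move: gS => /mapP[p]; rewrite mem_enum inE => lt ->; rewrite subr_gt0.
  by move=> x y lt; apply: gmin; apply/mapP; exists (x, y); rewrite // mem_enum inE.
have [w wminus [k wcoord]] := weights d.
pose B := \sum_(m <- ms) `|w m|.
have B0 : 0 <= B by apply: sumr_ge0.
(* [g / 2] is strictly below every gap above [h], and [e / (B + 1)] keeps both perturbations in the
   neighbourhood of [s]. *)
pose t := Num.min (g / 2) (e / (B + 1)).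
have t0 : 0 < t by rewrite lt_min !divr_gt0 // ltr_wpDl.
have tg x y : h < u x y -> t < u x y - h.
  move=> /gap; apply: lt_le_trans; rewrite gt_min; apply/orP; left.
  by rewrite ltr_pdivrMr // ltr_pMr // ltr1n.
have small m : m \in ms -> `|t * w m| < e.
  move=> mm; rewrite normrM gtr0_norm //.
  have le : `|w m| <= B by rewrite /B (big_rem m) //= lerDl sumr_ge0.
  apply: (@le_lt_trans _ _ (t * B)); first by rewrite ler_pM2l.
  have : t <= e / (B + 1) by rewrite ge_min lexx orbT.
  rewrite ler_pdivlMr ?ltr_wpDl // => l; apply: lt_le_trans l.
  by rewrite ltr_pM2l // ltrDl.
pose s1 : {additive M -> R} := s \+ (t \*o w).
pose s2 : {additive M -> R} := s \- (t \*o w).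
have S1 : ultrametric_char rho coord minus s1.
  split=> [x xr|]; first by rewrite /= s0 // wminus // mulr0 addr0.
  have := branch_pair_ultrametric ultra ar br (t * k) t0 tg.
  case=> h1 h2; split=> [x y xr yr xy|x y z xr yr zr xy yz zx].
    have yx : y != x by rewrite eq_sym.
    by rewrite /= !wcoord // !mulrBr; exact: h1.
  by rewrite /= !wcoord // !mulrBr; exact: h2.
have V1 : V (fun m => s1 m - s m).
  by apply: (proj1 (near s1 _)) S1 => m mm; rewrite /= addrAC subrr add0r small.
have := branch_pair_not_ultrametric ultra ar br cr ab bc ca hab hbc hca (k := t * k) t0.
apply; suff [_ [h1 h2]] : ultrametric_char rho coord minus s2.
  split=> [x y xr yr xy|x y z xr yr zr xy yz zx].
    have yx : y != x by rewrite eq_sym.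
    by have := h1 x y xr yr xy; rewrite /= !wcoord // !mulrBr.
  by have := h2 x y z xr yr zr xy yz zx; rewrite /= !wcoord // !mulrBr.
apply: (proj2 (near s2 _)) => [m mm|].
  by rewrite /= addrAC subrr add0r normrN small.
have -> : (fun m => s2 m - s m) = (fun m => -1 * (s1 m - s m)).
  apply/funext => m /=; move: (s m) (t * w m) => p q; ring.
exact: VZ.
Qed.

End Generic.

Section Weights.
Variables (L0 : finType) (rho a0 b0 : L0) (r : nat) (R : realType).
Hypotheses (a0rho : a0 != rho) (b0rho : b0 != rho) (a0b0 : a0 != b0).
Local Notation M := (ambient_char L0 r).
Local Notation D := (dpairs L0).
Local Notation coord := (coord_char rho a0 b0 r).
Local Notation minus := (minus_char rho r).
Implicit Types (d : L0 -> L0 -> R).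

(** Realizes an arbitrary change [d] of the distances as a direction in the ambient space, up to the
    constant [d a0 b0] contributed by the normalizing pair. *)
Definition off_root_weight d (m : M) : R :=
  \sum_(p : D | off_root rho p) d (val p).1 (val p).2 *~ val m.1 p.

Fact off_root_weight_morphism d : zmod_morphism (off_root_weight d).
Proof.
move=> m n; rewrite -sumrB; apply: eq_bigr => p _.
by rewrite -mulrzBr; congr (_ *~ _); rewrite !ffunE.
Qed.
HB.instance Definition _ d :=
  GRing.isZmodMorphism.Build _ _ (off_root_weight d) (off_root_weight_morphism d).

Lemma root_char_off a b (p : D) : off_root rho p ->
  root_char rho a b p = (val p == (a, b))%:R.
Proof.
case/andP => p1 p2; rewrite !ffunE [val p]surjective_pairing !xpair_eqE.
by rewrite (negPf p2) !andbF !subr0.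
Qed.

Lemma off_root_weight_coord d a b : a != rho -> b != rho -> a != b ->
  off_root_weight d (coord a b) = d a b - d a0 b0.
Proof.
move=> ar br ab; have sumE a' b' : a' != rho -> b' != rho -> a' != b' ->
    \sum_(p : D | off_root rho p) d (val p).1 (val p).2 *~ root_char rho a' b' p = d a' b'.
  move=> ar' br' ab'; rewrite (bigD1 (exist _ (a', b') ab')) /off_root /= ?ar' //.
  rewrite root_char_off ?eqxx /off_root /= ?ar' // mulr1z big1 ?addr0 // => p /andP[op np].
  rewrite root_char_off //; case: eqP => [e|_]; last by rewrite mulr0z.
  by case/eqP: np; apply: val_inj.
rewrite /off_root_weight val_coord_char // -(sumE a b) // -(sumE a0 b0) // -sumrB.
by apply: eq_bigr => p _; rewrite !ffunE -mulrzBr.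
Qed.

Lemma off_root_weight_minus d a : a != rho -> off_root_weight d (minus a) = 0.
Proof.
move=> ar; rewrite /off_root_weight big1 // => p /andP[p1 p2].
rewrite val_minus_char // !ffunE [val p]surjective_pairing !xpair_eqE.
by rewrite (negPf p1) (negPf p2) andbF subrr mulr0z.
Qed.

Lemma off_root_weights d : exists2 w : {additive M -> R},
  forall a, a != rho -> w (minus a) = 0 &
  exists k, forall a b, a != rho -> b != rho -> a != b -> w (coord a b) = d a b - k.
Proof.
exists (off_root_weight d); first exact: off_root_weight_minus.
by exists (d a0 b0); exact: off_root_weight_coord.
Qed.

End Weights.

(** * The tropical moduli space *)

Section TropicalModuli.
Variables (L0 : finType) (rho a0 b0 : L0) (r : nat) (R : realType).
Hypotheses (a0rho : a0 != rho) (b0rho : b0 != rho) (a0b0 : a0 != b0).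
Local Notation M := (ambient_char L0 r).
Local Notation D := (dpairs L0).

(* The Gromov product at rho is the length of the common part of two paths
   from rho, which is an ultrametric; the sign in the definition of pl makes
   it the value of the Pluecker character. *)
Lemma Mtrop_ultrametric (Delta : L0 -> 'rV[int]_r) (s : {additive M -> R}) :
  Mtrop Delta rho s ->
  ultrametric_char rho (coord_char rho a0 b0 r) (minus_char rho r) s.
Proof.
case=> C [e [dist [_ hdist sE]]].
pose d a b := if insub (a, b) is Some p then dist p else 0.
have dE a b (ab : a != b) : d a b = dist (exist _ (a, b) ab).
  by rewrite /d insubT; congr dist; apply: val_inj.
have hd a b : a != b -> has_dist (e a) (e b) (d a b).
  by move=> ab; rewrite (dE a b ab); exact: hdist (exist _ (a, b) ab).
(* The Pluecker part of [s], extended to exponent vectors that are not characters, so that it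
   applies to [unit_char] and [root_char]. *)
pose G (f : {ffun D -> int}) : R := \sum_p (f p)%:~R * (- dist p / 2).
have GB f g : G (f - g) = G f - G g.
  by rewrite -sumrB; apply: eq_bigr => p _; rewrite !ffunE rmorphB mulrBl.
have Gu a b : a != b -> G (unit_char a b) = - d a b / 2.
  move=> ab; rewrite /G (bigD1 (exist _ (a, b) ab)) //= ffunE eqxx mul1r -dE.
  rewrite big1 ?addr0 // => p np; rewrite ffunE; case: eqP => [ep|_]; last by rewrite mul0r.
  by case/eqP: np; apply: val_inj.
have sG (m : M) : m.2 = 0 -> s m = G (val m.1).
  move=> m0; rewrite sE m0 [X in _ + X]big1 ?addr0 // => i _.
  by rewrite mxE mul0r.
have dsym a b : a != b -> d a b = d b a.
  by move=> ab; apply: dist_symmetric (hd a b ab) (hd b a _); rewrite eq_sym.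
have paths a : exists p, a != rho -> tree_path (e rho) (e a) p /\ d rho a = path_length (e rho) p.
  have [ar|_] := boolP (a != rho); last by exists [::].
  have ra : rho != a by rewrite eq_sym.
  by have [p h1 h2] := has_dist_path (hd rho a ra); exists p.
have [P hP] := choice paths.
pose g a b := path_length (e rho) (lcp (P a) (P b)).
have gE a b : a != rho -> b != rho -> a != b -> G (root_char rho a b) = g a b.
  move=> ar br ab; have [ta ea] := hP a ar; have [tb eb] := hP b br.
  rewrite !GB !Gu // (dsym a rho ar) (dsym b rho br) (branch_dist ta tb (hd a b ab)) ea eb /g.
  by field.
have coordE a b : a != rho -> b != rho -> a != b ->
    s (coord_char rho a0 b0 r a b) = g a b - g a0 b0.
  move=> ar br ab; rewrite (sG _ (coord_char_torus _ _ _ _ _ _)).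
  by rewrite val_coord_char // GB !gE.
split=> [a ar|].
  rewrite (sG _ (minus_char_torus _ _ _)) val_minus_char // GB.
  have ra : rho != a by rewrite eq_sym.
  by rewrite (Gu a rho) // (Gu rho a) // (dsym a rho ar) subrr.
have gsym a b : g a b = g b a.
  rewrite /g; congr path_length; elim: (P a) (P b) => [|x p IH] [|y q] //=.
  by rewrite eq_sym; case: eqP => [->|//]; rewrite IH.
split=> [a b ar br ab|a b c ar br cr ab bc ca].
  have ba : b != a by rewrite eq_sym.
  by rewrite (coordE a b) // (coordE b a) // gsym.
rewrite (coordE a b) // (coordE b c) // (coordE c a) // -addr_minl lerD2r.
have [ta _] := hP a ar; have [tb _] := hP b br.
have mono q : prefix q (lcp (P a) (P b)) -> path_length (e rho) q <= g a b.
  case/prefixP => q' eq; rewrite /g eq path_length_cat lerDl; apply: path_length_ge0.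
  have [p' [_ [ep _ _]]] := lcp_split (P a) (P b); have [pa _ _] := ta.
  by move: pa; rewrite ep eq -catA !cat_path => /and3P[].
by rewrite ge_min; apply/orP; have /orP[/mono|/mono] := lcp_ultrametric (P a) (P b) (P c);
  [left|right].
Qed.

End TropicalModuli.

Section UltrametricCurve.
Variables (L0 : finType) (rho a0 b0 : L0) (r : nat) (R : realType).
Hypotheses (a0rho : a0 != rho) (b0rho : b0 != rho) (a0b0 : a0 != b0).
Local Notation M := (ambient_char L0 r).
Local Notation D := (dpairs L0).

(* Hence the heights of the ends of the legs drop out of the class of the
   distances modulo the image of Phi. *)
Lemma sum_phi (k : L0 -> R) (m : pl_char L0) :
  \sum_(p : D) (val m p)%:~R * (k (val p).1 + k (val p).2) = 0.
Proof.
have deg l : (\sum_p (val m p)%:~R *+ (((val p).1 == l) + ((val p).2 == l))) = 0 :> R.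
  have /pl_charP/(_ l) h := valP m.
  transitivity ((char_degree l (val m))%:~R : R); last by rewrite h.
  by rewrite rmorph_sum /=; apply: eq_bigr => p _; exact/esym/rmorphMn.
transitivity (\sum_l k l * \sum_p (val m p)%:~R *+ (((val p).1 == l) + ((val p).2 == l))).
  under [RHS]eq_bigr do rewrite big_distrr /=.
  rewrite exchange_big /=; apply: eq_bigr => p _.
  have kE l : \sum_l' k l' *+ (l == l') = k l.
    rewrite (bigD1 l) //= eqxx mulr1n big1 ?addr0 // => l' /negPf nl.
    by rewrite eq_sym nl.
  rewrite -[k _ in LHS](kE) -[k _ in X in _ + X]kE -big_split /= mulr_sumr.
  by apply: eq_bigr => l _; rewrite -mulrnDr mulrC mulrnAl mulrnAr.
by rewrite big1 // => l _; rewrite deg mulr0.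
Qed.

Lemma ultrametric_Mtrop (Delta : L0 -> 'rV[int]_r) (s : {additive M -> R}) :
  \sum_l Delta l = 0 ->
  ultrametric_char rho (coord_char rho a0 b0 r) (minus_char rho r) s ->
  Mtrop Delta rho s.
Proof.
move=> Delta0 [s_minus [usym umin]].
pose u a b := s (coord_char rho a0 b0 r a b).
pose P0 : 'rV[R]_r := \row_i s (torus_char L0 i).
have N1 : (1 < #|finset.setC (finset.set1 rho)|)%N.
  by apply/card_gt1P; exists a0, b0; rewrite !inE.
have [C [e [k [eE e0 dN dr]]]] := ultrametric_curve (u := u) usym umin N1 P0 Delta0.
(* With the value 0 on pairs that contain [rho], one formula covers all distances of
   [ultrametric_curve]. *)
pose w (p : D) := if off_root rho p then u (val p).1 (val p).2 else 0.
exists C, e, (fun p : D => k (val p).1 + k (val p).2 - w p *+ 2); split=> //.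
  case=> -[a b] /= ab; rewrite /w /off_root /=.
  have [ea|ar] := eqVneq a rho.
    by rewrite mul0rn subr0 ea; have [] := dr b; rewrite // -ea eq_sym.
  have [->|br] := eqVneq b rho; last exact: dN.
  by rewrite mul0rn subr0; have [] := dr a.
move=> m; rewrite (additive_decomp a0rho b0rho a0b0 s m) [X in _ - X + _]big1 ?subr0; last first.
  move=> p p1; rewrite s_minus ?mul0rz //; apply: contraTneq (valP p) => p2.
  by rewrite (eqP p1) p2 eqxx.
congr (_ + _); last first.
  by apply: eq_bigr => i _; rewrite e0 mxE mulrzl.
transitivity (\sum_(p : D) (val m.1 p)%:~R * w p); last first.
  have e2 : \sum_(p : D) (1 / 2) * ((val m.1 p)%:~R * (k (val p).1 + k (val p).2)) = 0 :> R.
    by rewrite -mulr_sumr sum_phi mulr0.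
  rewrite -[LHS]subr0 -[X in _ - X]e2 -sumrB.
  by apply: eq_bigr => p _; field.
rewrite big_mkcond; apply: eq_bigr => p _; rewrite /w /u mulrzl.
by case: (off_root rho p); rewrite ?mul0rz.
Qed.

End UltrametricCurve.

(** * Tropicalization *)

Section BaseChangeEval.
Variables (K L F : fieldType) (iota : {rmorphism K -> L}) (j : {rmorphism L -> F}).
Variables (M : zmodType) (y : torus_point M F).

Lemma gmap_eval_gmap (f : group_algebra K M) :
  gmap_eval j y (gmap iota f) = gmap_eval (j \o iota) y f.
Proof.
have sub : {subset gsupp (gmap iota f) <= gsupp f}.
  move=> m; apply: contraLR => mf.
  by rewrite /gsupp mem_finsupp negbK -/(gcoef _ _) gcoef_gmap gcoef_out // rmorph0.
rewrite (gmap_evalE j y (fset_uniq _) sub) /gmap_eval.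
by apply: eq_bigr => m _; rewrite gcoef_gmap.
Qed.

Lemma base_change_eval (I : set (group_algebra K M)) :
  (forall f, I f -> gmap_eval (j \o iota) y f = 0) ->
  forall g, base_change iota I g -> gmap_eval j y g = 0.
Proof.
move=> hI g; apply: (ideal_gen_min (I := [set g | gmap_eval j y g = 0])).
  split=> [|a b /= ea eb|a b /= eb]; first exact: gmap_eval0.
    by rewrite gmap_evalD ea eb addr0.
  by rewrite gmap_evalM eb mulr0.
by move=> _ [f If <-] /=; rewrite gmap_eval_gmap hI.
Qed.

End BaseChangeEval.

Section TropicalUltrametrics.
Variables (L0 : finType) (rho a0 b0 : L0) (r : nat) (R : realType).
Hypotheses (a0rho : a0 != rho) (b0rho : b0 != rho) (a0b0 : a0 != b0).
Local Notation M := (ambient_char L0 r).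
Local Notation coord := (coord_char rho a0 b0 r).
Local Notation minus := (minus_char rho r).
Variables (K : fieldType) (v : valuation R K).
Hypothesis natK : forall m n : nat, m%:R = n%:R :> K -> m = n.
Variable Y : set (torus_point M K).
Hypothesis wedgeY : forall (x : L0 -> K) (t : 'I_r -> K)
  (W0 : forall a b, a != b -> affine_wedge rho x a b != 0) (t0 : forall k, t k != 0),
  Y (wedge_point W0 t0).
Hypothesis relY : plucker_relations rho coord minus (vanishing_ideal Y).
Implicit Types s : {additive M -> R}.

Lemma trop_support_ultrametric s :
  trop_support v (vanishing_ideal Y) s <-> ultrametric_char rho coord minus s.
Proof.
split=> [[l]|us]; first by apply: degeneration_ultrametric relY _ _.
have [F' [v' [j [x [t [W0 [t0 [vj vs _]]]]]]]] := valued_point a0rho b0rho a0b0 us v.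
(* The realized point is both the translating point of the lifting and the point whose
   specialization keeps 1 out of the initial ideal. *)
exists (Lifting vj vs); pose id' : {rmorphism F' -> F'} := idfun.
apply: (initial_ideal_proper (j := id') (fun=> erefl) vs vs).
apply: base_change_eval => f If; exact: (vanishing_extend _ natK wedgeY If).
Qed.

Lemma degeneration_prime s (l : lifting v s) : ultrametric_char rho coord minus s ->
  no_equal_triple rho (fun a b => s (coord a b)) ->
  is_prime (@initial_degeneration _ _ _ _ (vanishing_ideal Y) _ l).
Proof.
move=> us distinct.
have [F' [v' [j [x [t [W0 [t0 [vj vs ind]]]]]]]] :=
  valued_point a0rho b0rho a0b0 us (lift_val l).
have idL := base_change_ideal (vanishing_ideal Y) l.
pose B m := binomial_mem (lift_val l) (base_change (lift_emb l) (vanishing_ideal Y)) (lift_point l) m.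
have [||phi [phiB phi_ind]] := ind distinct B.
- by split; [exact: binomial_mem0|exact: binomial_memD|exact: binomial_memN].
- split=> [a|a b|a b c'].
  + exact: (binomial_minus relY l us).
  + exact: (binomial_swap relY l us).
  + exact: (binomial_triple relY l).
apply: (initial_ideal_prime idL vj (lift_pointE l) vs _ _ phi_ind).
  apply: base_change_eval => f If; exact: (vanishing_extend _ natK wedgeY If).
by move=> m m' /phiB; exact: binomial_mem_gmon.
Qed.

Lemma trop_is_ultrametric :
  trop_is v (vanishing_ideal Y) [set s | ultrametric_char rho coord minus s] (fun=> 1%N).
Proof.
split; first by apply/seteqP; split=> s /= /trop_support_ultrametric.
move=> s gs n; have us := gs.1.
have distinct := generic_no_equal_triple (off_root_weights r a0rho b0rho a0b0) gs.
have w1 (l : lifting v s) := sum_multiplicities_prime (degeneration_prime l us distinct).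
split=> [[l <-]|->]; first exact: w1.
by have /trop_support_ultrametric[l _] := us; exists l.
Qed.

End TropicalUltrametrics.

Lemma leg_direction_sum (R : realType) (r : nat) (Sigma : fan1 R r) (I J : finType)
    (c : tangency Sigma J) : \sum_l leg_direction c (I := I) l = 0.
Proof.
rewrite big_sumType /= big1 // add0r -[RHS](tbalanced c).
rewrite (partition_big (tray c) xpredT) //=; apply: eq_bigr => w _.
rewrite -natz natr_sum scaler_suml; apply: eq_bigr => j /eqP <-.
by rewrite natz.
Qed.

Theorem mainTheorem3 (R : realType) (K : closedFieldType)
    (charK : [pchar K]%R =i pred0) (v : valuation R K)
    (r : nat) (Sigma : fan1 R r) (I J : finType) (c : tangency Sigma J)
    (i0 : I) (card_L0 : (3 <= #|{: I + J}|)%N) :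
  trop_is v (vanishing_ideal (Mlab c i0 (K := K)))
    (Mtrop (leg_direction c (I := I)) (inl i0))
    (fun=> 1%N).
Proof.
pose rho : I + J := inl i0.
have natK (m n : nat) : m%:R = n%:R :> K -> m = n.
  have K0 := (pcharf0P K).1 charK.
  wlog le : m n / (m <= n)%N => [wl|].
    by case: (leqP m n) => [/wl//|/ltnW/wl h e]; apply/esym/h.
  move=> e; apply/eqP; rewrite eqn_leq le /= -subn_eq0 -K0 natrB // e subrr.
  by rewrite eqxx.
have /card_gt1P[a0 [b0 []]] : (1 < #|finset.setC (finset.set1 rho)|)%N.
  by have := card_L0; rewrite -(finset.cardsC (finset.set1 rho)) finset.cards1 add1n ltnS.
rewrite !inE => a0rho b0rho a0b0.
have -> : Mtrop (leg_direction c (I := I)) rho =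
    [set s : {additive _ -> R} | ultrametric_char rho (coord_char rho a0 b0 r) (minus_char rho r) s].
  apply/seteqP; split=> s /=; first exact: Mtrop_ultrametric.
  exact: ultrametric_Mtrop (leg_direction_sum _ c).
apply: trop_is_ultrametric => // [x t W0 t0|]; first exact: wedge_point_Mlab.
by apply: vanishing_plucker_relations => // y; exact: Mlab_wedge.
Qed.
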